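(* Let $n\geq 2$, let $f\in(\mathcal{E}'(\mathbb{R}^n))^n$ be a compactly supported covector-valued distribution, and let $V\subset\mathbb{R}^n$ be a nonempty open set. If $\mathrm{d}f|_V=0$ and $N_1 f$ vanishes to infinite order at some point $x_0\in V$, then $f=\mathrm{d}\phi$ for some $\phi\in\mathcal{E}'(\mathbb{R}^n)$.
   Context: $\mathcal{E}'(\mathbb{R}^n)$ is the space of compactly supported distributions and $\mathcal{D}'(\mathbb{R}^n)$ the space of all distributions on $\mathbb{R}^n$. $f\in(\mathcal{E}'(\mathbb{R}^n))^n$ means $f=(f_1,\dots,f_n)$ with each $f_i\in\mathcal{E}'(\mathbb{R}^n)$. One-forms are identified with vector fields. The exterior derivative of $f$ is given, in the sense of distributions, by $(\mathrm{d}f)_{ij}=\partial_i f_j-\partial_j f_i$. For a scalar distribution $\phi$, $\mathrm{d}\phi=(\partial_1\phi,\dots,\partial_n\phi)$. $\mathrm{d}f|_V=0$ means that all components $(\mathrm{d}f)_{ij}$ vanish as distributions on $V$. Let $\Gamma=\{(z,\theta):\theta\in S^{n-1},\ z\in\theta^\perp\}$ be the manifold of oriented lines, where $(z,\theta)$ represents $t\mapsto z+t\theta$. The X-ray transform of a smooth compactly supported one-form $f$ is $X_1f(z,\theta)=\int_{\mathbb{R}}f(z+t\theta)\cdot\theta\,dt$, and its adjoint is $(X_1^*\psi)_i(x)=\int_{S^{n-1}}\theta_i\,\psi(x-(x\cdot\theta)\theta,\theta)\,d\theta$. The normal operator $N_1=X_1^*X_1$ extends by duality to a map $N_1:(\mathcal{E}'(\mathbb{R}^n))^n\to(\mathcal{D}'(\mathbb{R}^n))^n$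 and is given by the convolution formula $$(N_1f)_i=\sum_{j=1}^n\frac{2x_ix_j}{|x|^{n+1}}\ast f_j .$$ $N_1f$ vanishes to infinite order at $x_0$ if $N_1f$ is smooth in a neighborhood of $x_0$ and $\partial^\beta (N_1f)_i(x_0)=0$ for all multi-indices $\beta\in\mathbb{N}^n$ and all $i=1,\dots,n$. *)

(* Defs.v *)
From HB Require Import structures.
From mathcomp Require Import all_boot all_order all_algebra.
From mathcomp Require Import all_classical all_reals all_analysis.

Set Implicit Arguments.
Unset Strict Implicit.
Unset Printing Implicit Defensive.

Import Order.TTheory GRing.Theory Num.Theory.
Import numFieldNormedType.Exports.

Local Open Scope classical_set_scope.
Local Open Scope ring_scope.

(* Lebesgue measure on R^n is built on [n.-tuple R], which carries the product
   sigma-algebra: it is the image of [lebesgue_measure \x mu_(n-1)] under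
   [(x, t) |-> x :: t]. *)
Section lebesgue_cons.
Context (R : realType) (n : nat).
Let X := measurableTypeR R.
Context (mu : {sigma_finite_measure set (n.-tuple X) -> \bar R}).

Definition cons_pair (p : X * n.-tuple X) : n.+1.-tuple X :=
  [tuple of p.1 :: p.2].

Lemma measurable_cons_pair : measurable_fun setT cons_pair.
Proof. exact: measurable_cons. Qed.

Definition lebesgue_cons : set (n.+1.-tuple X) -> \bar R :=
  pushforward (@lebesgue_measure R \x mu)%E cons_pair.

HB.instance Definition _ := Measure.copy lebesgue_cons
  (measure_function_pushforward__canonical__measure_function_Measure
     _ measurable_cons_pair).

Let lebesgue_cons_sigma_finite : sigma_finite setT lebesgue_cons.
Proof.
have /sigma_finiteP[F [TF ndF Foo]] := sigma_finiteT (@lebesgue_measure R).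
have /sigma_finiteP[G [TG ndG Goo]] := sigma_finiteT mu.
exists (fun k => [set t | F k (thead t) /\ G k [tuple of behead t]]).
  apply/seteqP; split=> // t _ /=.
  have [k _ Fk] : (\bigcup_i F i) (thead t) by rewrite -TF.
  have [l _ Gl] : (\bigcup_i G i) [tuple of behead t] by rewrite -TG.
  exists (maxn k l) => //; split.
    by move: Fk; exact/subsetPset/ndF/leq_maxl.
  by move: Gl; exact/subsetPset/ndG/leq_maxr.
move=> k; have [mF Fk] := Foo k; have [mG Gk] := Goo k; split.
  have -> : [set t | F k (thead t) /\ G k [tuple of behead t]] =
      (fun t : n.+1.-tuple X => tnth t ord0) @^-1` F k `&`
      (fun t : n.+1.-tuple X => [tuple of behead t]) @^-1` G k by [].
  apply: measurableI; rewrite -[X in measurable X]setTI.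
    exact: measurable_tnth.
  exact: measurable_behead.
have preimE : cons_pair @^-1` [set t | F k (thead t) /\ G k [tuple of behead t]]
    = F k `*` G k.
  apply/funext => p; rewrite /preimage /setX /mkset.
  have -> : thead (cons_pair p) = p.1 by exact: theadE.
  by have -> : [tuple of behead (cons_pair p)] = p.2 :> n.-tuple X by exact/val_inj.
rewrite /lebesgue_cons /pushforward preimE product_measure1E//.
by rewrite lte_mul_pinfty// ge0_fin_numE.
Qed.

HB.instance Definition _ := Measure_isSigmaFinite.Build _ _ _ lebesgue_cons
  lebesgue_cons_sigma_finite.

End lebesgue_cons.

Section lebesgue_nil.
Context (R : realType).
Let X := measurableTypeR R.

Definition lebesgue_nil : set (0.-tuple X) -> \bar R := \d_[tuple].

HB.instance Definition _ := Measure.on lebesgue_nil.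

Let lebesgue_nil_sigma_finite : sigma_finite setT lebesgue_nil.
Proof. by apply: fin_num_fun_sigma_finite => //; rewrite measure0. Qed.

HB.instance Definition _ := Measure_isSigmaFinite.Build _ _ _ lebesgue_nil
  lebesgue_nil_sigma_finite.

End lebesgue_nil.

Fixpoint lebesgue_tuple (R : realType) (n : nat) :
    {sigma_finite_measure set (n.-tuple (measurableTypeR R)) -> \bar R} :=
  if n is n'.+1 then lebesgue_cons (lebesgue_tuple R n') else @lebesgue_nil R.

Section distributions.
Context {R : realType} {n : nat}.
Local Notation Rn := 'rV[R]_n.
Implicit Types (g phi psi : Rn -> R) (U K : set Rn) (i j : 'I_n).

Definition integral_Rn g : R :=
  (\int[lebesgue_tuple R n]_t g (\row_i tnth t i))%R.

(* The library norm on ['rV[R]_n] is the sup norm. *)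
Definition enorm (x : Rn) : R := Num.sqrt (\sum_i x 0 i ^+ 2).

Definition partial i g : Rn -> R := fun x => 'D_(delta_mx 0 i) g x.

Definition partials (s : seq 'I_n) g : Rn -> R := foldr partial g s.

Definition mpartial (b : 'I_n -> nat) g : Rn -> R :=
  foldr (fun i h => iter (b i) (partial i) h) g (enum 'I_n).

Definition smooth_on U g : Prop :=
  forall (s : seq 'I_n) (x : Rn), U x ->
    {for x, continuous (partials s g)} /\
    forall i, derivable (partials s g) x (delta_mx 0 i).

Definition fsupp g : set Rn := closure [set x | g x != 0].

(* [test_on U] is C_c^oo(U) for U open, and, for K compact, the space of test
   functions on R^n supported in K. *)
Definition test_on U phi : Prop :=
  [/\ smooth_on setT phi, compact (fsupp phi) & fsupp phi `<=` U].

Definition Cseminorm (m : nat) phi : R :=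
  \sum_(b : {ffun 'I_n -> 'I_m.+1} | (\sum_i b i <= m)%N)
     sup (range (fun x => `|mpartial (fun i => b i) phi x|)).

(* A distribution is represented by a functional on all functions R^n -> R, of
   which only the values on test functions are meaningful: everything below,
   including the equality [dist_eq], depends on these values only. *)
Definition functional : Type := (Rn -> R) -> R.
Implicit Types u v : functional.

Definition distribution u : Prop :=
  (forall (a : R) phi psi, test_on setT phi -> test_on setT psi ->
     u (fun x => a * phi x + psi x) = a * u phi + u psi) /\
  (forall K, compact K -> exists (C : R) (m : nat), forall phi,
     test_on K phi -> `|u phi| <= C * Cseminorm m phi).

Definition dist_eq u v : Prop := forall phi, test_on setT phi -> u phi = v phi.

Definition vanishes_on U u : Prop := forall phi, test_on U phi -> u phi = 0.

Definition compact_distribution u : Prop :=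
  distribution u /\ exists2 K, compact K & vanishes_on (~` K) u.

Definition dist_partial i u : functional := fun phi => - u (partial i phi).

Definition cutoff K chi : Prop :=
  test_on setT chi /\
  exists U, [/\ open U, K `<=` U & forall x, U x -> chi x = 1].

(* The pairing of a compactly supported distribution u with a smooth function
   psi is u (chi psi), for any cutoff chi equal to 1 near a compact set off which
   u vanishes; the value does not depend on the choice of K and chi. *)
Definition pairing u psi : R :=
  xget 0 [set c | exists K chi,
    [/\ compact K, vanishes_on (~` K) u, cutoff K chi &
        c = u (fun x => chi x * psi x)]].

(* Convolution of a locally integrable function with a compactly supported
   distribution: <k * u, phi> = <u(y), int k(x - y) phi(x) dx>. *)
Definition convolution (k : Rn -> R) u : functional := fun phi =>
  pairing u (fun y => integral_Rn (fun x => k (x - y) * phi x)).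

Definition ext_diff1 (f : 'I_n -> functional) i j : functional :=
  fun phi => dist_partial i (f j) phi - dist_partial j (f i) phi.

Definition normal_kernel i j (x : Rn) : R :=
  2 * x 0 i * x 0 j / enorm x ^+ n.+1.

Definition normal_op1 (f : 'I_n -> functional) i : functional := fun phi =>
  \sum_j convolution (normal_kernel i j) (f j) phi.

Definition vanishes_infinite_order (F : 'I_n -> functional) (x0 : Rn) : Prop :=
  exists (U : set Rn) (g : 'I_n -> Rn -> R), [/\ open U, U x0 & forall i,
    [/\ smooth_on U (g i),
        forall phi, test_on U phi ->
          F i phi = integral_Rn (fun x => g i x * phi x) &
        forall b : 'I_n -> nat, mpartial b (g i) x0 = 0]].

End distributions.
Arguments functional : clear implicits.

(* Main.v *)
Require Import Defs.
From mathcomp Require Import all_boot all_order all_algebra.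
From mathcomp Require Import all_classical all_reals all_analysis.
From mathcomp Require Import measurable_realfun.
From mathcomp Require Import ring lra.

(** The kernel of the normal operator is 2 z_l z_j / |z|^(n+1), where |z| is the
    Euclidean norm. Up to the gradient of
    the field z_j / |z|^(n-1) it is a constant times the identity matrix times the
    scalar function kappa(z) = 1/|z|^(n-1). Exterior derivatives annihilate gradients,
    so the exterior derivative of the normal operator applied to f is a constant times
    the convolution of kappa with df ([normal_op1_curl]). It remains to show that a
    compactly supported distribution h, here a component of df, vanishes when it
    vanishes near x0 and its convolution with kappa vanishes to infinite order at x0,
    and then to find a primitive of f.

    Since x0 is off the support of h, the derivatives at x0 of the convolution are the
    pairings of h with the derivatives of kappa centered at x0
    ([annihilates_derivatives]); all of them are 0. Linear combinations of the
    derivatives of kappa of orders up to k contain P(z) |z|^(1-n-2k) for every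
    homogeneous polynomial P of degree k ([annihilated_Hom]): the exponent 1 - n, unlike
    the 2 - n of the Newtonian potential, never makes the recursion on the degree
    degenerate. On the support of h, which lies in an annulus around x0 of inner radius
    d, the function g = 1 - d^2 / |z|^2 takes values in an interval [0, q] with q < 1.
    Expanding |z|^2 = d^2 / (1 - g) in a geometric series, which converges with all
    derivatives, shows that h also annihilates P(z) |z|^(1-n) ([damping_argument],
    [damped_Hom_eq0]). The factors P are now all polynomials, and these are dense
    ([weierstrass]), so h = 0 ([density]).

    Thus df = 0 on the whole space. Integrating f along rays parallel to a coordinate
    axis gives a primitive, which does not depend on the axis; as there are at least
    two axes, its support is compact ([poincare]).

    Distributions are controlled through [bnd], a common bound on the derivatives up to
    a given order ([dist_bnd]); in particular a distribution takes the value 0 on a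
    function that it cannot tell apart from functions with arbitrarily small
    derivatives ([dist_small]). *)

Set Implicit Arguments.
Unset Strict Implicit.
Unset Printing Implicit Defensive.

Import Order.TTheory GRing.Theory Num.Theory.
Import numFieldNormedType.Exports.

Local Open Scope classical_set_scope.
Local Open Scope ring_scope.

(** * Differential calculus of smooth functions *)

Section calculus.
Context {R : realType} {n : nat}.
Local Notation Rn := 'rV[R]_n.
Local Notation ei i := (delta_mx 0 i : 'rV[R]_n).
Implicit Types (g : Rn -> R) (x y : Rn) (U : set Rn) (i : 'I_n) (s : seq 'I_n).

Lemma line_quotient g x (v : Rn) (t : R) :
  (fun h : R => h^-1 *: (((fun r : R => g (x + r *: v)) \o shift t) (h *: 1)
     - g (x + t *: v))) =
  (fun h : R => h^-1 *: ((g \o shift (x + t *: v)) (h *: v) - g (x + t *: v))).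
Proof.
apply/funext => h /=; congr (_ *: (g _ - _)).
by rewrite [h *: 1]mulr1 scalerDl addrCA.
Qed.

Lemma is_derive_line g x (v : Rn) (t d : R) :
  is_derive (x + t *: v) v g d -> is_derive t (1 : R) (fun r => g (x + r *: v)) d.
Proof.
move=> [dg <-]; split; rewrite /derivable /derive line_quotient//.
Qed.

Lemma is_derive_of_line g x (v : Rn) (d : R) :
  is_derive (0 : R) (1 : R) (fun r => g (x + r *: v)) d -> is_derive x v g d.
Proof.
move=> [dg <-]; have Q := line_quotient g x v 0.
rewrite scale0r addr0 in Q.
split; rewrite /derivable /derive -Q.
  by move: dg; rewrite /derivable /= scale0r addr0.
by rewrite scale0r [x + 0]addr0.
Qed.

Lemma partial_near i g1 g2 x :
  (\near x, g1 x = g2 x) -> partial i g1 x = partial i g2 x.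
Proof. by move=> g12; rewrite /partial; apply: near_eq_derive. Qed.

Lemma partial_eq_on U i g1 g2 : open U -> (forall x, U x -> g1 x = g2 x) ->
  forall x, U x -> partial i g1 x = partial i g2 x.
Proof.
move=> Uo g12 x Ux; apply: partial_near.
by near=> y; apply: g12; near: y; exact: open_nbhs_nbhs.
Unshelve. all: by end_near. Qed.

Lemma partials_eq_on U s g1 g2 : open U -> (forall x, U x -> g1 x = g2 x) ->
  forall x, U x -> partials s g1 x = partials s g2 x.
Proof. by move=> Uo g12; elim: s => // i s IH x Ux /=; exact: partial_eq_on IH x Ux. Qed.

Lemma near_continuous g1 g2 x : (\near x, g1 x = g2 x) ->
  {for x, continuous g1} -> {for x, continuous g2}.
Proof.
move=> e c; change (g2 @ x --> g2 x); have <- := nbhs_singleton e.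
exact: cvg_trans (near_eq_cvg e) c.
Qed.

Lemma smooth_eq_on U g1 g2 : open U -> (forall x, U x -> g1 x = g2 x) ->
  smooth_on U g1 -> smooth_on U g2.
Proof.
move=> Uo g12 sg s x Ux; have [c d] := sg s x Ux.
have E : \near x, partials s g1 x = partials s g2 x.
  near=> y; apply: (partials_eq_on s Uo g12).
  by near: y; exact: open_nbhs_nbhs.
split; first exact: near_continuous c.
by move=> i; apply: near_eq_derivable E _; exact: d.
Unshelve. all: by end_near. Qed.

Lemma smooth_onW U U' g : U' `<=` U -> smooth_on U g -> smooth_on U' g.
Proof. by move=> UU' sg s x Ux; apply: sg; exact: UU'. Qed.

Lemma partials_rcons s i g : partials (rcons s i) g = partials s (partial i g).
Proof. by rewrite /partials -cats1 foldr_cat. Qed.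

Lemma partials_cat s1 s2 g : partials (s1 ++ s2) g = partials s1 (partials s2 g).
Proof. by rewrite /partials foldr_cat. Qed.

Lemma smooth_partial U g i : smooth_on U g -> smooth_on U (partial i g).
Proof. by move=> sg s x Ux; rewrite -partials_rcons; exact: sg. Qed.

Lemma smooth_partials U g s : smooth_on U g -> smooth_on U (partials s g).
Proof. by move=> sg; elim: s => [|i s IH]; [exact: sg|exact: smooth_partial]. Qed.

Lemma smooth_continuous U g x : smooth_on U g -> U x -> {for x, continuous g}.
Proof. by move=> sg /(sg [::]) []. Qed.

Lemma smooth_derivable U g x i :
  smooth_on U g -> U x -> derivable g x (delta_mx 0 i).
Proof. by move=> sg /(sg [::]) []. Qed.

Lemma partial_cst i (c : R) x : partial i (fun=> c) x = 0.
Proof. by rewrite /partial derive_cst. Qed.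

Lemma partialD i g1 g2 x : derivable g1 x (delta_mx 0 i) ->
  derivable g2 x (delta_mx 0 i) ->
  partial i (fun y => g1 y + g2 y) x = partial i g1 x + partial i g2 x.
Proof. exact: deriveD. Qed.

Lemma partialM i g1 g2 x : derivable g1 x (delta_mx 0 i) ->
  derivable g2 x (delta_mx 0 i) ->
  partial i (fun y => g1 y * g2 y) x = partial i g1 x * g2 x + g1 x * partial i g2 x.
Proof. move=> d1 d2; rewrite addrC [_ * g2 x]mulrC; exact: (deriveM d1 d2). Qed.

(** The functions obtained from the generators [B] by sums and products. Their
    smoothness reduces to that of the generators, provided that the partial
    derivatives of a generator are again such combinations. *)
Inductive alg (B : (Rn -> R) -> Prop) : (Rn -> R) -> Prop :=
| alg_base g : B g -> alg B g
| alg_cst c : alg B (fun=> c)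
| alg_add g1 g2 : alg B g1 -> alg B g2 -> alg B (fun x => g1 x + g2 x)
| alg_mul g1 g2 : alg B g1 -> alg B g2 -> alg B (fun x => g1 x * g2 x).

Lemma alg_smooth U (B : (Rn -> R) -> Prop) : open U ->
  (forall g, B g -> forall x, U x -> {for x, continuous g}) ->
  (forall g i, B g -> exists2 g', alg B g' &
     forall x, U x -> is_derive x (delta_mx 0 i : Rn) g (g' x)) ->
  forall g, alg B g -> smooth_on U g.
Proof.
move=> Uo Bc Bd.
have algc g : alg B g -> forall x, U x -> {for x, continuous g}.
  elim=> [{}g /Bc//|c x _|g1 g2 _ I1 _ I2 x Ux|g1 g2 _ I1 _ I2 x Ux].
  - exact: cst_continuous.
  - exact: (continuousD (I1 x Ux) (I2 x Ux)).
  - exact: (continuousM (I1 x Ux) (I2 x Ux)).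
have algd g : alg B g -> forall i, exists2 g', alg B g' &
     forall x, U x -> is_derive x (delta_mx 0 i : Rn) g (g' x).
  elim=> [{}g Bg i|c i|g1 g2 a1 I1 a2 I2 i|g1 g2 a1 I1 a2 I2 i].
  - exact: Bd.
  - by exists (fun=> 0) => [|x _]; [exact: alg_cst|exact: is_derive_cst].
  - have [h1 b1 d1] := I1 i; have [h2 b2 d2] := I2 i.
    exists (fun x => h1 x + h2 x) => [|x Ux]; first exact: alg_add.
    exact: (@is_deriveD _ _ _ g1 g2 x _ _ _ (d1 x Ux) (d2 x Ux)).
  - have [h1 b1 d1] := I1 i; have [h2 b2 d2] := I2 i.
    exists (fun x => g1 x * h2 x + g2 x * h1 x) => [|x Ux].
      by apply: alg_add; apply: alg_mul.
    exact: (@is_deriveM _ _ g1 g2 x _ _ _ (d1 x Ux) (d2 x Ux)).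
have algp s g : alg B g ->
    exists2 g', alg B g' & forall x, U x -> partials s g x = g' x.
  move=> ag; elim: s => [|i s [g' ag' E]]; first by exists g.
  have [g'' ag'' d] := algd _ ag' i; exists g'' => // x Ux /=.
  by rewrite (partial_eq_on i Uo E Ux); have [_ <-] := d x Ux.
move=> g ag s x Ux; have [g' ag' E] := algp s g ag.
split.
  apply: (near_continuous _ (algc _ ag' _ Ux)).
  by near=> y; rewrite E//; near: y; exact: open_nbhs_nbhs.
move=> i; have [g'' _ /(_ x Ux)[dg' _]] := algd _ ag' i.
apply: near_eq_derivable dg'.
by near=> y; rewrite E//; near: y; exact: open_nbhs_nbhs.
Unshelve. all: by end_near. Qed.

Lemma smooth_alg U g : open U -> alg (smooth_on U) g -> smooth_on U g.
Proof.
move=> Uo; apply: (alg_smooth Uo) => [{}g sg x|{}g i sg].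
  exact: smooth_continuous.
exists (partial i g); first by apply: alg_base; exact: smooth_partial.
by move=> x Ux; split => //; exact: smooth_derivable Ux.
Qed.

Lemma smooth_cst U (c : R) : open U -> smooth_on U (fun=> c).
Proof. move=> Uo; apply: (smooth_alg Uo); exact: alg_cst. Qed.

Lemma smoothD U g1 g2 : open U -> smooth_on U g1 -> smooth_on U g2 ->
  smooth_on U (fun x => g1 x + g2 x).
Proof. move=> Uo s1 s2; apply: (smooth_alg Uo); apply: alg_add; exact: alg_base. Qed.

Lemma smoothM U g1 g2 : open U -> smooth_on U g1 -> smooth_on U g2 ->
  smooth_on U (fun x => g1 x * g2 x).
Proof. move=> Uo s1 s2; apply: (smooth_alg Uo); apply: alg_mul; exact: alg_base. Qed.

Lemma smoothZ U (c : R) g : open U -> smooth_on U g ->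
  smooth_on U (fun x => c * g x).
Proof. move=> Uo sg; apply: (smoothM Uo _ sg); exact: smooth_cst. Qed.

Lemma smoothN U g : open U -> smooth_on U g -> smooth_on U (fun x => - g x).
Proof.
move=> Uo sg; have -> : (fun x => - g x) = (fun x => -1 * g x).
  by apply/funext => x; rewrite mulN1r.
exact: (smoothZ _ Uo sg).
Qed.

Lemma smoothB U g1 g2 : open U -> smooth_on U g1 -> smooth_on U g2 ->
  smooth_on U (fun x => g1 x - g2 x).
Proof. by move=> Uo s1 s2; exact: (smoothD Uo s1 (smoothN Uo s2)). Qed.

Lemma smoothX U g k : open U -> smooth_on U g -> smooth_on U (fun x => g x ^+ k).
Proof.
move=> Uo sg; elim: k => [|k IH].
  by have -> : (fun x => g x ^+ 0) = (fun=> 1) by []; exact: smooth_cst.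
have -> : (fun x => g x ^+ k.+1) = (fun x => g x * g x ^+ k).
  by apply/funext => x; rewrite exprS.
exact: (smoothM Uo sg IH).
Qed.

Lemma smooth_sum U (I : Type) (r : seq I) (P : pred I) (F : I -> Rn -> R) :
  open U -> (forall k, P k -> smooth_on U (F k)) ->
  smooth_on U (fun x => \sum_(k <- r | P k) F k x).
Proof.
move=> Uo sF; elim: r => [|k r IH].
  have -> : (fun x => \sum_(k <- [::] | P k) F k x) = (fun=> 0).
    by apply/funext => x; rewrite big_nil.
  exact: smooth_cst.
have -> : (fun x => \sum_(j <- k :: r | P j) F j x) =
    (fun x => if P k then F k x + \sum_(j <- r | P j) F j x
              else \sum_(j <- r | P j) F j x).
  by apply/funext => x; rewrite big_cons.
case: (P k) (sF k) => [sk|_]; last exact: IH.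
exact: (smoothD Uo (sk isT) IH).
Qed.

Lemma is_derive_affine (a c t : R) : is_derive t (1 : R) (fun r => a + r * c) c.
Proof.
have := @is_deriveD _ _ _ _ _ _ _ _ _ (is_derive_cst a t 1)
  (@is_deriveM _ _ _ _ _ _ _ _ (is_derive_id t 1) (is_derive_cst c t 1)).
by move=> d; apply: (is_derive_eq d); rewrite scaler0 !add0r [LHS]mulr1.
Qed.

Lemma coord_derive x i j :
  is_derive x (delta_mx 0 i : Rn) (fun y => y 0 j) (i == j)%:R.
Proof.
apply: is_derive_of_line.
have -> : (fun r : R => (x + r *: 'e_i) 0 j) =
   (fun r : R => x 0 j + r * (i == j)%:R).
  by apply/funext => s; rewrite !mxE /= eq_sym.
exact: is_derive_affine.
Qed.

Lemma continuous_coord j x : {for x, continuous (fun y : Rn => y 0 j)}.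
Proof. exact: coord_continuous. Qed.

Lemma smooth_coord j U : open U -> smooth_on U (fun y : Rn => y 0 j).
Proof.
move=> Uo; pose B (g : Rn -> R) := exists j, g = (fun y => y 0 j).
apply: (@alg_smooth U B) => //; last by apply: alg_base; exists j.
  by move=> _ [k ->] x _; exact: continuous_coord.
move=> _ i [k ->]; exists (fun=> (i == k)%:R); first exact: alg_cst.
by move=> x _; exact: coord_derive.
Qed.

Lemma partial_coord i j x : partial i (fun y => y 0 j) x = (i == j)%:R.
Proof. by have [_] := coord_derive x i j. Qed.

End calculus.

(** * Mean value theorem and symmetry of second derivatives *)

Section mean_value.
Context {R : realType} {n : nat}.
Local Notation Rn := 'rV[R]_n.
Local Notation ei i := (delta_mx 0 i : 'rV[R]_n).
Implicit Types (g : Rn -> R) (x y v : Rn) (U : set Rn) (i : 'I_n) (s : seq 'I_n).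

Lemma coord_le_norm x i : `|x 0 i| <= `|x|.
Proof. by rewrite [leRHS]mx_normrE (@le_bigmax _ _ _ 0 (fun k : 'I_1 * 'I_n => `|x k.1 k.2|) (0, i)). Qed.

Lemma norm_le_coord x (r : R) : 0 <= r -> (forall i, `|x 0 i| <= r) -> `|x| <= r.
Proof.
move=> r0 xr; rewrite [leLHS]mx_normrE; apply/bigmax_leP; split => // k _.
by rewrite (ord1 k.1); exact: xr.
Qed.

Lemma norm_delta_le i : `|ei i| <= 1.
Proof.
by apply: norm_le_coord => // j; rewrite mxE; case: (_ && _); rewrite ?normr1 ?normr0.
Qed.

Lemma near_normP x (P : Rn -> Prop) : (\near x, P x) <->
  exists2 e : R, 0 < e & forall y, `|y - x| < e -> P y.
Proof.
rewrite nbhs_normP; split=> -[e e0 xe]; exists e => // y yx; apply: xe => /=.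
  by rewrite distrC.
by rewrite distrC.
Qed.

Lemma openP U : open U <->
  forall x, U x -> exists2 e : R, 0 < e & forall y, `|y - x| < e -> U y.
Proof.
rewrite openE; split=> Uo x Ux; have := Uo x Ux; first by move/near_normP.
by move=> /near_normP.
Qed.

Lemma open_norm_lt v (r : R) : open [set x : Rn | `|x - v| < r].
Proof.
apply/openP => x /= xr; exists (r - `|x - v|); first by rewrite subr_gt0.
move=> y; rewrite ltrBrDr; apply: le_lt_trans.
exact: ler_distD.
Qed.

Lemma open_norm_gt v (r : R) : open [set x : Rn | r < `|x - v|].
Proof.
apply/openP => x /= xr; exists (`|x - v| - r); first by rewrite subr_gt0.
move=> y; rewrite ltrBrDr -ltrBrDl => h; apply: lt_le_trans h _.
by rewrite lerBlDr [leRHS]addrC (distrC y x); exact: ler_distD.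
Qed.

Lemma shift_quotient g v x w :
  (fun h : R => h^-1 *: (((fun y => g (y + v)) \o shift x) (h *: w) - g (x + v)))
  = (fun h : R => h^-1 *: ((g \o shift (x + v)) (h *: w) - g (x + v))).
Proof. by apply/funext => h /=; rewrite addrA. Qed.

Lemma partial_shift i g v x : partial i (fun y => g (y + v)) x = partial i g (x + v).
Proof. by rewrite /partial /derive shift_quotient. Qed.

Lemma derivable_shift i g v x :
  derivable g (x + v) (ei i) -> derivable (fun y => g (y + v)) x (ei i).
Proof. by rewrite /derivable shift_quotient. Qed.

Lemma partials_shift s g v x :
  partials s (fun y => g (y + v)) x = partials s g (x + v).
Proof.
elim: s x => [|i s IH] x; first by [].
have E : partials s (fun y => g (y + v)) = (fun y => partials s g (y + v)).
  by apply/funext => y; exact: IH.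
by rewrite /= E partial_shift.
Qed.

Lemma line_MVT g x i (t : R) :
  (forall r, `|r| <= `|t| -> derivable g (x + r *: ei i) (ei i)) ->
  exists2 c, `|c| <= `|t| &
    g (x + t *: ei i) - g x = t * partial i g (x + c *: ei i).
Proof.
move=> dg; pose p r := g (x + r *: ei i); pose dp r := partial i g (x + r *: ei i).
have pd r : `|r| <= `|t| -> is_derive r (1 : R) p (dp r).
  move=> rt; apply: is_derive_line; split; first exact: dg.
  by [].
have p0 : p 0 = g x by rewrite /p scale0r addr0.
have MV a b : a <= b -> (forall r, a <= r <= b -> `|r| <= `|t|) ->
    exists2 c, `|c| <= `|t| & p b - p a = dp c * (b - a).
  move=> ab abt.
  have pd' r : r \in `]a, b[ -> is_derive r (1 : R) p (dp r).
    rewrite in_itv /= => /andP[ar rb]; apply: pd; apply: abt.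
    by rewrite !ltW.
  have cp : {within `[a, b], continuous p}.
    apply: derivable_within_continuous => r; rewrite in_itv /= => /abt/pd d.
    exact: (@ex_derive _ _ _ _ _ _ _ d).
  have [c cab E] := MVT_segment ab pd' cp.
  by exists c => //; apply: abt; move: cab; rewrite in_itv.
have [t0|t0] := leP 0 t.
  have [r /andP[r0 rt]|c ct E] := MV 0 t t0.
    by rewrite ger0_norm// ger0_norm.
  by exists c => //; rewrite -p0 [LHS]E subr0 mulrC.
have [r /andP[r0 rt]|c ct E] := MV t 0 (ltW t0).
  by rewrite ler0_norm// ltr0_norm// lerN2.
exists c => //; apply: oppr_inj.
by rewrite opprB -p0 [LHS]E sub0r mulrN mulrC.
Qed.

(** Both mixed second derivatives at [x] are limits of the second difference
    quotient, which is symmetric in the two directions. *)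
Lemma second_difference U g x i j (r : R) : smooth_on U g ->
  (forall a b, `|a| <= `|r| -> `|b| <= `|r| -> U (x + a *: ei i + b *: ei j)) ->
  exists a b, [/\ `|a| <= `|r|, `|b| <= `|r| &
   g (x + r *: ei i + r *: ei j) - g (x + r *: ei i) - (g (x + r *: ei j) - g x) =
   r * r * partial j (partial i g) (x + a *: ei i + b *: ei j)].
Proof.
move=> sg box.
have box0 a : `|a| <= `|r| -> U (x + a *: ei i).
  by move=> ar; have := box a 0 ar; rewrite normr0 scale0r addr0; apply.
pose G y := g (y + r *: ei j) - g y.
have dG a : `|a| <= `|r| -> derivable G (x + a *: ei i) (ei i).
  move=> ar; apply: derivableB.
    by apply: derivable_shift; apply: (smooth_derivable sg); exact: box.
  by apply: (smooth_derivable sg); exact: box0.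
have [a ar] := line_MVT dG.
have -> : partial i G (x + a *: ei i) =
    partial i g (x + a *: ei i + r *: ei j) - partial i g (x + a *: ei i).
  rewrite -(partial_shift i g) /partial; apply: deriveB.
    by apply: derivable_shift; apply: (smooth_derivable sg); exact: box.
  by apply: (smooth_derivable sg); exact: box0.
have d2 b : `|b| <= `|r| ->
    derivable (partial i g) (x + a *: ei i + b *: ei j) (ei j).
  move=> br; apply: (smooth_derivable (smooth_partial _ sg)).
  exact: box.
have [b br ->] := line_MVT d2.
rewrite /G => ->; exists a, b; split => //.
by rewrite mulrA.
Qed.

Lemma partialC U g i j : open U -> smooth_on U g ->
  forall x, U x -> partial i (partial j g) x = partial j (partial i g) x.
Proof.
move=> Uo sg x Ux; apply/eqP; rewrite -subr_eq0 -normr_le0; apply/ler_addgt0Pl => e e0.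
have cont k l : exists2 d : R, 0 < d & forall y, `|y - x| < d ->
    `|partial k (partial l g) x - partial k (partial l g) y| < e / 2.
  apply/near_normP.
  have := smooth_continuous (smooth_partial k (smooth_partial l sg)) Ux.
  by move=> /cvgrPdist_lt c; apply: c; apply: divr_gt0; rewrite ?ltr0n.
have [d1 d10 C1] := cont i j; have [d2 d20 C2] := cont j i.
have /openP/(_ x Ux)[d3 d30 C3] := Uo.
pose r := Num.min d1 (Num.min d2 d3) / 4.
have r0 : 0 < r by rewrite divr_gt0// !lt_min d10 d20 d30.
have near k l a b d : `|a| <= `|r| -> `|b| <= `|r| -> 4 * r <= d ->
    `|x + a *: ei k + b *: ei l - x| < d.
  move=> ar br; apply: lt_le_trans; rewrite addrC !addrA addNr add0r.
  rewrite (le_lt_trans (ler_normD _ _))// !normrZ.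
  rewrite (gtr0_norm r0) in ar br.
  have le1 (c : R) m : `|c| <= r -> `|c| * `|ei m| <= r.
    by move=> cr; rewrite -[leRHS]mulr1 ler_pM// norm_delta_le.
  rewrite (le_lt_trans (lerD (le1 a k ar) (le1 b l br)))//.
  by move: r0; lra.
have r4 : 4 * r = Num.min d1 (Num.min d2 d3) by rewrite /r mulrC divfK.
have r1 : 4 * r <= d1 by rewrite r4 ge_min lexx.
have r2 : 4 * r <= d2 by rewrite r4 !ge_min lexx orbT.
have r3 : 4 * r <= d3 by rewrite r4 !ge_min lexx !orbT.
have [a [b [ar br E1]]] := @second_difference U g x i j r sg
  (fun a b ar br => C3 _ (near _ _ _ _ _ ar br r3)).
have [a' [b' [ar' br' E2]]] := @second_difference U g x j i r sg
  (fun a b ar br => C3 _ (near _ _ _ _ _ ar br r3)).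
have := C1 _ (near j i _ _ _ ar' br' r1).
have := C2 _ (near i j _ _ _ ar br r2).
have E3 : x + r *: ei i + r *: ei j = x + r *: ei j + r *: ei i by exact: addrAC.
set P1 := partial j (partial i g) (x + a *: ei i + b *: ei j) in E1 *.
set P2 := partial i (partial j g) (x + a' *: ei j + b' *: ei i) in E2 *.
have E12 : P1 = P2.
  apply: (@mulfI _ (r * r)); first by rewrite mulf_neq0// gt_eqF.
  apply: etrans (esym E1) (etrans _ E2); rewrite E3.
  move: (g _) (g _) (g _) (g _) => A1 A2 A3 A4; ring.
clearbody P1 P2; move: E12 => ->; clear.
move: (partial j (partial i g) x) (partial i (partial j g) x) => A1 A2.
rewrite !ltr_norml ler_norml => /andP[? ?] /andP[? ?].
by apply/andP; split; lra.
Qed.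

End mean_value.

(** * Multi-indices and bounds on derivatives *)

Section seminorms.
Context {R : realType} {n : nat}.
Local Notation Rn := 'rV[R]_n.
Local Notation ei i := (delta_mx 0 i : 'rV[R]_n).
Implicit Types (g phi psi : Rn -> R) (x y v : Rn) (U K : set Rn) (i : 'I_n)
  (s : seq 'I_n).

Lemma partials_swap U g s i : open U -> smooth_on U g ->
  forall x, U x -> partials s (partial i g) x = partial i (partials s g) x.
Proof.
move=> Uo sg; elim: s => [|j s IH] x Ux; first by [].
rewrite /= (partial_eq_on j Uo IH Ux).
exact: (partialC j i Uo (smooth_partials s sg) Ux).
Qed.

Lemma partials_perm U g s1 s2 : open U -> smooth_on U g -> perm_eq s1 s2 ->
  forall x, U x -> partials s1 g x = partials s2 g x.
Proof.
move=> Uo sg; elim: s1 s2 => [|i s1 IH] s2 p x Ux.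
  by move: p; rewrite perm_sym => /perm_nilP ->.
have /path.splitPr E : i \in s2 by rewrite -(perm_mem p) mem_head.
case: E p => a b p.
have p' : perm_eq s1 (a ++ b).
  by rewrite -(perm_cons i) (perm_trans p)// perm_catC /= perm_cons perm_catC.
rewrite /= (partial_eq_on i Uo (IH _ p') Ux) !partials_cat /=.
by rewrite (partials_swap a i Uo (smooth_partials b sg) Ux).
Qed.

Definition multi_seq (b : 'I_n -> nat) : seq 'I_n :=
  flatten [seq nseq (b i) i | i <- enum 'I_n].

Lemma mpartialE b g : mpartial b g = partials (multi_seq b) g.
Proof.
rewrite /mpartial /multi_seq; elim: (enum 'I_n) => //= i e ->.
by rewrite partials_cat; elim: (b i) => //= k ->.
Qed.

Lemma size_multi_seq b : size (multi_seq b) = (\sum_i b i)%N.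
Proof.
rewrite /multi_seq size_flatten /shape -map_comp sumnE big_map.
by rewrite big_enum /=; apply: eq_bigr => i _; rewrite size_nseq.
Qed.

Lemma perm_multi_seq s : perm_eq s (multi_seq (fun i => count_mem i s)).
Proof.
apply/allP => j _ /=; apply/eqP.
rewrite /multi_seq count_flatten -map_comp sumnE big_map big_enum /=.
rewrite (bigD1 j)//= big1 => [|i ij]; rewrite count_nseq /= ?eqxx ?mul1n ?addn0//.
by rewrite (negbTE ij).
Qed.

(** Derivatives commute, so that an iterated derivative depends only on the
    number of occurrences of each index. *)
Lemma partials_mpartial U g s x : open U -> smooth_on U g -> U x ->
  partials s g x = mpartial (fun i => count_mem i s) g x.
Proof.
by move=> Uo sg Ux; rewrite mpartialE; exact: (partials_perm Uo sg (perm_multi_seq s)).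
Qed.

Definition bnd (m : nat) g (B : R) : Prop :=
  forall s x, (size s <= m)%N -> `|partials s g x| <= B.

Lemma bnd_ge0 m g B : bnd m g B -> 0 <= B.
Proof. by move=> /(_ [::] 0 isT); exact: le_trans. Qed.

#[global] Arguments bnd_ge0 {m g B} _.

Lemma bnd0P g B : bnd 0 g B <-> forall x, `|g x| <= B.
Proof.
split=> [h x|h s x]; first exact: (h [::]).
by rewrite leqn0 size_eq0 => /eqP ->; exact: h.
Qed.

Lemma bndSP m g B :
  bnd m.+1 g B <-> (forall x, `|g x| <= B) /\ forall i, bnd m (partial i g) B.
Proof.
split=> [h|[h0 h1] s x].
  split=> [x|i s x sm]; first exact: (h [::]).
  by rewrite -partials_rcons; apply: h; rewrite size_rcons.
case/lastP: s => [_|s i]; first exact: h0.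
by rewrite size_rcons partials_rcons ltnS; exact: h1.
Qed.

Lemma bnd_le m m' g B B' : (m' <= m)%N -> B <= B' -> bnd m g B -> bnd m' g B'.
Proof.
by move=> mm BB h s x sm; apply: le_trans BB; apply: h; exact: leq_trans mm.
Qed.

Lemma bndD m g1 g2 B1 B2 : smooth_on setT g1 -> smooth_on setT g2 ->
  bnd m g1 B1 -> bnd m g2 B2 -> bnd m (fun x => g1 x + g2 x) (B1 + B2).
Proof.
elim: m g1 g2 => [|m IH] g1 g2 s1 s2.
  move=> /bnd0P h1 /bnd0P h2; apply/bnd0P => x.
  by rewrite (le_trans (ler_normD _ _))// lerD.
move=> /bndSP[h1 d1] /bndSP[h2 d2]; apply/bndSP; split=> [x|i].
  by rewrite (le_trans (ler_normD _ _))// lerD.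
have -> : partial i (fun x => g1 x + g2 x) =
    (fun x => partial i g1 x + partial i g2 x).
  apply/funext => x; exact: (partialD (smooth_derivable s1 I) (smooth_derivable s2 I)).
exact: (IH _ _ (smooth_partial i s1) (smooth_partial i s2)).
Qed.

(** Each derivative at most doubles the number of products to be bounded. *)
Lemma bndM m g1 g2 B1 B2 : smooth_on setT g1 -> smooth_on setT g2 ->
  bnd m g1 B1 -> bnd m g2 B2 -> bnd m (fun x => g1 x * g2 x) (2 ^+ m * (B1 * B2)).
Proof.
elim: m g1 g2 => [|m IH] g1 g2 s1 s2.
  move=> /bnd0P h1 /bnd0P h2; apply/bnd0P => x.
  by rewrite expr0 mul1r normrM ler_pM.
move=> b1 b2; have := b1 => /bndSP[h1 d1]; have := b2 => /bndSP[h2 d2].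
have B10 := bnd_ge0 b1; have B20 := bnd_ge0 b2.
apply/bndSP; split=> [x|i].
  rewrite normrM (le_trans (ler_pM _ _ (h1 x) (h2 x)))//.
  by rewrite ler_peMl ?mulr_ge0// exprn_ege1// ler1n.
have -> : partial i (fun x => g1 x * g2 x) =
    (fun x => partial i g1 x * g2 x + g1 x * partial i g2 x).
  apply/funext => x; exact: (partialM (smooth_derivable s1 I) (smooth_derivable s2 I)).
have b1' : bnd m g1 B1 by apply: bnd_le b1.
have b2' : bnd m g2 B2 by apply: bnd_le b2.
have -> : 2 ^+ m.+1 * (B1 * B2) = 2 ^+ m * (B1 * B2) + 2 ^+ m * (B1 * B2).
  by rewrite exprS; ring.
have s1' := smooth_partial i s1; have s2' := smooth_partial i s2.
apply: bndD.
- exact: (smoothM openT s1' s2).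
- exact: (smoothM openT s1 s2').
- exact: (IH _ _ s1' s2).
- exact: (IH _ _ s1 s2').
Qed.

Lemma bndZ m g (c B : R) : smooth_on setT g ->
  bnd m g B -> bnd m (fun x => c * g x) (`|c| * B).
Proof.
elim: m g => [|m IH] g sg.
  by move=> /bnd0P h; apply/bnd0P => x; rewrite normrM ler_wpM2l.
move=> /bndSP[h d]; apply/bndSP; split=> [x|i]; first by rewrite normrM ler_wpM2l.
have -> : partial i (fun x => c * g x) = (fun x => c * partial i g x).
  apply/funext => x; rewrite (@partialM _ _ i (fun=> c) g).
  - by rewrite partial_cst mul0r add0r.
  - exact: derivable_cst.
  - exact: (smooth_derivable sg I).
exact: (IH _ (smooth_partial i sg)).
Qed.

(** Going from [y] to [x] one coordinate at a time. *)
Lemma bnd_lipschitz g B x y : smooth_on setT g -> bnd 1 g B ->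
  `|g x - g y| <= n%:R * B * `|x - y|.
Proof.
move=> sg /bndSP[_ dB].
pose z k : Rn := \row_(i < n) (if (i < k)%N then x 0 i else y 0 i).
have zS (k : 'I_n) : z k.+1 = z k + (x 0 k - y 0 k) *: ei k.
  apply/rowP => i; rewrite !mxE /= ltnS leq_eqVlt.
  have [->|ik] := eqVneq i k; first by rewrite eqxx /= ltnn mulr1 addrC subrK.
  by rewrite (negPf (ik : (i : nat) != k)) /= mulr0 addr0.
have z0 : z 0%N = y by apply/rowP => i; rewrite mxE.
have zn : z n = x by apply/rowP => i; rewrite mxE ltn_ord.
rewrite -{1}zn -{1}z0 -(telescope_sumr (fun k => g (z k)))// big_mkord.
rewrite (le_trans (ler_norm_sum _ _ _))//.
have -> : n%:R * B * `|x - y| = \sum_(k < n) B * `|x - y|.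
  by rewrite sumr_const card_ord -[RHS]mulr_natl mulrA.
apply: ler_sum => k _; rewrite zS.
have [r _|c _ ->] := @line_MVT _ _ g (z k) k (x 0 k - y 0 k).
  exact: (smooth_derivable sg I).
rewrite normrM mulrC ler_pM//; first exact: (dB k [::]).
by have := coord_le_norm (x - y) k; rewrite !mxE.
Qed.

Lemma line_taylor g B x i (t : R) : smooth_on setT g -> bnd 2 g B ->
  `|g (x + t *: ei i) - g x - t * partial i g x| <= t ^+ 2 * B.
Proof.
move=> sg bB.
have [r _|c ct ->] := @line_MVT _ _ g x i t; first exact: (smooth_derivable sg I).
have [r _|d dc] := @line_MVT _ _ (partial i g) x i c.
  exact: (smooth_derivable (smooth_partial i sg) I).
rewrite -mulrBr => ->; rewrite !normrM mulrA -[t ^+ 2]real_normK ?num_real//.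
have := bB [:: i; i] (x + d *: ei i) isT; rewrite [partials _ _ _]/=.
have -> : `|t| ^+ 2 = `|t| * `|t| by rewrite expr2.
by move=> ?; rewrite ler_pM// ?mulr_ge0// ler_pM.
Qed.

End seminorms.

(** * Test functions and seminorms *)

Section test_functions.
Context {R : realType} {n : nat}.
Local Notation Rn := 'rV[R]_n.
Local Notation ei i := (delta_mx 0 i : 'rV[R]_n).
Implicit Types (g phi psi chi : Rn -> R) (x y v : Rn) (U K : set Rn) (i : 'I_n)
  (s : seq 'I_n) (u : functional R n).

Lemma fsupp_notin phi x : ~ fsupp phi x -> phi x = 0.
Proof.
move=> h; apply: contrapT => /eqP px; apply: h.
exact: subset_closure.
Qed.

Lemma closed_fsupp phi : closed (fsupp phi).
Proof. exact: closed_closure. Qed.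

Lemma open_fsuppC phi : open (~` fsupp phi).
Proof. by rewrite openC; exact: closed_fsupp. Qed.

Lemma fsupp_sub K phi : closed K -> (forall x, ~ K x -> phi x = 0) ->
  fsupp phi `<=` K.
Proof.
move=> Kc h; rewrite /fsupp closureE; apply: smallest_sub => // x /= /eqP px.
by apply: contrapT => /h.
Qed.

Lemma smooth_onU U1 U2 g : smooth_on U1 g -> smooth_on U2 g ->
  smooth_on (U1 `|` U2) g.
Proof. by move=> s1 s2 s x [/s1|/s2]; exact. Qed.

Lemma test_smooth U phi : test_on U phi -> smooth_on setT phi.
Proof. by case. Qed.

Lemma test_derivable U phi x i : test_on U phi -> derivable phi x (ei i).
Proof. by move=> [sp _ _]; exact: (smooth_derivable sp I). Qed.

Lemma testW U U' phi : U `<=` U' -> test_on U phi -> test_on U' phi.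
Proof. by move=> UU' [sp cp pU]; split => //; exact: subset_trans UU'. Qed.

Lemma testT U phi : test_on U phi -> test_on setT phi.
Proof. exact: testW. Qed.

Lemma test_zero U phi x : test_on U phi -> ~ U x -> phi x = 0.
Proof. by move=> [_ _ pU] Ux; apply: fsupp_notin => /pU. Qed.

Lemma compact_le_norm K : compact K -> exists2 r : R, 0 < r &
  forall x, K x -> `|x| <= r.
Proof.
move=> /compact_bounded [M [_ h]]; exists (`|M| + 1) => [|x Kx].
  by rewrite ltr_wpDl.
by apply: h => //; rewrite (le_lt_trans (ler_norm _))// ltrDl.
Qed.

Lemma test_far U phi : test_on U phi ->
  exists2 r : R, 0 < r & forall x, r < `|x| -> phi x = 0.
Proof.
move=> [_ /compact_le_norm[r r0 h] _]; exists r => // x rx.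
by apply: fsupp_notin => /h; rewrite leNgt rx.
Qed.

Lemma closed_norm_le (r : R) : closed [set x : Rn | `|x| <= r].
Proof.
have -> : [set x : Rn | `|x| <= r] = ~` [set x | r < `|x - 0|].
  apply/seteqP; split=> y /=; rewrite subr0.
    by move=> yr; apply/negP; rewrite -leNgt.
  by move/negP; rewrite -leNgt.
exact/open_closedC/open_norm_gt.
Qed.

Lemma testI U K phi (r : R) : smooth_on setT phi -> closed K -> K `<=` U ->
  (forall x, ~ K x -> phi x = 0) -> (forall x, r < `|x| -> phi x = 0) ->
  test_on U phi.
Proof.
move=> sp Kc KU h hr; split => //.
  apply: bounded_closed_compact; last exact: closed_closure.
  exists r; split; first exact: num_real.
  move=> M rM x /=; have : fsupp phi `<=` [set x : Rn | `|x| <= r].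
    apply: fsupp_sub => [|y /= /negP]; last by rewrite -ltNge => /hr.
    exact: closed_norm_le.
  by move=> /(_ x)/[apply] /= xr; rewrite (le_trans xr)// ltW.
by apply: subset_trans KU; exact: fsupp_sub.
Qed.

Lemma test_sub U phi psi : smooth_on setT psi -> test_on U phi ->
  (forall x, ~ fsupp phi x -> psi x = 0) -> test_on U psi.
Proof.
move=> sp tp h; have [r _ hr] := test_far tp; have [_ cp pU] := tp.
have [r' _ hr'] := compact_le_norm cp.
apply: (@testI U (fsupp phi) psi r' sp (closed_fsupp (phi:=phi)) pU h) => x rx.
apply: h => /hr'.
by rewrite leNgt rx.
Qed.

Lemma test_partial U phi i : test_on U phi -> test_on U (partial i phi).
Proof.
move=> tp; have sp := test_smooth tp.
apply: (test_sub (smooth_partial i sp) tp) => x xp.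
rewrite -(partial_cst i 0 x).
apply: (partial_eq_on i (open_fsuppC (phi:=phi)) _ xp); exact: fsupp_notin.
Qed.

Lemma test_partials U phi s : test_on U phi -> test_on U (partials s phi).
Proof. by move=> tp; elim: s => [|i s IH]; [exact: tp|exact: test_partial]. Qed.

Lemma testM U g phi : open U -> smooth_on U g -> test_on U phi ->
  test_on U (fun x => g x * phi x).
Proof.
move=> Uo sg tp; have [sp cp pU] := tp.
apply: (test_sub _ tp) => [|x /fsupp_notin ->]; last by rewrite mulr0.
have -> : setT = U `|` ~` fsupp phi.
  apply/seteqP; split=> // x _; have [/pU|] := pselect (fsupp phi x); by [left|right].
have oC := open_fsuppC (phi:=phi).
apply: smooth_onU; first exact: (smoothM Uo sg (smooth_onW _ sp)).
apply: (@smooth_eq_on _ _ _ (fun=> 0)) => // [x /fsupp_notin ->|].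
  by rewrite mulr0.
exact: smooth_cst.
Qed.

Lemma testMr U g phi : smooth_on setT g -> test_on U phi ->
  test_on U (fun x => g x * phi x).
Proof.
move=> sg tp; apply: (test_sub _ tp) => [|x /fsupp_notin ->]; last by rewrite mulr0.
exact: (smoothM openT sg (test_smooth tp)).
Qed.

Lemma testZ U (c : R) phi : test_on U phi -> test_on U (fun x => c * phi x).
Proof. by apply: testMr; exact: (smooth_cst _ openT). Qed.

Lemma testD U phi psi : test_on U phi -> test_on U psi ->
  test_on U (fun x => phi x + psi x).
Proof.
move=> t1 t2; have [s1 c1 u1] := t1; have [s2 c2 u2] := t2.
have [r1 r10 h1] := test_far t1; have [r2 r20 h2] := test_far t2.
apply: (@testI _ (fsupp phi `|` fsupp psi) _ (r1 + r2)).
- exact: (smoothD openT s1 s2).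
- by apply: closedU; exact: closed_fsupp.
- by rewrite subUset.
- move=> x h; rewrite !fsupp_notin ?addr0//.
    by move=> ?; apply: h; right.
  by move=> ?; apply: h; left.
- move=> x h; rewrite h1 ?h2 ?addr0//; apply: lt_trans h.
    by rewrite ltrDr.
  by rewrite ltrDl.
Qed.

Lemma testN U phi : test_on U phi -> test_on U (fun x => - phi x).
Proof.
move=> tp; have -> : (fun x => - phi x) = (fun x => -1 * phi x).
  by apply/funext => x; rewrite mulN1r.
exact: testZ.
Qed.

Lemma testB U phi psi : test_on U phi -> test_on U psi ->
  test_on U (fun x => phi x - psi x).
Proof. by move=> t1 t2; apply: testD => //; exact: testN. Qed.

Lemma test0 U : test_on U (fun=> 0).
Proof.
apply: (@testI U set0 _ 0) => // [|]; first exact: (smooth_cst _ openT).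
exact: closed0.
Qed.

Lemma smooth_shift g v : smooth_on setT g -> smooth_on setT (fun x => g (x + v)).
Proof.
move=> sg s x _.
have -> : partials s (fun x => g (x + v)) = (fun x => partials s g (x + v)).
  by apply/funext => y; exact: partials_shift.
have [c d] := sg s (x + v) I; split; last by move=> i; exact: derivable_shift.
have c1 : {for x, continuous (fun y : Rn => y + v)}.
  apply: continuousD; last exact: cst_continuous.
  by move=> A.
exact: (@continuous_comp Rn Rn R (fun y => y + v) (partials s g) x c1 c).
Qed.

Lemma test_shift phi v : test_on setT phi -> test_on setT (fun x => phi (x + v)).
Proof.
move=> tp; have [r r0 h] := test_far tp.
apply: (@testI _ setT _ (r + `|v|) _ closedT) => [|x _|x /(_ I)|x rx].
- exact: (smooth_shift v (test_smooth tp)).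
- by [].
- by [].
- apply: h; rewrite -(ltrD2r `|v|) (lt_le_trans rx)//.
  by rewrite -{1}(addrK v x) (le_trans (ler_normB _ _)).
Qed.

Lemma test_bounded phi : test_on setT phi -> exists B, forall x, `|phi x| <= B.
Proof.
move=> tp; have [sp cp _] := tp.
have cphi : {within fsupp phi, continuous phi}.
  apply: continuous_subspaceT => x; exact: (smooth_continuous sp).
have [M [_ h]] := compact_bounded (continuous_compact cphi cp).
exists (`|M| + 1) => x; have [xp|/fsupp_notin ->] := pselect (fsupp phi x).
  apply: h; last by exists x.
  by rewrite (le_lt_trans (ler_norm _))// ltrDl.
by rewrite normr0 addr_ge0.
Qed.

Lemma test_bnd phi m : test_on setT phi -> exists B, bnd m phi B.
Proof.
elim: m phi => [|m IH] phi tp; have [B hB] := test_bounded tp.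
  by exists B; apply/bnd0P.
have /choice[D hD] i := IH _ (test_partial i tp).
have D0 i := bnd_ge0 (hD i).
exists (`|B| + \sum_i D i); apply/bndSP; split=> [x|i].
  by rewrite (le_trans (hB x))// (le_trans (ler_norm _))// lerDl sumr_ge0.
apply: bnd_le (hD i) => //; rewrite (bigD1 i)//= addrCA lerDl addr_ge0//.
by rewrite sumr_ge0.
Qed.

Lemma range_bounded phi (B : R) : (forall x, `|phi x| <= B) ->
  forall x, `|phi x| <= sup (range (fun x => `|phi x|)).
Proof.
move=> hB x; apply: ub_le_sup; last by exists x.
by exists B => _ [y _ <-].
Qed.

Lemma sup_range_le phi (B : R) : (forall x, `|phi x| <= B) ->
  sup (range (fun x => `|phi x|)) <= B.
Proof.
by move=> hB; apply: ge_sup; [exists `|phi 0|; exists 0|move=> _ [y _ <-]].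
Qed.

Lemma Cseminorm_le m phi (B : R) : bnd m phi B ->
  Cseminorm m phi <= #|{ffun 'I_n -> 'I_m.+1}|%:R * B.
Proof.
move=> hB; have B0 := bnd_ge0 hB.
rewrite /Cseminorm (le_trans (y := \sum_(b : {ffun 'I_n -> 'I_m.+1}) B))//.
  rewrite big_mkcond; apply: ler_sum => b _; case: ifP => // bm.
  apply: sup_range_le => x; rewrite mpartialE; apply: hB.
  by rewrite size_multi_seq.
by rewrite sumr_const -[leLHS]mulr_natl.
Qed.

(** All derivatives of a test function are test functions, hence bounded;
    this makes the suprema in [Cseminorm] upper bounds. *)
Lemma bnd_Cseminorm m phi : test_on setT phi -> bnd m phi (Cseminorm m phi).
Proof.
move=> tp s x sm; rewrite (partials_mpartial s openT (test_smooth tp) I).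
have cs : (\sum_i count_mem i s)%N = size s.
  by rewrite -size_multi_seq; apply/esym/perm_size; exact: perm_multi_seq.
have cm i : (count_mem i s < m.+1)%N.
  by rewrite ltnS (leq_trans (count_size _ _)).
pose b : {ffun 'I_n -> 'I_m.+1} := [ffun i => Ordinal (cm i)].
have bE : (fun i => count_mem i s) = (fun i => b i : nat).
  by apply/funext => i; rewrite ffunE.
have bm : (\sum_i b i <= m)%N.
  by rewrite (eq_bigr (fun i => count_mem i s)) ?cs// => i _; rewrite ffunE.
have T b' : test_on setT (mpartial b' phi) by rewrite mpartialE; exact: test_partials.
rewrite bE /Cseminorm (bigD1 b bm)/=.
have [B hB] := test_bounded (T (fun i => b i)).
rewrite (le_trans (range_bounded hB x))// lerDl sumr_ge0// => b' _.
have [B' hB'] := test_bounded (T (fun i => b' i)).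
by rewrite (le_trans _ (range_bounded hB' 0)).
Qed.

#[global] Arguments bnd_Cseminorm m {phi} _.

(** Continuity in terms of [bnd], which behaves well under products and
    restrictions; [distributionI] is the way back. *)
Lemma dist_bnd u K : Defs.distribution u -> compact K ->
  exists C m, 0 <= C /\ forall phi B, test_on K phi -> bnd m phi B -> `|u phi| <= C * B.
Proof.
move=> [_ /[apply]] [C [m h]].
exists (`|C| * #|{ffun 'I_n -> 'I_m.+1}|%:R), m; split; first exact: mulr_ge0.
move=> phi B tp hB; rewrite (le_trans (h _ tp))// -mulrA.
have C0 : 0 <= Cseminorm m phi by exact: (bnd_ge0 (bnd_Cseminorm m (testT tp))).
by rewrite (le_trans (ler_wpM2r C0 (ler_norm C)))// ler_wpM2l// Cseminorm_le.
Qed.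

Lemma distributionI u :
  (forall (a : R) phi psi, test_on setT phi -> test_on setT psi ->
     u (fun x => a * phi x + psi x) = a * u phi + u psi) ->
  (forall K, compact K -> exists C m, forall phi B,
     test_on K phi -> bnd m phi B -> `|u phi| <= C * B) ->
  Defs.distribution u.
Proof.
move=> lin h; split=> // K /h[C [m Cm]]; exists C, m => phi tp.
by apply: Cm => //; apply: bnd_Cseminorm; exact: testT tp.
Qed.

End test_functions.

(** * Cutoff functions *)

Section bumps.
Context {R : realType}.
Implicit Types (t : R) (m : nat).

(** The family [flat m] extends t^-m exp(-1/t) by 0; it is closed under
    differentiation, which makes all its members smooth. *)
Definition flat m t : R := if 0 < t then t ^- m * expR (- t^-1) else 0.

Lemma flat_ge0 m t : 0 <= flat m t.
Proof.
rewrite /flat; case: ifP => // t0.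
by rewrite mulr_ge0 ?expR_ge0// invr_ge0 exprn_ge0// ltW.
Qed.

Lemma flat_le m t : flat m t <= m.+2%:R ^+ m.+2 * t ^+ 2.
Proof.
rewrite /flat; case: ifP => t0; last first.
  by rewrite mulr_ge0 ?sqr_ge0// exprn_ge0.
rewrite expRN ler_pdivrMr ?expR_gt0//.
have -> : expR t^-1 = expR ((m.+2%:R * t)^-1) ^+ m.+2.
  by rewrite -expRM_natl; congr expR; rewrite invfM mulrA divff ?pnatr_eq0// mul1r.
have tm : 0 < m.+2%:R * t by rewrite mulr_gt0// ltr0n.
have h : ((m.+2%:R * t)^-1) ^+ m.+2 <= expR ((m.+2%:R * t)^-1) ^+ m.+2.
  rewrite lerXn2r// ?nnegrE ?invr_ge0 ?expR_ge0//; first exact: ltW.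
  by rewrite (le_trans _ (expR_ge1Dx _))// lerDr.
apply: le_trans (ler_wpM2l _ h); last by rewrite mulr_ge0 ?sqr_ge0// exprn_ge0.
rewrite exprVn exprMn invfM mulrACA divff ?expf_neq0 ?pnatr_eq0// mul1r.
have tn0 : t != 0 by rewrite gt_eqF.
rewrite -[m.+2]addn2 exprD invfM mulrCA divff ?expf_neq0// mulr1.
by [].
Qed.

Lemma is_derive_inv t : t != 0 -> is_derive t (1 : R) (fun s : R => s^-1) (- t ^- 2).
Proof.
move=> t0; have := @is_deriveV R id t 1 1 t0 (is_derive_id t 1).
by rewrite /GRing.scale /= mulr1.
Qed.

Lemma flat_derive m t :
  is_derive t (1 : R) (flat m) (flat m.+2 t - m%:R * flat m.+1 t).
Proof.
have [t0|t0|->] := ltgtP t 0.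
- have E : \near t, (fun=> 0 : R) t = flat m t.
    near=> s; rewrite /flat; have -> : 0 < s = false; last by [].
    apply/negbTE; rewrite -leNgt ltW//; near: s.
    exact: (lt_nbhsl t0).
  apply: (near_eq_is_derive E); rewrite /flat ltNge (ltW t0)/= mulr0 subr0.
  exact: is_derive_cst.
- have E : \near t, (fun s : R => (s^-1) ^+ m * expR (- s^-1)) t = flat m t.
    near=> s; rewrite /flat; have -> : 0 < s by near: s; exact: lt_nbhsr.
    by rewrite exprVn.
  apply: (near_eq_is_derive E).
  have tn0 : t != 0 by rewrite gt_eqF.
  have d1 := is_derive_inv tn0.
  have d2 : is_derive t (1 : R) (fun s : R => (s^-1) ^+ m)
     (m%:R * (t^-1) ^+ m.-1 * - (t ^- 2)) by have := is_deriveX m d1; rewrite exprfctE.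
  have d3 : is_derive t (1 : R) (fun s : R => - s^-1) (t ^- 2).
    by rewrite -[t ^- 2]opprK; exact: is_deriveN d1.
  have d4 := @is_derive1_comp _ expR _ t _ _ (is_derive_expR (- t^-1)) d3.
  apply: (is_derive_eq (is_deriveM d2 d4)).
  rewrite /GRing.scale /= /flat t0 -!exprVn.
  case: (m) => [|k] /=; first by rewrite expr0 !mul0r mulr0 subr0; ring.
  by rewrite !exprS; ring.
- have f0 k : flat k 0 = 0 by rewrite /flat ltxx.
  have C : (fun h : R => h^-1 *: ((flat m \o shift 0) (h *: 1) - flat m 0)) @ 0^'
      --> (0 : R).
    apply/cvgrPdist_le => e e0; near=> h.
    have h0 : h != 0 by near: h; exact: nbhs_dnbhs_neq.
    rewrite f0 subr0 sub0r normrN /= addr0 [h *: 1]mulr1 [_ *: _]/(_ * _) normrM.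
    rewrite normfV ler_pdivrMl ?normr_gt0// ger0_norm ?flat_ge0//.
    rewrite (le_trans (flat_le m h))// -[h ^+ 2]real_normK ?num_real// expr2.
    rewrite mulrCA ler_wpM2l// -ler_pdivlMl ?exprn_gt0 ?ltr0n//; near: h.
    by apply: dnbhs0_le; rewrite mulr_gt0 ?invr_gt0 ?exprn_gt0 ?ltr0n.
  rewrite !f0 mulr0 subr0; split; first by apply/cvg_ex; exists 0.
  exact: cvg_lim C.
Unshelve. all: by end_near. Qed.

Lemma flat_continuous m : continuous (flat m).
Proof.
move=> t; apply: differentiable_continuous; apply/derivable1_diffP.
by have [] := flat_derive m t.
Qed.

End bumps.

Section cutoffs.
Context {R : realType} {n : nat}.
Local Notation Rn := 'rV[R]_n.
Local Notation ei i := (delta_mx 0 i : 'rV[R]_n).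
Implicit Types (g q phi psi chi : Rn -> R) (x y v c : Rn) (U K : set Rn) (i : 'I_n).

Lemma is_derive_comp (f : R -> R) q x v (a b : R) :
  is_derive (q x) (1 : R) f a -> is_derive x v q b ->
  is_derive x v (fun y => f (q y)) (a * b).
Proof.
move=> df dq; apply: is_derive_of_line.
have q0 : q (x + 0 *: v) = q x by rewrite scale0r addr0.
apply: (@is_derive1_comp _ f (fun r => q (x + r *: v))); first by rewrite q0.
by apply: is_derive_line; rewrite scale0r addr0.
Qed.

Lemma is_derive_partial U g x i : smooth_on U g -> U x ->
  is_derive x (ei i) g (partial i g x).
Proof. by move=> sg Ux; split; [exact: (smooth_derivable sg Ux)|]. Qed.

Lemma smoothV U g : open U -> smooth_on U g -> (forall x, U x -> g x != 0) ->
  smooth_on U (fun x => (g x)^-1).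
Proof.
move=> Uo sg g0; pose B h := smooth_on U h \/ h = (fun x => (g x)^-1).
apply: (@alg_smooth _ _ _ B Uo); last by apply: alg_base; right.
  move=> h [sh|->] x Ux; first exact: (smooth_continuous sh Ux).
  exact: (continuousV (g0 x Ux) (smooth_continuous sg Ux)).
move=> h i [sh|->].
  exists (partial i h) => [|x Ux]; last exact: (is_derive_partial _ sh Ux).
  by apply: alg_base; left; exact: smooth_partial.
exists (fun x => (-1 * ((g x)^-1 * (g x)^-1)) * partial i g x) => [|x Ux].
  apply: alg_mul; last by apply: alg_base; left; exact: smooth_partial.
  apply: alg_mul; first exact: alg_cst.
  by apply: alg_mul; apply: alg_base; right.
have -> : -1 * ((g x)^-1 * (g x)^-1) = - (g x) ^- 2.
  by rewrite mulN1r -invfM expr2.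
exact: (is_derive_comp (is_derive_inv (g0 x Ux)) (is_derive_partial i sg Ux)).
Qed.

Lemma smooth_flat U m q : open U -> smooth_on U q ->
  smooth_on U (fun x => flat m (q x)).
Proof.
move=> Uo sq.
pose B h := smooth_on U h \/ exists k, h = (fun x => flat k (q x)).
apply: (@alg_smooth _ _ _ B Uo); last by apply: alg_base; right; exists m.
  move=> h [sh|[k ->]] x Ux; first exact: (smooth_continuous sh Ux).
  apply: (@continuous_comp Rn R R q (flat k) x (smooth_continuous sq Ux)).
  exact: flat_continuous.
move=> h i [sh|[k ->]].
  exists (partial i h) => [|x Ux]; last exact: (is_derive_partial _ sh Ux).
  by apply: alg_base; left; exact: smooth_partial.
exists (fun x => (flat k.+2 (q x) + - k%:R * flat k.+1 (q x)) * partial i q x)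
    => [|x Ux].
  apply: alg_mul; last by apply: alg_base; left; exact: smooth_partial.
  apply: alg_add; first by apply: alg_base; right; exists k.+2.
  by apply: alg_mul; [exact: alg_cst|apply: alg_base; right; exists k.+1].
have := is_derive_comp (flat_derive k (q x)) (is_derive_partial i sq Ux).
by rewrite mulNr.
Qed.

Definition sqnorm x : R := \sum_i x 0 i ^+ 2.

Lemma sqnorm_ge0 x : 0 <= sqnorm x.
Proof. by apply: sumr_ge0 => i _; exact: sqr_ge0. Qed.

Lemma smooth_sqnorm U : open U -> smooth_on U sqnorm.
Proof.
move=> Uo; apply: (smooth_sum _ Uo) => i _.
exact: (smoothX 2 Uo (smooth_coord i Uo)).
Qed.

Lemma sqnorm_le x : sqnorm x <= n%:R * `|x| ^+ 2.
Proof.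
have -> : n%:R * `|x| ^+ 2 = \sum_(i < n) `|x| ^+ 2.
  by rewrite sumr_const card_ord -[RHS]mulr_natl.
apply: ler_sum => i _; rewrite -[x 0 i ^+ 2]real_normK ?num_real//.
by rewrite lerXn2r// ?nnegrE// coord_le_norm.
Qed.

Lemma norm_le_sqnorm x : `|x| ^+ 2 <= sqnorm x.
Proof.
have xi i : `|x 0 i| <= Num.sqrt (sqnorm x).
  rewrite -sqrtr_sqr ler_wsqrtr// /sqnorm (bigD1 i)//= lerDl.
  by apply: sumr_ge0 => j _; exact: sqr_ge0.
have := norm_le_coord (sqrtr_ge0 _) xi.
by move=> h; rewrite -[leRHS](sqr_sqrtr (sqnorm_ge0 x)) lerXn2r ?nnegrE ?sqrtr_ge0.
Qed.

Lemma sqnorm_gt0 x : x != 0 -> 0 < sqnorm x.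
Proof.
by move=> x0; apply: lt_le_trans (norm_le_sqnorm x); rewrite exprn_gt0// normr_gt0.
Qed.

(** The quotient p / (p + r), where p and r are the functions exp(-1/t) of
    [b - g] and of [g - a]. *)
Lemma level_cutoff g (a b : R) : smooth_on setT g -> a < b -> exists chi, [/\ smooth_on setT chi,
  forall x, 0 <= chi x <= 1, forall x, g x <= a -> chi x = 1 &
  forall x, b <= g x -> chi x = 0].
Proof.
move=> ssq ab; pose p x := flat 0 (b - g x); pose r x := flat 0 (g x - a).
have sp : smooth_on setT p.
  apply: (smooth_flat 0 openT); apply: (smoothB openT _ ssq).
  exact: (smooth_cst _ openT).
have sr : smooth_on setT r.
  apply: (smooth_flat 0 openT); apply: (smoothB openT ssq).
  exact: (smooth_cst _ openT).
have fpos t : 0 < t -> 0 < flat 0 t :> R.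
  by move=> t0; rewrite /flat t0 mulr_gt0 ?expR_gt0// expr0 invr1.
have fneg t : t <= 0 -> flat 0 t = 0 :> R.
  by move=> t0; rewrite /flat ltNge t0.
have p0 x : 0 <= p x by exact: flat_ge0.
have r0 x : 0 <= r x by exact: flat_ge0.
have pr x : 0 < p x + r x.
  have [h|h] := ltP (g x) b.
    by rewrite ltr_pwDl// fpos// subr_gt0.
  by rewrite ltr_wpDl// fpos// subr_gt0 (lt_le_trans ab).
exists (fun x => p x * (p x + r x)^-1); split.
- apply: (smoothM openT sp); apply: (smoothV openT (smoothD openT sp sr)) => x _.
  by rewrite gt_eqF.
- move=> x; rewrite divr_ge0// ?(ltW (pr x))//= ler_pdivrMr// mul1r lerDl.
  exact: r0.
- move=> x xa; rewrite /r [X in _ + X]fneg ?subr_le0// addr0 divff//.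
  by rewrite gt_eqF// fpos// subr_gt0 (le_lt_trans xa).
- by move=> x xb; rewrite [X in X * _]fneg ?mul0r// subr_le0.
Qed.

Lemma cutoff_sqnorm (a b : R) : a < b -> exists chi, [/\ smooth_on setT chi,
  forall x, 0 <= chi x <= 1, forall x, sqnorm x <= a -> chi x = 1 &
  forall x, b <= sqnorm x -> chi x = 0].
Proof. exact: (level_cutoff (smooth_sqnorm (@openT Rn))). Qed.

Lemma large_cutoff (r : R) : 0 < r -> exists chi r', [/\ smooth_on setT chi,
  r < r', forall x, `|x| <= r -> chi x = 1 & forall x, r' <= `|x| -> chi x = 0].
Proof.
move=> r0; have [|chi [sc _ c1 c0]] := @cutoff_sqnorm (n%:R * r ^+ 2) (n%:R * r ^+ 2 + 1).
  by rewrite ltrDl.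
exists chi, ((n%:R + 1) * (r + 1)); split => // [|x xr|x xr].
- by have : 0 <= n%:R :> R by []; nra.
- apply: c1; apply: le_trans (sqnorm_le x) _; rewrite ler_wpM2l//.
  by rewrite lerXn2r ?nnegrE// ltW.
- apply: c0; apply: le_trans (norm_le_sqnorm x).
  have h : ((n%:R + 1) * (r + 1)) ^+ 2 <= `|x| ^+ 2.
    rewrite lerXn2r ?nnegrE// mulr_ge0// addr_ge0//; exact: ltW.
  apply: le_trans h; have n0 : 0 <= n%:R :> R by [].
  by rewrite exprMn; nra.
Qed.

Lemma small_cutoff c (r : R) : 0 < r -> exists chi d, [/\ smooth_on setT chi,
  0 < d /\ d < r, forall x, 0 <= chi x <= 1, forall x, `|x - c| <= d -> chi x = 1 &
  forall x, r <= `|x - c| -> chi x = 0].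
Proof.
move=> r0; have [|chi [sc c01 c1 c0]] := @cutoff_sqnorm (r ^+ 2 / 2) (r ^+ 2).
  by rewrite ltr_pdivrMr// ltr_pMr ?exprn_gt0// ltr1n.
have n2 : 0 < n%:R + 2 :> R by rewrite ltr_wpDl.
exists (fun x => chi (x - c)), (r / (n%:R + 2)); split => [||x|x xr|x xr].
- exact: (smooth_shift _ sc).
- split; first by rewrite divr_gt0.
  by rewrite ltr_pdivrMr// ltr_pMr// ltr_wpDl// ltr1n.
- exact: c01.
- apply: c1; apply: le_trans (sqnorm_le _) _.
  have h : `|x - c| ^+ 2 <= (r / (n%:R + 2)) ^+ 2.
    by rewrite lerXn2r ?nnegrE// divr_ge0// ltW.
  apply: le_trans (ler_wpM2l _ h) _ => //.
  have n0 : 0 <= n%:R :> R by [].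
  have nn : n%:R <= (n%:R + 2) ^+ 2 / 2 :> R by rewrite ler_pdivlMr//; nra.
  have -> : r ^+ 2 / 2 = (n%:R + 2) ^+ 2 / 2 * (r / (n%:R + 2)) ^+ 2.
    by rewrite expr_div_n; field; rewrite gt_eqF.
  by rewrite ler_wpM2r// sqr_ge0.
- apply: c0; apply: le_trans (norm_le_sqnorm _).
  by rewrite lerXn2r ?nnegrE// ltW.
Qed.

End cutoffs.

(** * Distributions and cutoffs *)

Section distributions.
Context {R : realType} {n : nat}.
Local Notation Rn := 'rV[R]_n.
Implicit Types (g phi psi chi : Rn -> R) (x y v : Rn) (U K : set Rn) (i j : 'I_n)
  (u : functional R n).

Lemma distD u phi psi : Defs.distribution u -> test_on setT phi ->
  test_on setT psi -> u (fun x => phi x + psi x) = u phi + u psi.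
Proof.
move=> [lin _] t1 t2; rewrite -[u phi]mul1r -(lin 1 _ _ t1 t2).
by congr u; apply/funext => x; rewrite mul1r.
Qed.

Lemma dist0 u : Defs.distribution u -> u (fun=> 0) = 0.
Proof.
move=> du; have := distD du (test0 setT) (test0 setT).
have -> : (fun x : Rn => 0 + 0 : R) = (fun=> 0) by apply/funext => x; rewrite addr0.
by move=> h; apply: (@addrI _ (u (fun=> 0))); rewrite addr0.
Qed.

Lemma distZ u (c : R) phi : Defs.distribution u -> test_on setT phi ->
  u (fun x => c * phi x) = c * u phi.
Proof.
move=> du tp; have [lin _] := du; have := lin c _ _ tp (test0 setT).
rewrite (dist0 du) addr0 => <-.
by congr u; apply/funext => x; rewrite addr0.
Qed.

Lemma distB u phi psi : Defs.distribution u -> test_on setT phi ->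
  test_on setT psi -> u (fun x => phi x - psi x) = u phi - u psi.
Proof.
move=> du t1 t2; have := distD du t1 (testZ (-1) t2).
rewrite (distZ _ du t2) mulN1r => <-.
by congr u; apply/funext => x; rewrite mulN1r.
Qed.

Lemma closed_zero_test U C phi : closed C -> C `<=` U ->
  test_on setT phi -> (forall x, ~ C x -> phi x = 0) -> test_on U phi.
Proof.
move=> Cc CU tp h; have [r _ hr] := test_far tp.
exact: (@testI _ _ U C phi r (test_smooth tp) Cc CU h hr).
Qed.

(** The support of [phi] lies in the complement of [W], hence in that of
    [K]. *)
Lemma dist_zero_near u K W phi : vanishes_on (~` K) u -> open W -> K `<=` W ->
  test_on setT phi -> (forall x, W x -> phi x = 0) -> u phi = 0.
Proof.
move=> vK Wo KW tp h; apply: vK.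
apply: (@closed_zero_test _ (~` W) _ _ _ tp).
- exact: open_closedC.
- exact: subsetC.
- by move=> x /= Wx; apply: h; apply: contrapT.
Qed.

Lemma cutoff_smooth K chi : cutoff K chi -> smooth_on setT chi.
Proof. by move=> [/test_smooth]. Qed.

Lemma cutoffM K chi g : cutoff K chi -> smooth_on setT g ->
  test_on setT (fun x => chi x * g x).
Proof.
move=> [tc _] sg; have -> : (fun x => chi x * g x) = (fun x => g x * chi x).
  by apply/funext => x; rewrite mulrC.
exact: testMr.
Qed.

(** The two cutoffs can be inserted together, so that the choice made in
    [pairing] does not matter. *)
Lemma cutoff_pairing_eq u K1 K2 chi1 chi2 psi : Defs.distribution u ->
  vanishes_on (~` K2) u -> cutoff K1 chi1 -> cutoff K2 chi2 ->
  smooth_on setT psi ->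
  u (fun x => chi1 x * psi x) = u (fun x => chi1 x * (chi2 x * psi x)).
Proof.
move=> du v2 c1 c2 sp; have s2 := smoothM openT (cutoff_smooth c2) sp.
apply/eqP; rewrite -subr_eq0 -(distB du (cutoffM c1 sp) (cutoffM c1 s2)).
have [_ [W [Wo KW W1]]] := c2; apply/eqP.
apply: (dist_zero_near v2 Wo KW); first exact: testB (cutoffM c1 sp) (cutoffM c1 s2).
by move=> x /W1 ->; rewrite mul1r subrr.
Qed.

Lemma pairingE u K chi psi : Defs.distribution u -> compact K ->
  vanishes_on (~` K) u -> cutoff K chi -> smooth_on setT psi ->
  pairing u psi = u (fun x => chi x * psi x).
Proof.
move=> du cK vK cc sp; rewrite /pairing; case: xgetP => [c _|/(_ (u (fun x => chi x * psi x)))]; last first.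
  by case; exists K, chi.
move=> [K' [chi' [cK' vK' cc' ->]]].
rewrite (cutoff_pairing_eq du vK cc' cc sp) (cutoff_pairing_eq du vK' cc cc' sp).
by congr u; apply/funext => x; rewrite mulrCA.
Qed.

Lemma partialZ i (c : R) g x : derivable g x (delta_mx 0 i) ->
  partial i (fun y => c * g y) x = c * partial i g x.
Proof.
move=> dg; rewrite (partialM (derivable_cst c x _) dg).
by rewrite partial_cst mul0r add0r.
Qed.

Lemma partials_lin U (a : R) (g1 g2 : Rn -> R) s :
  open U -> smooth_on U g1 -> smooth_on U g2 -> forall x, U x ->
  partials s (fun y => a * g1 y + g2 y) x = a * partials s g1 x + partials s g2 x.
Proof.
move=> Uo s1 s2; elim: s => [|i s IH] x Ux; first by [].
have p1 := smooth_partials s s1; have p2 := smooth_partials s s2.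
rewrite /= (partial_eq_on i Uo IH Ux).
rewrite (partialD (smooth_derivable (smoothZ a Uo p1) Ux) (smooth_derivable p2 Ux)).
by rewrite (partialZ a (smooth_derivable p1 Ux)).
Qed.

Lemma partialsZ U (a : R) (g : Rn -> R) s :
  open U -> smooth_on U g -> forall x, U x ->
  partials s (fun y => a * g y) x = a * partials s g x.
Proof.
move=> Uo sg x Ux.
have -> : (fun y => a * g y) = (fun y => (a - 1) * g y + g y).
  by apply/funext => y; rewrite mulrBl mul1r subrK.
by rewrite (partials_lin (a - 1) s Uo sg sg Ux) mulrBl mul1r subrK.
Qed.

Lemma dist_partial_distribution u i :
  Defs.distribution u -> Defs.distribution (dist_partial i u).
Proof.
move=> du; have [lin _] := du; apply: distributionI => [a phi psi t1 t2|K cK].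
  rewrite /dist_partial mulrN -opprD -(lin a _ _ (test_partial i t1) (test_partial i t2)).
  congr (- u _); apply/funext => x.
  rewrite (partialD (test_derivable (testZ a t1)) (test_derivable t2)).
  by rewrite (partialZ a (test_derivable t1)).
have [C [m [C0 Cm]]] := dist_bnd du cK; exists C, m.+1 => phi B tp /bndSP[_ bp].
by rewrite /dist_partial normrN; apply: Cm (test_partial i tp) (bp i).
Qed.

Lemma distribution_sub u1 u2 : Defs.distribution u1 -> Defs.distribution u2 ->
  Defs.distribution (fun phi => u1 phi - u2 phi).
Proof.
move=> d1 d2; have [l1 _] := d1; have [l2 _] := d2.
apply: distributionI => [a phi psi t1 t2|K cK].
  by rewrite l1// l2//; ring.
have [C1 [m1 [C10 h1]]] := dist_bnd d1 cK.
have [C2 [m2 [C20 h2]]] := dist_bnd d2 cK.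
exists (C1 + C2), (maxn m1 m2) => phi B tp bp.
rewrite (le_trans (ler_normB _ _))// mulrDl lerD//.
  by apply: h1 => //; apply: bnd_le bp; rewrite ?leq_maxl.
by apply: h2 => //; apply: bnd_le bp; rewrite ?leq_maxr.
Qed.

Lemma ext_diff_distribution (f : 'I_n -> functional R n) i j :
  (forall k, compact_distribution (f k)) -> Defs.distribution (ext_diff1 f i j).
Proof.
move=> hf; apply: distribution_sub; apply: dist_partial_distribution.
  by have [] := hf j.
by have [] := hf i.
Qed.

Lemma vanishes_onW U U' u : U' `<=` U -> vanishes_on U u -> vanishes_on U' u.
Proof. by move=> UU h phi tp; apply: h; exact: testW tp. Qed.

Lemma ext_diff_vanishes (f : 'I_n -> functional R n) K i j :
  (forall k, vanishes_on (~` K) (f k)) -> vanishes_on (~` K) (ext_diff1 f i j).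
Proof.
move=> vf phi tp; rewrite /ext_diff1 /dist_partial.
by rewrite (vf j _ (test_partial i tp)) (vf i _ (test_partial j tp)) oppr0 subrr.
Qed.

(** By continuity [u] is arbitrarily small on the functions [psi], while its
    value there is always the one at [phi]. *)
Lemma dist_small u K phi : Defs.distribution u -> compact K ->
  (forall m e, 0 < e -> exists psi, [/\ test_on K psi, bnd m psi e & u psi = u phi]) ->
  u phi = 0.
Proof.
move=> du cK h; have [C [m [C0 Cm]]] := dist_bnd du cK.
apply/eqP; rewrite -normr_le0; apply/ler_addgt0Pr => e e0; rewrite add0r.
have C1 : 0 < C + 1 by rewrite ltr_wpDl.
have [psi [tp bp <-]] := h m _ (divr_gt0 e0 C1).
rewrite (le_trans (Cm _ _ tp bp))// mulrA ler_pdivrMr// mulrC ler_wpM2l ?(ltW e0)//.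
by rewrite lerDl.
Qed.

End distributions.

(** * Lebesgue measure on R^n: translations and cubes *)

Section lebesgue_Rn.
Context {R : realType}.
Local Notation X := (measurableTypeR R).
Implicit Types (n : nat) (c : R).

Let addr_measurable c : measurable_fun [set: X] (fun x : X => (x + c : X)).
Proof. by apply: measurable_funD; [exact: measurable_id|exact: measurable_cst]. Qed.

Lemma lebesgue_measure_shift c (A : set X) : measurable A ->
  @lebesgue_measure R ((fun x : X => (x + c : X)) @^-1` A) = @lebesgue_measure R A.
Proof.
move=> mA; pose m := measure_function_pushforward__canonical__measure_function_Measure
  (@lebesgue_measure R) (addr_measurable c).
apply/esym; apply: (@lebesgue_measure_unique R m) => // _ [[a b]] _ <-.
rewrite /m /= /pushforward.
have -> : (fun x : X => x + c : X) @^-1` `]a, b] = `]a - c, b - c]%classic.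
  by apply/seteqP; split=> x; rewrite /= !in_itv /= ltrBlDr lerBrDr.
rewrite !lebesgue_measure_itv /= !lte_fin ltrD2r; case: ifP => // _.
by rewrite -!EFinB; congr (_%:E); ring.
Qed.

Definition shift_tuple n (v : nat -> R) (t : n.-tuple X) : n.-tuple X :=
  [tuple (tnth t i + v i : X) | i < n].

Lemma measurable_shift_tuple n v : measurable_fun setT (@shift_tuple n v).
Proof.
apply/measurable_fun_tnthP => i.
have -> : (fun t => tnth t i) \o @shift_tuple n v = (fun t => tnth t i + v i).
  by apply/funext => t /=; rewrite tnth_mktuple.
by apply: measurable_funD; [exact: measurable_tnth|exact: measurable_cst].
Qed.

(** By induction on the dimension, through the product measure that defines
    [lebesgue_tuple]. *)
Lemma lebesgue_tuple_shift n v (A : set (n.-tuple X)) : measurable A ->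
  lebesgue_tuple R n (shift_tuple v @^-1` A) = lebesgue_tuple R n A.
Proof.
elim: n v A => [|n IH] v A mA.
  congr (lebesgue_tuple R 0 _); apply/seteqP; split=> t /=.
    by rewrite (tuple0 (shift_tuple v t)) (tuple0 t).
  by rewrite (tuple0 (shift_tuple v t)) (tuple0 t).
pose w k := v k.+1.
pose s (p : X * n.-tuple X) := (p.1 + v 0%N : X, shift_tuple w p.2).
have ms : measurable_fun setT s.
  apply/measurable_fun_pairP; split => /=.
    exact: (measurableT_comp (addr_measurable (v 0%N)) measurable_fst).
  exact: (measurableT_comp (@measurable_shift_tuple n w) measurable_snd).
pose P := (@lebesgue_measure R \x lebesgue_tuple R n)%E.
pose m := measure_function_pushforward__canonical__measure_function_Measure P ms.
have mPE B : measurable B -> P B = m B.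
  apply: product_measure_unique => C D mC mD; rewrite /m /= /pushforward.
  have -> : s @^-1` (C `*` D) =
      ((fun x : X => (x + v 0%N : X)) @^-1` C) `*` (shift_tuple w @^-1` D) by [].
  rewrite /P product_measure1E.
  - by congr (_ * _)%E; [exact: lebesgue_measure_shift|exact: IH].
  - by rewrite -[X in measurable X]setTI; exact: addr_measurable.
  - by rewrite -[X in measurable X]setTI; exact: measurable_shift_tuple.
rewrite /= /lebesgue_cons /pushforward.
have mA' : measurable (@cons_pair R n @^-1` A).
  by rewrite -[X in measurable X]setTI; exact: measurable_cons_pair.
rewrite -/P (mPE _ mA') /m /= /pushforward; congr (P _).
apply/seteqP; split=> -[x t] /=; congr A; apply/eq_from_tnth => i;
  rewrite tnth_mktuple; case: (unliftP ord0 i) => [j|] ->;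
  by rewrite ?(tnth0, tnthS) ?tnth_mktuple.
Qed.

Definition cube n (a : R) : set (n.-tuple X) := [set t | forall i, `|tnth t i| <= a].

Lemma measurable_cube n a : measurable (@cube n a).
Proof.
have -> : @cube n a = ~` (\bigcup_i [set t | ~ `|tnth t i| <= a]).
  apply/seteqP; split=> t /=; first by move=> h [i _ /=]; apply.
  by move=> h i; apply: contrapT => hi; apply: h; exists i.
apply: measurableC; apply: countable_bigcupT_measurable => // i.
have -> : [set t | ~ `|tnth t i| <= a] = (fun t => tnth t i) @^-1` (~` `[- a, a]).
  by apply/seteqP; split=> t /=; rewrite in_itv /= ler_norml.
rewrite -[X in measurable X]setTI; apply: measurable_tnth => //.
exact: measurableC.
Qed.

Lemma lebesgue_cube n a : 0 <= a ->
  lebesgue_tuple R n (cube a) = ((2 * a) ^+ n)%:E.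
Proof.
move=> a0; elim: n => [|n IH].
  rewrite /= /lebesgue_nil diracE expr0 mem_set// /cube /=.
  by case.
rewrite /= /lebesgue_cons /pushforward.
have -> : @cons_pair R n @^-1` cube a = `[- a, a]%classic `*` cube a.
  apply/seteqP; split=> -[x t] /=.
    move=> h; split; first by rewrite in_itv /= -ler_norml; exact: (h ord0).
    by move=> i; have := h (lift ord0 i); rewrite tnthS.
  move=> [xa ta] i; case: (unliftP ord0 i) => [j|] ->; first by rewrite tnthS.
  by rewrite tnth0 ler_norml; move: xa; rewrite in_itv.
rewrite product_measure1E//; last exact: measurable_cube.
rewrite IH exprS EFinM; congr (_ * _)%E.
apply: (etrans (@lebesgue_measure_itv R `[- a, a])).
rewrite /= lte_fin; case: ltP => h.
  by rewrite -EFinB opprK mulr_natl mulr2n.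
have -> : a = 0 by apply/eqP; rewrite eq_le a0 andbT; lra.
by rewrite mulr0.
Qed.

End lebesgue_Rn.

(** * Measurability of continuous functions *)

Section measurability.
Context {R : realType} {n : nat}.
Local Notation Rn := 'rV[R]_n.

(** A continuous function is the limit of its compositions with the roundings to
    the lattices of mesh 1/(k+1), and these take countably many values. *)
Lemma measurable_continuous d (T : measurableType d) (p : T -> Rn) (g : Rn -> R) :
  (forall i, measurable_fun setT (fun t => p t 0 i)) ->
  (forall x, {for x, continuous g}) -> measurable_fun setT (fun t => g (p t)).
Proof.
move=> mp cg.
pose c k : R := k.+1%:R.
have c0 k : 0 < c k by exact: ltr0Sn.
pose q k t : Rn := \row_i ((Num.floor (c k * p t 0 i))%:~R / c k).
have mq k : measurable_fun setT (fun t => g (q k t)).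
  move=> _ Y mY; rewrite setTI.
  pose rv (v : {ffun 'I_n -> int}) : Rn := \row_i ((v i)%:~R / c k).
  pose F (v : {ffun 'I_n -> int}) : set T :=
    \bigcap_(i in [set: 'I_n]) ((fun t => c k * p t 0 i) @^-1`
       `[(v i)%:~R, (v i)%:~R + 1[%classic).
  have -> : (fun t => g (q k t)) @^-1` Y =
      \bigcup_v (if `[< Y (g (rv v)) >] then F v else set0).
    apply/seteqP; split=> t /=.
      move=> Yt; exists [ffun i => Num.floor (c k * p t 0 i)] => //.
      have E : rv [ffun i => Num.floor (c k * p t 0 i)] = q k t.
        by apply/rowP => i; rewrite !mxE ffunE.
      rewrite E; case: asboolP => // _ i _ /=.
      by rewrite in_itv /= ffunE -intrD1 floor_itv.
    move=> [v _]; case: asboolP => // Yv vt; congr Y : Yv; congr g.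
    apply/rowP => i; rewrite !mxE; congr (_%:~R / _); apply/esym/floor_def.
    by have := vt i I; rewrite /= in_itv /= intrD1.
  apply: countable_bigcupT_measurable => // v; case: ifP => // _.
  apply: fin_bigcap_measurable => // i _; rewrite -[X in measurable X]setTI.
  by apply: measurable_realfun.measurable_funM.
apply: (@measurable_fun_cvg _ _ _ _ (fun k t => g (q k t))) => // t _.
suff qp : (fun k => q k t) @ \oo --> p t.
  exact: (cvg_comp _ _ qp (cg (p t))).
apply/cvgrPdist_le => e e0; near=> k.
apply: norm_le_coord; first exact: ltW.
move=> i; rewrite !mxE.
have h1 : c k * p t 0 i - 1 < (Num.floor (c k * p t 0 i))%:~R.
  by rewrite ltrBlDr -intrD1 floorD1_gt.
have h2 := floor_le (c k * p t 0 i).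
have -> : p t 0 i - (Num.floor (c k * p t 0 i))%:~R / c k =
    (c k * p t 0 i - (Num.floor (c k * p t 0 i))%:~R) / c k.
  by field; rewrite gt_eqF.
rewrite normrM normfV (gtr0_norm (c0 k)) ler_pdivrMr//.
rewrite ger0_norm ?subr_ge0//.
have h3 : 1 <= e * c k.
  rewrite mulrC -ler_pdivrMr// mul1r; near: k.
  apply: filterS (nbhs_infty_ger e^-1) => k ek.
  by rewrite (le_trans ek)// ler_nat.
lra.
Unshelve. all: by end_near. Qed.

End measurability.

(** * Integrals of translates of a function *)

Lemma eps_delta_continuous {R : realType} {n : nat} (g : 'rV[R]_n -> R) y :
  (forall e, 0 < e -> exists2 r, 0 < r & forall x, `|x - y| < r ->
     `|g y - g x| <= e) -> {for y, continuous g}.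
Proof.
move=> h A /nbhs_normP[e /= e0 eA].
have [r r0 hr] := h (e / 2) (divr_gt0 e0 (ltr0Sn _ 1)).
apply/near_normP; exists r => // x xy; apply: eA => /=.
by rewrite (le_lt_trans (hr _ xy))// ltr_pdivrMr// ltr_pMr// ltr1n.
Qed.

(** The class of functions whose averages are differentiated under the
    integral sign; unlike the class of test functions, it is stable under
    [par]. *)
Definition bsmooth {R : realType} {n : nat} (psi : 'rV[R]_n -> R) : Prop :=
  smooth_on setT psi /\ forall m, exists B, bnd m psi B.

Section parameter_integrals.
Context {R : realType} {n : nat} d {T : measurableType d}
  (mu : {measure set T -> \bar R}) (k : T -> R) (p : T -> 'rV[R]_n).
Local Notation Rn := 'rV[R]_n.
Local Notation ei i := (delta_mx 0 i : 'rV[R]_n).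
Implicit Types (psi : Rn -> R) (y : Rn) (i : 'I_n).
Hypothesis ik : mu.-integrable setT (EFin \o k).
Hypothesis mp : forall i, measurable_fun setT (fun t => p t 0 i).

(** A superposition of the translates of [psi] by [p t], with weights [k t].
    Convolutions, mollifications and integrals along segments all have this
    form, with different measure spaces. *)
Definition par psi : Rn -> R := fun y => (\int[mu]_t (k t * psi (y + p t)))%R.

Definition mass : R := (\int[mu]_t `|k t|)%R.

Lemma mass_ge0 : 0 <= mass.
Proof. by apply: Rintegral_ge0. Qed.

Let mk : measurable_fun setT k.
Proof. by apply/measurable_EFinP; apply: (measurable_int mu). Qed.

Lemma measurable_par psi y : (forall x, {for x, continuous psi}) ->
  measurable_fun setT (fun t => psi (y + p t)).
Proof.
move=> cp; apply: (measurable_continuous (p := fun t => y + p t)) => // i.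
have -> : (fun t => (y + p t) 0 i) = (fun t => y 0 i + p t 0 i).
  by apply/funext => t; rewrite mxE.
by apply: measurable_realfun.measurable_funD.
Qed.

Lemma integrable_bounded_mul (g : T -> R) (B : R) : measurable_fun setT g ->
  (forall t, `|g t| <= B) -> mu.-integrable setT (EFin \o (fun t => k t * g t)).
Proof.
move=> mg gB; have i1 : mu.-integrable setT (fun t => (B%:E * (EFin \o k) t)%E).
  exact: integrableZl.
apply: (le_integrable measurableT _ _ i1).
  by apply/measurable_EFinP; apply: measurable_realfun.measurable_funM.
move=> t _ /=; rewrite lee_fin mulrC !normrM ler_wpM2r//.
by rewrite (le_trans (gB t))// ler_norm.
Qed.

Lemma Rintegral_bounded_mul (g : T -> R) (B : R) : measurable_fun setT g ->
  (forall t, `|g t| <= B) -> `|(\int[mu]_t (k t * g t))%R| <= mass * B.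
Proof.
move=> mg gB; have i1 := integrable_bounded_mul mg gB.
rewrite (le_trans (le_normr_Rintegral measurableT i1))//.
have ia : mu.-integrable setT (EFin \o (fun t => `|k t|)).
  exact: (integrable_norm ik).
rewrite /mass -RintegralZr//; apply: le_Rintegral => //.
- exact: (integrable_norm i1).
- have := integrableZl measurableT B ia.
  by congr (_.-integrable _ _); apply/funext => t /=; rewrite -EFinM mulrC.
- by move=> t _; rewrite normrM ler_wpM2l.
Qed.

Lemma bsmooth_bounded psi : bsmooth psi -> exists B, forall x, `|psi x| <= B.
Proof. by move=> [_ /(_ 0)[B /bnd0P]]; exists B. Qed.

Lemma bsmooth_cont psi : bsmooth psi -> forall x, {for x, continuous psi}.
Proof. by move=> [sp _] x; exact: (smooth_continuous sp I). Qed.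

Lemma bsmooth_partial psi i : bsmooth psi -> bsmooth (partial i psi).
Proof.
move=> [sp bp]; split=> [|m]; first exact: smooth_partial.
by have [B /bndSP[_ h]] := bp m.+1; exists B.
Qed.

Lemma bsmooth_partials psi s : bsmooth psi -> bsmooth (partials s psi).
Proof. by move=> bp; elim: s => [|i s IH]; [exact: bp|exact: bsmooth_partial]. Qed.

Lemma integrable_par psi y : bsmooth psi ->
  mu.-integrable setT (EFin \o (fun t => k t * psi (y + p t))).
Proof.
move=> bp; have [B hB] := bsmooth_bounded bp.
by apply: (integrable_bounded_mul (B := B)) => //; apply: measurable_par; exact: bsmooth_cont.
Qed.

Lemma par_le psi (B : R) y : (forall x, {for x, continuous psi}) ->
  (forall x, `|psi x| <= B) -> `|par psi y| <= mass * B.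
Proof. by move=> cp hB; apply: Rintegral_bounded_mul => //; exact: measurable_par. Qed.

Lemma par_sub psi1 psi2 y1 y2 : bsmooth psi1 -> bsmooth psi2 ->
  par psi1 y1 - par psi2 y2 =
  (\int[mu]_t (k t * (psi1 (y1 + p t) - psi2 (y2 + p t))))%R.
Proof.
move=> b1 b2; rewrite /par -RintegralB//; try exact: integrable_par.
by apply: eq_Rintegral => t _; rewrite mulrBr.
Qed.

Lemma par_lipschitz psi (B : R) y1 y2 : bsmooth psi -> bnd 1 psi B ->
  `|par psi y1 - par psi y2| <= mass * (n%:R * B * `|y1 - y2|).
Proof.
move=> bp hB; rewrite par_sub//; apply: Rintegral_bounded_mul.
  apply: measurable_realfun.measurable_funB; apply: measurable_par;
  exact: bsmooth_cont.
move=> t; rewrite (le_trans (bnd_lipschitz _ _ bp.1 hB))//.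
by rewrite opprD addrACA subrr addr0.
Qed.

Lemma par_continuous psi : bsmooth psi -> forall y, {for y, continuous (par psi)}.
Proof.
move=> bp y; have [B hB] := bp.2 1%N.
apply: eps_delta_continuous => e e0.
have B0 := bnd_ge0 hB; have m0 := mass_ge0.
have C0 : 0 < mass * (n%:R * B) + 1 by rewrite ltr_wpDl// !mulr_ge0.
exists (e / (mass * (n%:R * B) + 1)); first by rewrite divr_gt0.
move=> x xy; apply: le_trans (par_lipschitz _ _ bp hB) _.
rewrite mulrA distrC; move: xy; rewrite ltr_pdivlMr// => /ltW; apply: le_trans.
by rewrite mulrC ler_wpM2l// lerDl.
Qed.

(** The remainder in Taylor's formula is uniform in the base point, so it
    can be integrated. *)
Lemma par_taylor psi (B : R) y i (h : R) : bsmooth psi -> bnd 2 psi B ->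
  `|par psi (y + h *: ei i) - par psi y - h * par (partial i psi) y| <=
  mass * (h ^+ 2 * B).
Proof.
move=> bp hB; have bp' := bsmooth_partial i bp.
rewrite par_sub// -RintegralZl//; last exact: integrable_par.
have [C hC] := bsmooth_bounded bp; have [C' hC'] := bsmooth_bounded bp'.
have mb z : measurable_fun setT (fun t => psi (z + p t)).
  by apply: measurable_par; exact: bsmooth_cont.
have mb' : measurable_fun setT (fun t => partial i psi (y + p t)).
  by apply: measurable_par; exact: bsmooth_cont.
rewrite -RintegralB//; first last.
- have := integrableZl measurableT h (integrable_par y bp').
  by congr (_.-integrable _ _); apply/funext => t /=; rewrite -EFinM.
- apply: (integrable_bounded_mul (B := C + C)).
    exact: measurable_realfun.measurable_funB.
  by move=> t; rewrite (le_trans (ler_normB _ _))// lerD.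
have -> : (\int[mu]_t (k t * (psi (y + h *: ei i + p t) - psi (y + p t)) -
    h * (k t * partial i psi (y + p t))))%R =
  (\int[mu]_t (k t * (psi (y + h *: ei i + p t) - psi (y + p t) -
    h * partial i psi (y + p t))))%R.
  apply: eq_Rintegral => t _; move: (psi _) (psi _) (partial i psi _) => a b c.
  by ring.
apply: Rintegral_bounded_mul.
  apply: measurable_realfun.measurable_funB.
    exact: measurable_realfun.measurable_funB.
  by apply: measurable_realfun.measurable_funM.
by move=> t; rewrite [y + h *: ei i + p t]addrAC; exact: line_taylor bp.1 hB.
Qed.

Lemma par_derive psi y i : bsmooth psi ->
  is_derive y (ei i) (par psi) (par (partial i psi) y).
Proof.
move=> bp; have [B hB] := bp.2 2%N; have B0 := bnd_ge0 hB; have m0 := mass_ge0.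
have C0 : 0 < mass * B + 1 by rewrite ltr_wpDl// mulr_ge0.
have C : (fun h : R => h^-1 *: ((par psi \o shift y) (h *: ei i) - par psi y)) @ 0^'
    --> par (partial i psi) y.
  apply/cvgrPdist_le => e e0; near=> h.
  have h0 : h != 0 by near: h; exact: nbhs_dnbhs_neq.
  rewrite distrC /= [_ *: (_ - _)]/(_ * _).
  have -> : h^-1 * (par psi (h *: ei i + y) - par psi y) - par (partial i psi) y =
      h^-1 * (par psi (y + h *: ei i) - par psi y - h * par (partial i psi) y).
    rewrite [h *: _ + y]addrC.
    by rewrite [RHS]mulrBr [h^-1 * (h * _)]mulrA mulVf// mul1r.
  rewrite normrM normfV ler_pdivrMl ?normr_gt0//.
  apply: le_trans (par_taylor y i h bp hB) _.
  rewrite -[h ^+ 2]real_normK ?num_real// expr2 mulrCA -!mulrA ler_wpM2l//.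
  rewrite mulrCA mulrC.
  have : `|h| <= e / (mass * B + 1).
    by near: h; apply: dnbhs0_le; rewrite divr_gt0.
  rewrite ler_pdivlMr//; apply: le_trans; rewrite -mulrA ler_wpM2l//.
  by rewrite mulrC lerDl.
split; first by apply/cvg_ex; eexists; exact: C.
exact: (cvg_lim _ C).
Unshelve. all: by end_near. Qed.

Lemma par_partial psi i : bsmooth psi -> partial i (par psi) = par (partial i psi).
Proof. by move=> bp; apply/funext => y; have [_ <-] := par_derive y i bp. Qed.

Lemma par_partials psi s : bsmooth psi -> partials s (par psi) = par (partials s psi).
Proof.
move=> bp; elim: s => [|i s IH]; first by [].
rewrite /= [partials s _]IH; apply: par_partial; exact: bsmooth_partials.
Qed.

Lemma par_smooth psi : bsmooth psi -> smooth_on setT (par psi).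
Proof.
move=> bp s x _; rewrite (par_partials s bp).
have bs := bsmooth_partials s bp; split; first exact: par_continuous.
by move=> i; have [] := par_derive x i bs.
Qed.

Lemma par_bnd psi m (B : R) : bsmooth psi -> bnd m psi B -> bnd m (par psi) (mass * B).
Proof.
move=> bp hB s x sm; rewrite (par_partials s bp); apply: par_le.
  by apply: bsmooth_cont; exact: bsmooth_partials.
by move=> y; exact: hB.
Qed.

Lemma par_bsmooth psi : bsmooth psi -> bsmooth (par psi).
Proof.
move=> bp; split=> [|m]; first exact: par_smooth.
by have [B hB] := bp.2 m; exists (mass * B); exact: par_bnd.
Qed.

End parameter_integrals.

Lemma test_bsmooth {R : realType} {n : nat} (phi : 'rV[R]_n -> R) :
  test_on setT phi -> bsmooth phi.
Proof. by move=> tp; split=> [|m]; [exact: (test_smooth tp)|exact: test_bnd]. Qed.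

(** * Convolution with a locally integrable kernel *)

Section integrals_Rn.
Context {R : realType} {n : nat}.
Local Notation Rn := 'rV[R]_n.
Local Notation X := (measurableTypeR R).
Local Notation mu := (lebesgue_tuple R n).
Local Notation ei i := (delta_mx 0 i : 'rV[R]_n).
Implicit Types (g phi psi k : Rn -> R) (x y v : Rn) (i : 'I_n).

Definition row_of (t : n.-tuple X) : Rn := \row_i tnth t i.

Lemma measurable_row_of i : measurable_fun setT (fun t => row_of t 0 i).
Proof.
have -> : (fun t => row_of t 0 i) = (fun t => tnth t i).
  by apply/funext => t; rewrite mxE.
exact: measurable_tnth.
Qed.

Lemma integral_RnE g : integral_Rn g = (\int[mu]_t g (row_of t))%R.
Proof. by []. Qed.

Definition intRn g := mu.-integrable setT (EFin \o (g \o row_of)).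

Lemma cubeP (t : n.-tuple X) (r : R) : 0 <= r -> cube r t <-> `|row_of t| <= r.
Proof.
move=> r0; split=> [h|h i]; first by apply: norm_le_coord => // i; rewrite mxE.
by apply: le_trans h; have := coord_le_norm (row_of t) i; rewrite mxE.
Qed.

Lemma integrable_cube (r : R) : mu.-integrable setT (EFin \o (\1_(cube r) : _ -> R)).
Proof.
apply/integrableP; split.
  by apply/measurable_EFinP; apply: measurable_indic; exact: measurable_cube.
rewrite (eq_integral (fun t => (\1_(@cube R n r) t)%:E)); last first.
  by move=> t _ /=; rewrite ger0_norm.
rewrite integral_indic//; last exact: measurable_cube.
have fin a : 0 <= a -> (mu (cube a) < +oo)%E.
  by move=> a0; rewrite [ltLHS](@lebesgue_cube R n a a0) ltry.
rewrite setIT; have [r0|r0] := leP 0 r; first exact: fin.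
apply: le_lt_trans (fin 0 (lexx 0)).
apply: le_measure; rewrite ?inE; try exact: measurable_cube.
by move=> t h i; apply: le_trans (h i) (ltW r0).
Qed.

Lemma integral_cube (r : R) : 0 <= r -> (\int[mu]_t (\1_(cube r) t : R))%R = (2 * r) ^+ n.
Proof.
move=> r0; rewrite /Rintegral integral_indic//; last exact: measurable_cube.
by rewrite setIT [X in fine X](@lebesgue_cube R n r r0).
Qed.

Definition nat_coord v (m : nat) : R := if insub m is Some i then v 0 i else 0.

Lemma row_of_shift v t : row_of (shift_tuple (nat_coord v) t) = row_of t + v.
Proof.
apply/rowP => i; rewrite !mxE tnth_mktuple /nat_coord; congr (_ + _).
by rewrite (valK i).
Qed.

Lemma integral_Rn_shift g v : measurable_fun setT (g \o row_of) ->
  intRn (fun x => g (x + v)) ->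
  integral_Rn (fun x => g (x + v)) = integral_Rn g.
Proof.
move=> mg ig; rewrite !integral_RnE /Rintegral; congr fine.
have ms := @measurable_shift_tuple R n (nat_coord v).
pose m := measure_function_pushforward__canonical__measure_function_Measure mu ms.
have -> : (\int[mu]_t (g (row_of t))%:E = \int[m]_t (g (row_of t))%:E)%E.
  apply: eq_measure_integral => A mA _.
  by apply/esym; exact: lebesgue_tuple_shift.
rewrite /m (@integral_pushforward _ _ _ _ _ _ ms mu setT (EFin \o (g \o row_of)))//.
- by rewrite preimage_setT; apply: eq_integral => t _ /=; rewrite row_of_shift.
- exact/measurable_EFinP.
- rewrite preimage_setT; move: ig; congr (_.-integrable _ _).
  by apply/funext => t /=; rewrite row_of_shift.
Qed.

Lemma measurable_row_continuous g : (forall x, {for x, continuous g}) ->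
  measurable_fun setT (g \o row_of).
Proof. by move=> cg; apply: (measurable_continuous (p := row_of) measurable_row_of). Qed.

Lemma measurable_row_shift k v : measurable_fun setT (k \o row_of) ->
  measurable_fun setT (fun t => k (row_of t + v)).
Proof.
move=> mk; have -> : (fun t => k (row_of t + v)) =
    (k \o row_of) \o shift_tuple (nat_coord v).
  by apply/funext => t /=; rewrite row_of_shift.
exact: (measurableT_comp mk (@measurable_shift_tuple R n _)).
Qed.

Definition locint k := measurable_fun setT (k \o row_of) /\
  forall r : R, mu.-integrable setT (EFin \o (fun t => \1_(cube r) t * k (row_of t))).

(** The derivatives of this integral fall on [phi], which allows [k] to be
    singular. It is the convolution of [phi] with the reflection of [k], and
    all kernels to which it is applied are even. *)
Definition Conv k phi y := integral_Rn (fun z => k z * phi (z + y)).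

(** Near a given point, only a bounded part of the kernel matters. *)
Lemma Conv_par k phi (r rho : R) y : 0 < r -> 0 < rho ->
  (forall x, r < `|x| -> phi x = 0) -> `|y| <= rho ->
  Conv k phi y = par mu (fun t => \1_(cube (r + rho)) t * k (row_of t)) row_of phi y.
Proof.
move=> r0 rho0 hr yr; rewrite /Conv integral_RnE /par; apply: eq_Rintegral => t _.
rewrite indicE [_ + y]addrC; have [|tc] := boolP (t \in cube (r + rho)).
  by rewrite mul1r.
rewrite hr ?mulr0//; rewrite ltNge; apply/negP => yt; move/negP: tc; apply.
rewrite inE; apply/cubeP; first by rewrite addr_ge0// ltW.
by rewrite -(addKr y (row_of t)) (le_trans (ler_normD _ _))// normrN addrC lerD.
Qed.

Lemma locint_par k (r : R) : locint k ->
  mu.-integrable setT (EFin \o (fun t => \1_(cube r) t * k (row_of t))).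
Proof. by case. Qed.

(** Smoothness is local, while the bounded part of the kernel that
    [Conv_par] provides depends on the radius. *)
Lemma smooth_balls g : (forall rho : R, 0 < rho -> exists2 g', smooth_on setT g' &
    forall y, `|y| < rho -> g y = g' y) -> smooth_on setT g.
Proof.
move=> h s x _; have rx : 0 < `|x| + 1 by rewrite ltr_wpDl.
have [g' sg' E] := h _ rx.
pose U := [set y : Rn | `|y - 0| < `|x| + 1].
have Uo : open U by exact: open_norm_lt.
have sg : smooth_on U g.
  apply: (smooth_eq_on Uo (g1 := g')) => [y|].
    by rewrite /U /= subr0 => /E ->.
  exact: smooth_onW sg'.
by apply: sg; rewrite /U /= subr0 ltrDl.
Qed.

Lemma Conv_local k phi (rho : R) : locint k -> test_on setT phi -> 0 < rho ->
  exists r, forall s y, `|y| < rho -> Conv k (partials s phi) y =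
    par mu (fun t => \1_(cube r) t * k (row_of t)) row_of (partials s phi) y.
Proof.
move=> lk tp rho0; have [r r0 hr] := test_far tp; exists (r + rho) => s y yr.
apply: Conv_par => //; last exact: ltW.
elim: s => [|i s IH] x rx; first exact: hr.
have Uo := @open_norm_gt R n 0 r.
rewrite -[RHS](partial_cst i 0 x).
apply: (partial_eq_on i Uo); last by rewrite /= subr0.
by move=> z /=; rewrite subr0 => /IH.
Qed.

Lemma Conv_smooth k phi : locint k -> test_on setT phi -> smooth_on setT (Conv k phi).
Proof.
move=> lk tp; apply: smooth_balls => rho rho0.
have [r h] := Conv_local lk tp rho0.
exists (par mu (fun t => \1_(cube r) t * k (row_of t)) row_of phi); last exact: (h [::]).
apply: par_smooth; [exact: locint_par|exact: measurable_row_of|exact: test_bsmooth].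
Qed.

Lemma Conv_partial k phi i : locint k -> test_on setT phi ->
  partial i (Conv k phi) = Conv k (partial i phi).
Proof.
move=> lk tp; apply/funext => x; have rx : 0 < `|x| + 1 by rewrite ltr_wpDl.
have [r h] := Conv_local lk tp rx.
have xx : `|x| < `|x| + 1 by rewrite ltrDl.
rewrite (h [:: i] x xx) -par_partial.
- apply: (@partial_eq_on _ _ [set y : Rn | `|y - 0| < `|x| + 1]).
  + exact: open_norm_lt.
  + by move=> y; rewrite /= subr0 => /(h [::]).
  + by rewrite /= subr0.
- exact: locint_par.
- exact: measurable_row_of.
- exact: test_bsmooth.
Qed.

Lemma Conv_partials k phi s : locint k -> test_on setT phi ->
  partials s (Conv k phi) = Conv k (partials s phi).
Proof.
move=> lk tp; elim: s => [|i s IH]; first by [].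
by rewrite /= [partials s _]IH Conv_partial//; exact: test_partials.
Qed.

Lemma intRn_Conv k phi y : locint k -> test_on setT phi ->
  intRn (fun z => k z * phi (z + y)).
Proof.
move=> lk tp; have [r r0 hr] := test_far tp.
have i1 := integrable_par (locint_par (r + (`|y| + 1)) lk) measurable_row_of y (test_bsmooth tp).
move: i1; congr (_.-integrable _ _); apply/funext => t /=; congr (_%:E).
rewrite indicE [row_of t + y]addrC; have [|tc] := boolP (t \in cube (r + (`|y| + 1))).
  by rewrite mul1r.
rewrite hr ?mulr0//; rewrite ltNge; apply/negP => yt; move/negP: tc; apply.
rewrite inE; apply/cubeP; first by rewrite !addr_ge0// ltW.
rewrite -(addKr y (row_of t)) (le_trans (ler_normD _ _))// normrN addrC lerD//.
by rewrite lerDl.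
Qed.

Lemma Conv_sub k phi y : locint k -> test_on setT phi ->
  integral_Rn (fun x => k (x - y) * phi x) = Conv k phi y.
Proof.
move=> lk tp; rewrite /Conv -(@integral_Rn_shift (fun x => k (x - y) * phi x) y).
- by congr integral_Rn; apply/funext => x; rewrite addrK.
- apply: measurable_realfun.measurable_funM; first exact: (measurable_row_shift _ lk.1).
  by apply: measurable_row_continuous; apply: bsmooth_cont; exact: test_bsmooth.
- have -> : (fun x => k (x + y - y) * phi (x + y)) = (fun x => k x * phi (x + y)).
    by apply/funext => x; rewrite addrK.
  exact: intRn_Conv.
Qed.

Lemma locint_cst (c : R) : locint (fun=> c).
Proof.
split=> [|r]; first exact: measurable_cst.
have := integrableZl measurableT c (integrable_cube r).
by congr (_.-integrable _ _); apply/funext => t /=; rewrite mulrC EFinM.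
Qed.

Lemma intRn_test phi : test_on setT phi -> intRn phi.
Proof.
move=> tp; have := intRn_Conv 0 (locint_cst 1) tp; congr intRn.
by apply/funext => x; rewrite mul1r addr0.
Qed.

(** The integral is invariant under translation, so its derivative along [i],
    which is the integral of the partial derivative, is 0. *)
Lemma integral_Rn_partial phi i : test_on setT phi -> integral_Rn (partial i phi) = 0.
Proof.
move=> tp.
have C1 psi y : test_on setT psi -> Conv (fun=> 1) psi y = integral_Rn psi.
  move=> ts; rewrite /Conv; have mp : measurable_fun setT (psi \o row_of).
    by apply: measurable_row_continuous; apply: bsmooth_cont; exact: test_bsmooth.
  have -> : (fun z => 1 * psi (z + y)) = (fun z => psi (z + y)).
    by apply/funext => z; rewrite mul1r.
  by apply: integral_Rn_shift => //; apply: intRn_test; exact: test_shift.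
rewrite -(C1 _ 0 (test_partial i tp)) -(Conv_partial i (locint_cst 1) tp).
have -> : Conv (fun=> 1) phi = (fun=> integral_Rn phi) by apply/funext => y; exact: C1.
exact: partial_cst.
Qed.

End integrals_Rn.

(** * Powers of 1/|x| and their integrability *)

Section radial.
Context {R : realType} {n : nat}.
Local Notation Rn := 'rV[R]_n.
Local Notation ei i := (delta_mx 0 i : 'rV[R]_n).
Implicit Types (x : Rn) (i j : 'I_n) (e : R).

(** The inverse of the Euclidean norm, which is the case [e = 0], and its smooth
    regularizations. *)
Definition rad e x : R := (Num.sqrt (sqnorm x + e))^-1.

Lemma rad0E x : rad 0 x = (enorm x)^-1.
Proof. by rewrite /rad addr0. Qed.

Lemma rad_ge0 e x : 0 <= rad e x.
Proof. by rewrite invr_ge0 sqrtr_ge0. Qed.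

Lemma sqr_rad e x : 0 < sqnorm x + e -> rad e x ^+ 2 = (sqnorm x + e)^-1.
Proof. by move=> h; rewrite /rad exprVn sqr_sqrtr// ltW. Qed.

Lemma rad_eq0 : rad 0 (0 : Rn) = 0.
Proof.
rewrite /rad addr0 /sqnorm big1 ?sqrtr0 ?invr0// => i _.
by rewrite mxE expr0n.
Qed.

Definition rad_dom e : set Rn := [set x | 0 < sqnorm x + e].

Lemma continuous_sqnorm x : {for x, continuous (@sqnorm R n)}.
Proof. exact: (smooth_continuous (smooth_sqnorm openT) I). Qed.

Lemma rad_dom_open e : open (rad_dom e).
Proof.
have -> : rad_dom e = (@sqnorm R n) @^-1` [set t | - e < t].
  by apply/seteqP; split=> x; rewrite /rad_dom /= -ltrBlDr sub0r.
apply: open_comp; last exact: open_gt.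
by move=> x _; exact: continuous_sqnorm.
Qed.

Lemma rad_dom_neq0 x : x != 0 -> rad_dom 0 x.
Proof. by move=> x0; rewrite /rad_dom /= addr0 sqnorm_gt0. Qed.

Lemma rad_domT e : 0 < e -> rad_dom e = setT.
Proof.
by move=> e0; apply/seteqP; split=> // x _; rewrite /rad_dom /= ltr_wpDl// sqnorm_ge0.
Qed.

Lemma partial_sqnorm i x : partial i (@sqnorm R n) x = 2 * x 0 i.
Proof.
have d k : is_derive x (ei i) (fun y : Rn => y 0 k ^+ 2) (2 * x 0 k * (i == k)%:R).
  have := is_derive_comp (is_deriveX 2 (is_derive_id (x 0 k) 1)) (coord_derive x i k).
  by rewrite /= expr1 exprfctE /= /GRing.scale /= mulr1.
have E : @sqnorm R n = \sum_(k < n) (fun y : Rn => y 0 k ^+ 2).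
  by apply/funext => y; rewrite /sqnorm fct_sumE.
have [_] := is_derive_sum d; rewrite -E /partial => ->.
rewrite (bigD1 i)//= eqxx mulr1 big1 ?addr0// => k ki.
by rewrite eq_sym (negbTE ki) mulr0.
Qed.

Lemma is_derive_rad e i x : rad_dom e x ->
  is_derive x (ei i) (rad e) (- 1 * (x 0 i * (rad e x * (rad e x * rad e x)))).
Proof.
move=> h; have q0 : 0 < sqnorm x + e by [].
have s0 : Num.sqrt (sqnorm x + e) != 0 by rewrite gt_eqF// sqrtr_gt0.
have d1 : is_derive x (ei i) (fun y : Rn => sqnorm y + e) (2 * x 0 i).
  have d2 := is_derive_partial i (smooth_sqnorm openT) (I : setT x).
  have := @is_deriveD _ _ _ (@sqnorm R n) (cst e) x (ei i) _ _ d2 (is_derive_cst e x _).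
  by rewrite addr0 partial_sqnorm.
have := is_derive_comp (f := fun t => t^-1) (is_derive_inv s0)
  (is_derive_comp (is_derive1_sqrt q0) d1).
move=> d; apply: (is_derive_eq d); rewrite /rad expr2.
by field.
Qed.

Lemma smooth_rad e : smooth_on (rad_dom e) (rad e).
Proof.
pose B h := smooth_on (rad_dom e) h \/ h = rad e.
have Uo : open (rad_dom e) by exact: rad_dom_open.
apply: (@alg_smooth _ _ _ B Uo); last by apply: alg_base; right.
  move=> h [sh|->] x Ux; first exact: (smooth_continuous sh Ux).
  have q0 : 0 < sqnorm x + e by [].
  apply: continuousV; first by rewrite gt_eqF// sqrtr_gt0.
  apply: (@continuous_comp Rn R R (fun y => sqnorm y + e) Num.sqrt x); last exact: sqrt_continuous.
  by apply: continuousD; [exact: continuous_sqnorm|exact: cst_continuous].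
move=> h i [sh|->].
  exists (partial i h) => [|x Ux]; last exact: (is_derive_partial _ sh Ux).
  by apply: alg_base; left; exact: smooth_partial.
exists (fun x => - 1 * (x 0 i * (rad e x * (rad e x * rad e x)))) => [|x Ux].
  apply: alg_mul; first exact: alg_cst.
  apply: alg_mul; first by apply: alg_base; left; exact: smooth_coord.
  by do 2 (apply: alg_mul; first by apply: alg_base; right); apply: alg_base; right.
exact: is_derive_rad.
Qed.

Lemma partial_radX e m i x : rad_dom e x ->
  partial i (fun y => rad e y ^+ m) x = - m%:R * x 0 i * rad e x ^+ m.+2.
Proof.
move=> h; have [dr Er] := is_derive_rad i h.
have := @is_deriveX _ _ (rad e) m x (ei i) _ (is_derive_rad i h).
rewrite exprfctE => -[_]; rewrite /partial => ->.
rewrite /GRing.scale /=; case: m => [|m]; first by rewrite mulr0n; ring.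
by rewrite /= !exprS; ring.
Qed.

Lemma rad_le_norm x e : x != 0 -> 0 <= e -> rad e x <= `|x|^-1.
Proof.
move=> x0 e0; have nx : 0 < `|x| by rewrite normr_gt0.
have h : `|x| <= Num.sqrt (sqnorm x + e).
  have -> : `|x| = Num.sqrt (`|x| ^+ 2) by rewrite sqrtr_sqr normr_id.
  apply: ler_wsqrtr.
  by rewrite (le_trans (norm_le_sqnorm x))// lerDl.
by rewrite /rad lef_pV2 ?posrE// (lt_le_trans nx).
Qed.

Lemma coord_rad_le x e i : x != 0 -> 0 <= e -> `|x 0 i| * rad e x <= 1.
Proof.
move=> x0 e0; have nx : 0 < `|x| by rewrite normr_gt0.
rewrite (@le_trans _ _ (`|x| * `|x|^-1))//; last by rewrite divff// gt_eqF.
by rewrite ler_pM// ?rad_ge0 ?coord_le_norm ?rad_le_norm.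
Qed.

Lemma measurable_rad0 : measurable_fun setT (rad 0 \o @row_of R n).
Proof.
have -> : rad 0 \o @row_of R n =
    (fun t => (Num.sqrt (sqnorm (row_of t))) `^ (- 1)).
  by apply/funext => t /=; rewrite /rad addr0 powR_inv1// sqrtr_ge0.
suff m1 : measurable_fun setT ((fun x => Num.sqrt (sqnorm x)) \o @row_of R n).
  exact: (measurableT_comp (@measurable_powR R (- 1)) m1).
apply: measurable_row_continuous => x.
apply: (@continuous_comp Rn R R (@sqnorm R n) Num.sqrt x); first exact: continuous_sqnorm.
exact: sqrt_continuous.
Qed.

End radial.

Section local_integrability.
Context {R : realType} {n : nat}.
Local Notation Rn := 'rV[R]_n.
Local Notation mu := (lebesgue_tuple R n).
Hypothesis n1 : (1 < n)%N.

Lemma measurable_norm_inv (r : R) : measurable_fun setT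
   (fun t => (\1_(cube r) t * `|@row_of R n t|^-1 ^+ n.-1)%:E).
Proof.
apply/measurable_EFinP; apply: measurable_realfun.measurable_funM.
  by apply: measurable_indic; exact: measurable_cube.
apply: measurable_realfun.measurable_funX.
have -> : (fun t => `|row_of t|^-1) = (fun t => (`|@row_of R n t| `^ (- 1))).
  by apply/funext => t; rewrite powR_inv1.
suff m1 : measurable_fun setT ((fun x : Rn => `|x|) \o @row_of R n).
  exact: (measurableT_comp (@measurable_powR R (- 1)) m1).
apply: measurable_row_continuous => x; exact: norm_continuous.
Qed.

(** The shells on which |x| is comparable to r/2^k contribute a geometric series. *)
Lemma integral_norm_inv (r : R) : 0 < r ->
  (\int[mu]_t (\1_(cube r) t * `|row_of t|^-1 ^+ n.-1)%:E < +oo)%E.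
Proof.
move=> r0; pose rk m : R := r / (2 ^ m)%:R.
have p0 m : 0 < (2 ^ m)%:R :> R by rewrite ltr0n expn_gt0.
have rk0 m : 0 < rk m by rewrite divr_gt0.
pose a m := ((rk m.+1)^-1) ^+ n.-1.
have a0 m : 0 <= a m by rewrite exprn_ge0// invr_ge0 ltW.
pose f m t := (a m * \1_(@cube R n (rk m)) t)%:E.
have f0 m t : (0 <= f m t)%E by rewrite lee_fin mulr_ge0.
have mf m : measurable_fun setT (f m).
  apply/measurable_EFinP; apply: measurable_realfun.measurable_funM => //.
  by apply: measurable_indic; exact: measurable_cube.
have bound t : ((\1_(cube r) t * `|row_of t|^-1 ^+ n.-1)%:E <= \sum_(m <oo) f m t)%E.
  have s0 : (0 <= \sum_(m <oo) f m t)%E by apply: nneseries_ge0.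
  have [/set_mem /cubeP -/(_ (ltW r0)) tr|tr] := boolP (t \in cube r); last first.
    by rewrite indicE (negbTE tr) mul0r.
  have [t0|t0] := eqVneq `|row_of t| 0.
    have nE : n.-1 = n.-2.+1 by case: (n) n1 => [|[]].
    by rewrite t0 invr0 nE expr0n mulr0.
  have nt : 0 < `|row_of t| by rewrite lt_neqAle eq_sym t0 normr_ge0.
  have ex : exists m, rk m < `|row_of t|.
    exists (Num.bound (r / `|row_of t|)); rewrite /rk ltr_pdivrMr// mulrC.
    rewrite -ltr_pdivrMr// (lt_trans (archi_boundP _))//.
      by rewrite divr_ge0 ?ltW.
    by rewrite ltr_nat ltn_expl.
  have [m hm mmin] := ex_minnP ex.
  case: m hm mmin => [|m] hm mmin.
    by move: hm; rewrite /rk expn0 divr1 ltNge tr.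
  have tm : `|row_of t| <= rk m.
    by rewrite leNgt; apply/negP => /mmin; rewrite ltnn.
  apply: (@le_trans _ _ (f m t)).
    rewrite lee_fin !indicE !mem_set ?mulr1 ?mul1r; last 2 first.
    - by apply/cubeP; [exact: ltW|].
    - by apply/cubeP; [exact: ltW|].
    rewrite lerXn2r ?nnegrE ?invr_ge0 ?normr_ge0 ?(ltW (rk0 _))//.
    by rewrite lef_pV2 ?posrE// ltW.
  apply: (@le_trans _ _ (\sum_(0 <= i < m.+1) f i t)%E).
    by rewrite big_nat_recr//= leeDr// sume_ge0.
  exact: nneseries_lim_ge.
apply: (@le_lt_trans _ _ (\int[mu]_t (\sum_(m <oo) f m t))%E).
  apply: ge0_le_integral => //.
  - exact: measurable_norm_inv.
  - exact: (ge0_emeasurable_sum (P := xpredT)).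
rewrite integral_nneseries//.
apply: (@le_lt_trans _ _ (4 ^+ n * r)%:E); last exact: ltry.
have c0 : 0 <= 4 ^+ n * r by rewrite mulr_ge0 ?ltW// exprn_gt0.
apply: le_trans (epsilon_trick0 xpredT c0).
apply: lee_nneseries => [m _ _|m _]; first exact: integral_ge0.
rewrite /f; under eq_integral do rewrite EFinM.
rewrite integralZl//; last exact: integrable_cube.
rewrite integral_indic//; last exact: measurable_cube.
rewrite setIT [X in (_ * X)%E](@lebesgue_cube R n _ (ltW (rk0 m))).
rewrite -EFinM lee_fin.
have -> : 2 * rk m = 4 * rk m.+1.
  by rewrite /rk expnS natrM; field; rewrite gt_eqF.
have -> : 4 ^+ n * r / (2 ^ m.+1)%:R = 4 ^+ n * rk m.+1 by rewrite mulrA.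
rewrite exprMn mulrCA ler_wpM2l ?exprn_ge0//.
rewrite /a -{2}(prednK (ltnW n1)) exprS mulrCA exprVn mulVf ?mulr1//.
by rewrite expf_neq0// gt_eqF.
Qed.

Lemma locint_norm_inv (k : Rn -> R) (C : R) : measurable_fun setT (k \o @row_of R n) ->
  (forall x, `|k x| <= C * `|x|^-1 ^+ n.-1) -> locint k.
Proof.
move=> mk hk; split=> // r.
have C0 : 0 <= C.
  have := hk (const_mx 1); rewrite -[leRHS]mulr1 => h.
  have o0 : 0 < `|const_mx 1 : Rn|.
    rewrite normr_gt0; apply/eqP => /rowP /(_ (Ordinal (ltnW n1))).
    by rewrite !mxE => /eqP; rewrite oner_eq0.
  have : 0 <= C * `|const_mx 1 : Rn|^-1 ^+ n.-1.
    by apply: le_trans (hk _); exact: normr_ge0.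
  by rewrite pmulr_lge0// exprn_gt0// invr_gt0.
wlog r0 : r / 0 < r => [H|].
  have [/H//|r0] := ltP 0 r.
  apply: (le_integrable measurableT _ _ (H 1 ltr01)).
    apply/measurable_EFinP; apply: measurable_realfun.measurable_funM => //.
    by apply: measurable_indic; exact: measurable_cube.
  move=> t _ /=; rewrite lee_fin !normrM !indicE !normr_nat ler_wpM2r// ler_nat.
  have [/set_mem tr|//] := boolP (t \in cube r).
  rewrite mem_set// => i; rewrite (le_trans (tr i))// (le_trans r0)//.
apply/integrableP; split.
  apply/measurable_EFinP; apply: measurable_realfun.measurable_funM => //.
  by apply: measurable_indic; exact: measurable_cube.
have mI : measurable_fun setT
   (fun t => (\1_(cube r) t * `|@row_of R n t|^-1 ^+ n.-1)%:E).
  exact: measurable_norm_inv.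
apply: (@le_lt_trans _ _
   (\int[mu]_t (C%:E * (\1_(cube r) t * `|row_of t|^-1 ^+ n.-1)%:E))%E).
  apply: ge0_le_integral => //.
  - by apply: measurableT_comp => //; apply/measurable_EFinP;
      apply: measurable_realfun.measurable_funM => //;
      apply: measurable_indic; exact: measurable_cube.
  - by apply: measurable_funeM.
  - move=> t _ /=; rewrite lee_fin normrM ger0_norm// mulrCA ler_wpM2l//.
rewrite ge0_integralZl// lte_mul_pinfty//.
exact: integral_norm_inv.
Qed.

End local_integrability.

(** * The kernel of the normal operator *)

Section normal_kernel.
Context {R : realType} {n : nat}.
Local Notation Rn := 'rV[R]_n.
Local Notation mu := (lebesgue_tuple R n).
Implicit Types (x y z : Rn) (i j k l : 'I_n) (e : R) (omega : Rn -> R).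
Hypothesis n1 : (1 < n)%N.

Definition kcoef : R := 2 / (n.-1)%:R.

Definition kappa x : R := rad 0 x ^+ n.-1.

(** Up to the factor [- kcoef], the derivative along [l] of the (regularized)
    field z_j / |z|^(n-1). *)
Definition grad_kernel e l j x : R :=
  2 * x 0 l * x 0 j * rad e x ^+ n.+1 - kcoef * (l == j)%:R * rad e x ^+ n.-1.

Lemma n1_neq0 : (n.-1)%:R != 0 :> R.
Proof. by rewrite pnatr_eq0 -lt0n -subn1 subn_gt0. Qed.

Lemma n1_succ : n.-1 = n.-2.+1.
Proof. by case: (n) n1 => [|[]]. Qed.

(** Since the derivative along l of z_j / |z|^(n-1) is delta_(lj) /
    |z|^(n-1) - (n-1) z_l z_j / |z|^(n+1), the kernel is scalar up to a
    gradient. *)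
Lemma normal_kernelE l j x :
  normal_kernel l j x = grad_kernel 0 l j x + kcoef * (l == j)%:R * kappa x.
Proof. by rewrite /grad_kernel /kappa subrK rad0E /normal_kernel exprVn. Qed.

Lemma smooth_radX e m : smooth_on (rad_dom e) (fun x : Rn => rad e x ^+ m).
Proof. exact: (smoothX m (@rad_dom_open R n e) (@smooth_rad R n e)). Qed.

Lemma partial_grad_kernel e l j x : rad_dom e x ->
  partial l (fun z => - kcoef * (z 0 j * rad e z ^+ n.-1)) x = grad_kernel e l j x.
Proof.
move=> h; have Uo := @rad_dom_open R n e.
have s1 := smooth_coord j Uo; have s2 := @smooth_radX e n.-1.
rewrite (partialZ (- kcoef) (smooth_derivable (smoothM Uo s1 s2) h)).
rewrite (partialM (smooth_derivable s1 h) (smooth_derivable s2 h)).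
rewrite partial_coord (partial_radX _ _ h) /grad_kernel.
have -> : n.-1.+2 = n.+1 by rewrite (prednK (ltnW n1)).
rewrite /kcoef; have := n1_neq0; move: (n.-1)%:R (rad e x ^+ n.+1) => m A m0.
by field.
Qed.

Lemma smooth_grad_kernel e l j : 0 < e -> smooth_on setT (grad_kernel e l j).
Proof.
move=> e0; have sr m : smooth_on setT (fun x : Rn => rad e x ^+ m).
  by rewrite -(rad_domT (n := n) e0); exact: smooth_radX.
apply: (smoothB openT); last exact: (smoothZ _ openT (sr _)).
apply: (smoothM openT _ (sr _)).
apply: (smoothM openT _ (smooth_coord j openT)).
exact: (smoothZ 2 openT (smooth_coord l openT)).
Qed.

(** A function of the form (d_l G d_k omega - d_k G d_l omega) is the
    divergence of a compactly supported field. *)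
Lemma integral_grad_kernel e k l j omega : 0 < e -> test_on setT omega ->
  integral_Rn (fun z => grad_kernel e l j z * partial k omega z -
                        grad_kernel e k j z * partial l omega z) = 0.
Proof.
move=> e0 tw; pose G (z : Rn) := - kcoef * (z 0 j * rad e z ^+ n.-1).
have sG : smooth_on setT G.
  apply: (smoothZ _ openT); apply: (smoothM openT (smooth_coord j openT)).
  by rewrite -(rad_domT (n := n) e0); exact: smooth_radX.
have dom z : rad_dom e z by rewrite rad_domT.
have tGk := testMr sG (test_partial k tw).
have tGl := testMr sG (test_partial l tw).
have dG i z : partial l (fun y => G y * partial i omega y) z =
    partial l G z * partial i omega z + G z * partial l (partial i omega) z.
  by apply: (partialM (smooth_derivable sG I)); exact: (test_derivable (test_partial i tw)).
have dG' i z : partial k (fun y => G y * partial i omega y) z =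
    partial k G z * partial i omega z + G z * partial k (partial i omega) z.
  by apply: (partialM (smooth_derivable sG I)); exact: (test_derivable (test_partial i tw)).
have -> : (fun z => grad_kernel e l j z * partial k omega z -
                    grad_kernel e k j z * partial l omega z) =
   (fun z => partial l (fun y => G y * partial k omega y) z +
             -1 * partial k (fun y => G y * partial l omega y) z).
  apply/funext => z; rewrite dG dG' -(partial_grad_kernel l j (dom z)) -(partial_grad_kernel k j (dom z)).
  rewrite (partialC l k openT (test_smooth tw) (I : setT z)).
  move: (partial l G z) (partial k G z) (partial k omega z) (partial l omega z).
  by move: (G z) (partial k (partial l omega) z) => A B C D E F; ring.
rewrite integral_RnE RintegralD//.
- rewrite -[X in X + _]integral_RnE (integral_Rn_partial l tGk) add0r.
  rewrite RintegralZl//; last exact: (intRn_test (test_partial k tGl)).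
  by rewrite -integral_RnE (integral_Rn_partial k tGl) mulr0.
- exact: (intRn_test (test_partial l tGk)).
- exact: (intRn_test (testZ (-1) (test_partial k tGl))).
Qed.

Lemma kcoef_ge0 : 0 <= kcoef.
Proof. by rewrite divr_ge0. Qed.

Lemma grad_kernel_le e l j x : x != 0 -> 0 <= e ->
  `|grad_kernel e l j x| <= (2 + kcoef) * `|x|^-1 ^+ n.-1.
Proof.
move=> x0 e0; have r0 := rad_ge0 e x.
have rX : rad e x ^+ n.-1 <= `|x|^-1 ^+ n.-1.
  by rewrite lerXn2r ?nnegrE ?invr_ge0// rad_le_norm.
rewrite /grad_kernel [leRHS]mulrDl; apply: le_trans (ler_normB _ _) _.
apply: lerD; last first.
  rewrite normrM (normrM kcoef) normr_nat (ger0_norm kcoef_ge0) normrX (ger0_norm r0).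
  rewrite -mulrA ler_wpM2l ?kcoef_ge0//.
  by case: eqP => _; rewrite ?mul1r// mul0r exprn_ge0// invr_ge0.
have -> : 2 * x 0 l * x 0 j * rad e x ^+ n.+1 =
    2 * ((x 0 l * rad e x) * (x 0 j * rad e x) * rad e x ^+ n.-1).
  have -> : n.+1 = n.-1.+2 by rewrite (prednK (ltnW n1)).
  by rewrite !exprS; ring.
rewrite normrM ger0_norm// ler_wpM2l// normrM [`|rad e x ^+ _|]ger0_norm ?exprn_ge0//.
apply: le_trans rX; rewrite -[leRHS]mul1r ler_wpM2r ?exprn_ge0//.
rewrite normrM !(normrM _ (rad e x)) (ger0_norm r0) -[leRHS]mulr1.
by rewrite ler_pM// ?mulr_ge0// coord_rad_le.
Qed.

Lemma grad_kernel0_le l j x :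
  `|grad_kernel 0 l j x| <= (2 + kcoef) * `|x|^-1 ^+ n.-1.
Proof.
have [->|x0] := eqVneq x 0; last exact: grad_kernel_le.
by rewrite /grad_kernel rad_eq0 n1_succ !expr0n !mulr0 subr0 normr0 normr0 invr0 expr0n mulr0.
Qed.

Lemma measurable_grad_kernel e l j : measurable_fun setT (rad e \o @row_of R n) ->
  measurable_fun setT (grad_kernel e l j \o @row_of R n).
Proof.
move=> mr; apply: measurable_realfun.measurable_funB;
  apply: measurable_realfun.measurable_funM;
  rewrite ?(_ : (fun t => _ ^+ _) = _)//; try exact: measurable_realfun.measurable_funX.
by apply: measurable_realfun.measurable_funM; [apply: measurable_realfun.measurable_funM => //|];
 exact: measurable_row_of.
Qed.

Lemma locint_grad_kernel l j : locint (grad_kernel 0 l j).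
Proof.
apply: (locint_norm_inv n1 (C := 2 + kcoef)); last exact: grad_kernel0_le.
exact: (measurable_grad_kernel l j measurable_rad0).
Qed.

Lemma kappa_le x : `|kappa x| <= 1 * `|x|^-1 ^+ n.-1.
Proof.
rewrite mul1r normrX (ger0_norm (rad_ge0 _ _)).
have [->|x0] := eqVneq x 0; first by rewrite rad_eq0 normr0 invr0.
by rewrite lerXn2r ?nnegrE ?invr_ge0 ?rad_ge0// rad_le_norm.
Qed.

Lemma locint_kappa : locint kappa.
Proof.
apply: (locint_norm_inv n1 (C := 1)); last exact: kappa_le.
exact: (measurable_realfun.measurable_funX n.-1 measurable_rad0).
Qed.

Lemma ae_row_neq0 (P : n.-tuple (measurableTypeR R) -> Prop) :
  (forall t, row_of t != 0 -> P t) -> {ae mu, forall t, P t}.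
Proof.
move=> h; exists (cube 0); split; first exact: measurable_cube.
  by apply: etrans (@lebesgue_cube R n 0 (lexx 0)) _; rewrite mulr0 expr0n gtn_eqF// ltnW.
move=> t /= nP; apply/cubeP => //; rewrite normr_le0.
by apply/negPn/negP => /h.
Qed.

Lemma cvg_rad x : x != 0 -> (rad m.+1%:R^-1 x @[m --> \oo]) --> rad 0 x.
Proof.
move=> x0; have q0 : 0 < sqnorm x + 0 by rewrite addr0 sqnorm_gt0.
apply: cvgV; first by rewrite gt_eqF// sqrtr_gt0.
apply: (cvg_comp (fun m => sqnorm x + m.+1%:R^-1) Num.sqrt); last exact: sqrt_continuous.
by apply: cvgD; [exact: cvg_cst|exact: cvg_harmonic].
Qed.

Lemma cvg_grad_kernel l j x : x != 0 ->
  (grad_kernel m.+1%:R^-1 l j x @[m --> \oo]) --> grad_kernel 0 l j x.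
Proof.
move=> x0; have cr := cvg_rad x0.
have cX p : rad m.+1%:R^-1 x ^+ p @[m --> \oo] --> rad 0 x ^+ p.
  exact: (cvg_comp _ (fun t : R => t ^+ p) cr (@exprn_continuous _ _ _)).
by apply: cvgB; apply: cvgMr.
Qed.

(** At 0 the field is too singular for the divergence theorem; the identity
    is the limit of its regularizations, by dominated convergence. *)
Lemma integral_grad_kernel0 k l j omega : test_on setT omega ->
  integral_Rn (fun z => grad_kernel 0 l j z * partial k omega z -
                        grad_kernel 0 k j z * partial l omega z) = 0.
Proof.
move=> tw.
pose F e z := grad_kernel e l j z * partial k omega z -
  grad_kernel e k j z * partial l omega z.
pose em m : R := m.+1%:R^-1.
have em0 m : 0 < em m by rewrite invr_gt0.
have mpart i : measurable_fun setT (partial i omega \o @row_of R n).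
  apply: measurable_row_continuous => x.
  exact: (smooth_continuous (test_smooth (test_partial i tw)) I).
have mF e : measurable_fun setT (rad e \o @row_of R n) ->
    measurable_fun setT (EFin \o (F e \o @row_of R n)).
  move=> mr; apply/measurable_EFinP.
  by apply: measurable_realfun.measurable_funB; apply: measurable_realfun.measurable_funM;
    [exact: (measurable_grad_kernel _ _ mr)|exact: mpart
    |exact: (measurable_grad_kernel _ _ mr)|exact: mpart].
have mrad m : measurable_fun setT (rad (em m) \o @row_of R n).
  apply: measurable_row_continuous => x; apply: (smooth_continuous (@smooth_rad R n (em m))).
  by rewrite rad_domT.
have [r r0 hr] := test_far tw.
have hr' i x : r < `|x| -> partial i omega x = 0.
  move=> rx; rewrite -(partial_cst i 0 x).
  apply: (@partial_eq_on _ _ [set y | r < `|y - 0|] i omega (fun=> 0)).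
  - exact: open_norm_gt.
  - by move=> y /=; rewrite subr0 => /hr.
  - by rewrite /= subr0.
have [Bk hBk] := test_bounded (test_partial k tw).
have [Bl hBl] := test_bounded (test_partial l tw).
pose dom (t : n.-tuple (measurableTypeR R)) : \bar R :=
  ((2 + kcoef) * (Bk + Bl) * (\1_(cube r) t * `|row_of t|^-1 ^+ n.-1))%:E.
have idom : mu.-integrable setT dom.
  have i1 : mu.-integrable setT (fun t => (\1_(cube r) t * `|@row_of R n t|^-1 ^+ n.-1)%:E).
    apply/integrableP; split; first exact: measurable_norm_inv.
    apply: le_lt_trans (integral_norm_inv n1 r0).
    apply: ge0_le_integral => //.
    - by apply: measurableT_comp => //; exact: measurable_norm_inv.
    - exact: measurable_norm_inv.
    - by move=> t _ /=; rewrite ger0_norm// mulr_ge0// exprn_ge0// invr_ge0.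
  have := integrableZl measurableT ((2 + kcoef) * (Bk + Bl)) i1.
  by congr (_.-integrable _ _).
have aecvg : {ae mu, forall t, setT t ->
    (fun m => (F (em m) (row_of t))%:E) @ \oo --> (F 0 (row_of t))%:E}.
  apply: ae_row_neq0 => t t0 _; apply: cvg_EFin; first exact: nearW.
  by apply: cvgB; apply: cvgMl; exact: cvg_grad_kernel.
have aedom : {ae mu, forall t m, setT t -> (`|(F (em m) (row_of t))%:E| <= dom t)%E}.
  apply: ae_row_neq0 => t t0 m _; rewrite lee_fin.
  have [tr|tr] := leP `|row_of t| r; last first.
    rewrite /F !hr'// !mulr0 subr0 normr0.
    rewrite !mulr_ge0 ?addr_ge0 ?kcoef_ge0 ?exprn_ge0 ?invr_ge0//.
    + exact: le_trans (hBk 0).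
    + exact: le_trans (hBl 0).
  rewrite indicE mem_set ?mul1r; last by apply/cubeP; [exact: ltW|].
  apply: le_trans (ler_normB _ _) _; rewrite !normrM mulrDr mulrDl mulrAC.
  rewrite [_ * Bl * _]mulrAC.
  by apply: lerD; apply: ler_pM => //; apply: grad_kernel_le => //; exact: ltW.
have [_ _ C] := dominated_convergence measurableT (fun m => mF _ (mrad m))
  (mF 0 measurable_rad0) aecvg idom aedom.
have E m : (\int[mu]_t (F (em m) (row_of t))%:E = 0)%E.
  have tF : test_on setT (F (em m)).
    by apply: testB; apply: testMr; [exact: smooth_grad_kernel|exact: test_partial
      |exact: smooth_grad_kernel|exact: test_partial].
  rewrite -[LHS]fineK; last exact: (integrable_fin_num measurableT (intRn_test tF)).
  by congr (_%:E); exact: (integral_grad_kernel k l j (em0 m) tw).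
rewrite integral_RnE /Rintegral.
have C0 : (fun=> 0%E) @ \oo --> (\int[mu]_t (F 0 (row_of t))%:E)%E.
  by apply: cvg_trans C; apply: near_eq_cvg; apply: nearW => m; rewrite /= E.
by rewrite -(cvg_unique _ (cvg_cst 0%E) C0).
Qed.

End normal_kernel.

(** * The exterior derivative of the normal operator *)

Section normal_operator.
Context {R : realType} {n : nat}.
Local Notation Rn := 'rV[R]_n.
Local Notation mu := (lebesgue_tuple R n).
Implicit Types (x y z : Rn) (i j k l : 'I_n) (omega phi chi : Rn -> R) (K : set Rn).
Hypothesis n1 : (1 < n)%N.

Lemma locintD (k1 k2 : Rn -> R) (a : R) : locint k1 -> locint k2 ->
  locint (fun x => k1 x + a * k2 x).
Proof.
move=> [m1 i1] [m2 i2]; split=> [|r].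
  apply: measurable_realfun.measurable_funD => //.
  by apply: measurable_realfun.measurable_funM.
have := integrableD measurableT (i1 r) (integrableZl measurableT a (i2 r)).
congr (_.-integrable _ _); apply/funext => t /=.
by rewrite -EFinM -EFinD; congr (_%:E); ring.
Qed.

Lemma ConvD (k1 k2 : Rn -> R) (a : R) phi y : locint k1 -> locint k2 ->
  test_on setT phi ->
  Conv (fun x => k1 x + a * k2 x) phi y = Conv k1 phi y + a * Conv k2 phi y.
Proof.
move=> l1 l2 tp; have i1 := intRn_Conv y l1 tp; have i2 := intRn_Conv y l2 tp.
rewrite /Conv !integral_RnE -[in RHS]RintegralZl// -RintegralD//.
  by apply: eq_Rintegral => t _; ring.
have := integrableZl measurableT a i2.
by congr (_.-integrable _ _); apply/funext => t /=; rewrite -EFinM.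
Qed.

Lemma normal_kernel_lin l j :
  normal_kernel l j = (fun x => grad_kernel 0 l j x + kcoef (n := n) * (l == j)%:R * kappa x) :> (Rn -> R).
Proof. by apply/funext => x; exact: normal_kernelE. Qed.

Lemma locint_normal_kernel l j : locint (normal_kernel l j : Rn -> R).
Proof.
rewrite normal_kernel_lin; apply: locintD; first exact: locint_grad_kernel.
exact: locint_kappa.
Qed.

(** The gradient part of the kernel contributes nothing to the curl, by
    [integral_grad_kernel0]. *)
Lemma Conv_normal_kernel k l j omega y : test_on setT omega ->
  Conv (normal_kernel l j) (partial k omega) y -
  Conv (normal_kernel k j) (partial l omega) y =
  kcoef (R := R) (n := n) * ((l == j)%:R * Conv kappa (partial k omega) y -
                   (k == j)%:R * Conv kappa (partial l omega) y).
Proof.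
move=> tw; have tk := test_partial k tw; have tl := test_partial l tw.
have lg i : locint (grad_kernel 0 i j : Rn -> R) by exact: locint_grad_kernel.
have lk := @locint_kappa R n n1.
rewrite !normal_kernel_lin (ConvD _ _ (lg l) lk tk) (ConvD _ _ (lg k) lk tl).
suff : Conv (grad_kernel 0 l j) (partial k omega) y -
       Conv (grad_kernel 0 k j) (partial l omega) y = 0.
  move/eqP; rewrite subr_eq0 => /eqP ->.
  by move: (Conv _ _ _) (Conv _ _ _) (Conv _ _ _) => A B C; ring.
rewrite /Conv !integral_RnE -RintegralB//; first last.
- exact: intRn_Conv (lg k) tl.
- exact: intRn_Conv (lg l) tk.
apply: etrans (integral_grad_kernel0 n1 k l j (test_shift y tw)).
rewrite integral_RnE; apply: eq_Rintegral => t _.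
by rewrite !partial_shift.
Qed.

Lemma convolutionE (g : Rn -> R) u K chi phi : Defs.distribution u -> compact K ->
  vanishes_on (~` K) u -> cutoff K chi -> locint g -> test_on setT phi ->
  convolution g u phi = u (fun x => chi x * Conv g phi x).
Proof.
move=> du cK vK cc lg tp; rewrite /convolution.
have -> : (fun y => integral_Rn (fun x => g (x - y) * phi x)) = Conv g phi.
  by apply/funext => y; exact: Conv_sub.
exact: (pairingE du cK vK cc (Conv_smooth lg tp)).
Qed.

(** A scalar convolution commutes with the exterior derivative, and by
    [Conv_normal_kernel] the kernel of the normal operator acts here as a
    scalar one. *)
Lemma normal_op1_curl (f : 'I_n -> functional R n) K chi k l omega :
  (forall i, Defs.distribution (f i)) -> compact K ->
  (forall i, vanishes_on (~` K) (f i)) -> cutoff K chi -> test_on setT omega ->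
  normal_op1 f l (partial k omega) - normal_op1 f k (partial l omega) =
  - kcoef (n := n) * ext_diff1 f k l (fun x => chi x * Conv kappa omega x).
Proof.
move=> df cK vK cc tw; have lk := @locint_kappa R n n1.
have tk := test_partial k tw; have tl := test_partial l tw.
pose A i x := chi x * Conv kappa (partial i omega) x.
have tA i : test_on setT (A i).
  by apply: (cutoffM cc); exact: (Conv_smooth lk (test_partial i tw)).
rewrite /normal_op1.
have cE i j phi : test_on setT phi -> convolution (normal_kernel i j) (f j) phi =
    f j (fun x => chi x * Conv (normal_kernel i j) phi x).
  by move=> tp; exact: (convolutionE (df j) cK (vK j) cc (locint_normal_kernel i j) tp).
have tC i j phi : test_on setT phi ->
    test_on setT (fun x => chi x * Conv (normal_kernel i j) phi x).
  by move=> tp; apply: (cutoffM cc); exact: (Conv_smooth (locint_normal_kernel i j) tp).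
have step j : convolution (normal_kernel l j) (f j) (partial k omega) -
    convolution (normal_kernel k j) (f j) (partial l omega) =
    kcoef (n := n) * ((l == j)%:R * f j (A k) - (k == j)%:R * f j (A l)).
  rewrite !cE// -(distB (df j) (tC _ _ _ tk) (tC _ _ _ tl)).
  have tZ i a : test_on setT (fun x => a * A i x) by exact: testZ.
  rewrite -(distZ _ (df j) (tA k)) -(distZ _ (df j) (tA l)).
  rewrite -(distB (df j) (tZ _ _) (tZ _ _)).
  rewrite -(distZ _ (df j) (testB (tZ _ _) (tZ _ _))).
  congr (f j); apply/funext => x; rewrite -mulrBr Conv_normal_kernel// /A.
  by move: (Conv _ _ _) (Conv _ _ _) => B C; ring.
rewrite -sumrB (eq_bigr _ (fun j _ => step j)) -mulr_sumr sumrB.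
have pick i (F : 'I_n -> R) : \sum_j (i == j)%:R * F j = F i.
  rewrite (bigD1 i)//= eqxx mul1r big1 ?addr0// => j ji.
  by rewrite eq_sym (negbTE ji) mul0r.
rewrite mulNr -mulrN /ext_diff1 /dist_partial opprB opprK; congr (_ * _).
have sc := cutoff_smooth cc; have sH := Conv_smooth lk tw.
have main i j : f j (partial i (fun x => chi x * Conv kappa omega x)) = f j (A i).
  have tcp : test_on setT (fun x => partial i chi x * Conv kappa omega x).
    have [tc _] := cc; have := testMr sH (test_partial i tc).
    by congr test_on; apply/funext => x; rewrite mulrC.
  have -> : partial i (fun x => chi x * Conv kappa omega x) =
      (fun x => partial i chi x * Conv kappa omega x + A i x).
    apply/funext => x.
    rewrite (partialM (smooth_derivable sc I) (smooth_derivable sH I)).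
    by rewrite (Conv_partial i lk tw).
  rewrite (distD (df j) tcp (tA i)).
  have [_ [W [Wo KW W1]]] := cc.
  rewrite (dist_zero_near (vK j) Wo KW tcp) ?add0r// => x Wx.
  by rewrite (partial_eq_on i Wo W1 Wx) partial_cst mul0r.
rewrite (main k l) (main l k) [RHS]addrC; congr (_ - _).
  exact: (pick l (fun j => f j (A k))).
exact: (pick k (fun j => f j (A l))).
Qed.

Lemma compact_norm_le (r : R) : compact [set x : Rn | `|x| <= r].
Proof.
apply: bounded_closed_compact; last exact: closed_norm_le.
exists r; split; first exact: num_real.
by move=> M rM x /= xr; rewrite (le_trans xr)// ltW.
Qed.

Lemma common_support (f : 'I_n -> functional R n) :
  (forall i, compact_distribution (f i)) -> exists2 r : R, 0 < r &
    forall i, vanishes_on (~` [set x | `|x| <= r]) (f i).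
Proof.
move=> hf; have h i : exists r : R, 0 < r /\ vanishes_on (~` [set x | `|x| <= r]) (f i).
  have [_ [K /compact_le_norm[r r0 Kr] vK]] := hf i.
  exists r; split=> //; apply: vanishes_onW vK; apply: subsetC.
  exact: Kr.
have [r hr] := choice h.
exists (1 + \sum_i r i).
  by rewrite ltr_pwDl// sumr_ge0// => i _; rewrite ltW// (hr i).1.
move=> i; apply: vanishes_onW (hr i).2; apply: subsetC => x /= xi.
rewrite (le_trans xi)// (bigD1 i)//= addrCA lerDl addr_ge0// sumr_ge0// => j _.
by rewrite ltW// (hr j).1.
Qed.

Lemma ball_cutoff (r : R) : 0 < r -> exists chi, cutoff [set x : Rn | `|x| <= r] chi.
Proof.
move=> r0; have r1 : 0 < r + 1 by rewrite addr_gt0.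
have [chi [r' [sc rr c1 c0]]] := @large_cutoff R n _ r1.
exists chi; split.
  apply: (@testI _ _ _ setT _ r' sc closedT) => // [x /(_ I)//|x /ltW]; exact: c0.
exists [set x | `|x - 0| < r + 1]; split; first exact: open_norm_lt.
  by move=> x /= xr; rewrite subr0 (le_lt_trans xr)// ltrDl.
by move=> x /=; rewrite subr0 => /ltW; exact: c1.
Qed.

End normal_operator.

(** * Mollification and integration by parts *)

Section mollification.
Context {R : realType} {n : nat}.
Local Notation Rn := 'rV[R]_n.
Local Notation mu := (lebesgue_tuple R n).
Implicit Types (x y z : Rn) (i : 'I_n) (s : seq 'I_n) (omega psi phi g : Rn -> R)
  (U : set Rn).

Lemma integral_RnZ (c : R) phi : test_on setT phi ->
  integral_Rn (fun x => c * phi x) = c * integral_Rn phi.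
Proof.
move=> tp; rewrite !integral_RnE RintegralZl//.
exact: intRn_test.
Qed.

Lemma integral_Rn_test_shift phi y : test_on setT phi ->
  integral_Rn (fun x => phi (x + y)) = integral_Rn phi.
Proof.
move=> tp; apply: integral_Rn_shift; last exact: (intRn_test (test_shift y tp)).
by apply: measurable_row_continuous => x; exact: (smooth_continuous (test_smooth tp) I).
Qed.

Lemma mollifier x0 (e : R) : 0 < e -> exists omega, [/\ test_on setT omega,
  forall x, 0 <= omega x, forall x, e <= `|x - x0| -> omega x = 0 &
  integral_Rn omega = 1].
Proof.
move=> e0; have [chi [d [sc [d0 de] c01 c1 c0]]] := @small_cutoff R n x0 e e0.
have tc : test_on setT chi.
  apply: (@testI _ _ _ setT _ (e + `|x0|) sc closedT) => // [x /(_ I)//|x xe].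
  by apply: c0; apply: le_trans (lerB_dist x x0); rewrite lerBrDr ltW.
have pos : 0 < integral_Rn chi.
  rewrite -(integral_Rn_test_shift x0 tc).
  apply: (@lt_le_trans _ _ ((2 * d) ^+ n)); first by rewrite exprn_gt0// mulr_gt0.
  rewrite -(integral_cube (n := n) (ltW d0)) integral_RnE; apply: le_Rintegral => //.
  - exact: integrable_cube.
  - exact: (intRn_test (test_shift x0 tc)).
  - move=> t _; rewrite indicE; have [/set_mem/cubeP -/(_ (ltW d0)) td|_] := boolP (t \in cube d).
      by rewrite c1// addrK.
    by have /andP[] := c01 (row_of t + x0).
exists (fun x => (integral_Rn chi)^-1 * chi x); split.
- exact: testZ.
- by move=> x; have /andP[h _] := c01 x; rewrite mulr_ge0// invr_ge0 ltW.
- by move=> x xe; rewrite c0// mulr0.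
- by rewrite integral_RnZ// mulVf// gt_eqF.
Qed.

Lemma integral_Rn_by_parts U g omega i : open U -> smooth_on U g -> test_on U omega ->
  integral_Rn (fun x => g x * partial i omega x) =
  - integral_Rn (fun x => partial i g x * omega x).
Proof.
move=> Uo sg tw.
have t1 := testT (testM Uo sg tw).
have t2 := testT (testM Uo sg (test_partial i tw)).
have t3 := testT (testM Uo (smooth_partial i sg) tw).
have := integral_Rn_partial i t1.
have -> : partial i (fun x => g x * omega x) =
    (fun x => partial i g x * omega x + g x * partial i omega x).
  apply/funext => x; have [Ux|Ux] := pselect (U x).
    exact: (partialM (smooth_derivable sg Ux) (test_derivable tw)).
  rewrite (test_zero (test_partial i (testM Uo sg tw)) Ux) (test_zero tw Ux).
  by rewrite (test_zero (test_partial i tw) Ux) !mulr0 addr0.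
rewrite integral_RnE RintegralD//; first last.
- exact: (intRn_test t2).
- exact: (intRn_test t3).
by move=> /eqP; rewrite addrC addr_eq0 => /eqP.
Qed.

Lemma integral_Rn_by_parts_seq U g omega s : open U -> smooth_on U g ->
  test_on U omega ->
  integral_Rn (fun x => g x * partials s omega x) =
  (- 1) ^+ size s * integral_Rn (fun x => partials (rev s) g x * omega x).
Proof.
move=> Uo + tw; elim: s g => [|i s IH] g sg; first by rewrite mul1r.
have := integral_Rn_by_parts i Uo sg (test_partials s tw).
rewrite (IH _ (smooth_partial i sg)) rev_cons => ->.
rewrite exprS mulN1r mulNr; congr (- (_ * integral_Rn _)).
by apply/funext => x; rewrite partials_rcons.
Qed.

Lemma integral_Rn_le omega g (e c : R) x0 : test_on setT omega ->
  test_on setT (fun x => g x * omega x) ->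
  (forall x, 0 <= omega x) -> (forall x, e <= `|x - x0| -> omega x = 0) ->
  integral_Rn omega = 1 -> (forall x, `|x - x0| < e -> `|g x| <= c) ->
  `|integral_Rn (fun x => g x * omega x)| <= c.
Proof.
move=> tw tg w0 we w1 gc; rewrite integral_RnE.
rewrite (le_trans (le_normr_Rintegral measurableT (intRn_test tg)))//.
rewrite -[leRHS]mulr1 -[X in _ <= _ * X]w1 -(integral_RnZ c tw) integral_RnE.
apply: le_Rintegral => //; first exact: (integrable_norm (intRn_test tg)).
  exact: (intRn_test (testZ c tw)).
move=> t _; rewrite normrM (ger0_norm (w0 _)).
have [te|te] := ltP `|row_of t - x0| e; first by rewrite ler_wpM2r// gc.
by rewrite we// !mulr0.
Qed.

Lemma measurable_oppr_row i : measurable_fun setT (fun t => (- @row_of R n t) 0 i).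
Proof.
have -> : (fun t => (- @row_of R n t) 0 i) = (fun t => - (row_of t 0 i)).
  by apply/funext => t; rewrite mxE.
exact: measurableT_comp (measurable_row_of i).
Qed.

(** Convolution with [omega], as an average over [omega] of translates of [psi]. *)
Definition smear omega psi : Rn -> R :=
  par mu (omega \o row_of) (fun t => - row_of t) psi.

Lemma smear_partials omega psi s : test_on setT omega -> bsmooth psi ->
  partials s (smear omega psi) = smear omega (partials s psi).
Proof.
move=> tw bp; apply: par_partials => //; first exact: (intRn_test tw).
exact: measurable_oppr_row.
Qed.

Lemma smear_smooth omega psi : test_on setT omega -> bsmooth psi ->
  smooth_on setT (smear omega psi).
Proof.
move=> tw bp; apply: par_smooth => //; first exact: (intRn_test tw).
exact: measurable_oppr_row.
Qed.

(** [smear omega psi] averages the values of [psi] at points at distance at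
    most [e] from [y - x0]. *)
Lemma smear_close omega psi (e B : R) x0 y : test_on setT omega -> bsmooth psi ->
  (forall x, 0 <= omega x) -> (forall x, e <= `|x - x0| -> omega x = 0) ->
  integral_Rn omega = 1 -> bnd 1 psi B -> 0 < e ->
  `|smear omega psi y - psi (y - x0)| <= n%:R * B * e.
Proof.
move=> tw bp w0 we w1 hB e0; have B0 := bnd_ge0 hB.
have iw := intRn_test tw.
have i1 := integrable_par iw measurable_oppr_row y bp.
have i2 := integrableZl measurableT (psi (y - x0)) iw.
have i2' : mu.-integrable setT (EFin \o (fun t => psi (y - x0) * omega (row_of t))).
  by move: i2; congr (_.-integrable _ _).
have -> : psi (y - x0) = (\int[mu]_t (psi (y - x0) * omega (row_of t)))%R.
  by rewrite RintegralZl// -[X in _ * X]integral_RnE w1 mulr1.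
rewrite /smear /par -RintegralB//.
have ib := integrableB measurableT i1 i2'.
rewrite (le_trans (le_normr_Rintegral measurableT ib))//.
rewrite -[leRHS]mulr1 -[X in _ <= _ * X]w1 integral_RnE -RintegralZl//.
apply: le_Rintegral => //; first exact: (integrable_norm ib).
  by have := integrableZl measurableT (n%:R * B * e) iw; congr (_.-integrable _ _).
move=> t _ /=; rewrite mulrC -mulrBl normrM (ger0_norm (w0 _)).
have [te|te] := ltP `|row_of t - x0| e; last by rewrite we// !mulr0.
rewrite ler_wpM2r// (le_trans (bnd_lipschitz _ _ bp.1 hB))//.
rewrite ler_wpM2l ?mulr_ge0// opprB [y - _ + _]addrC addrA subrK distrC.
exact: ltW.
Qed.

End mollification.

(** * From vanishing to infinite order to orthogonality relations *)

Section annihilation.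
Context {R : realType} {n : nat}.
Local Notation Rn := 'rV[R]_n.
Local Notation mu := (lebesgue_tuple R n).
Implicit Types (x y z : Rn) (i : 'I_n) (s : seq 'I_n) (omega psi phi g chi : Rn -> R)
  (U : set Rn).
Hypothesis n1 : (1 < n)%N.

Lemma radN e x : rad e (- x) = rad e x.
Proof.
rewrite /rad; congr (Num.sqrt (_ + _))^-1; apply: eq_bigr => i _.
by rewrite mxE sqrrN.
Qed.

Lemma kappa_sub x y : kappa (x - y) = kappa (y - x) :> R.
Proof. by rewrite /kappa -radN opprB. Qed.

Lemma smooth_kappa : smooth_on (rad_dom 0) (@kappa R n).
Proof. exact: smooth_radX. Qed.

Lemma rad_dom0P x : rad_dom 0 x <-> x != 0.
Proof.
split; last exact: rad_dom_neq0.
rewrite /rad_dom /= addr0 => h; apply/eqP => x0; move: h; rewrite x0 /sqnorm.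
by rewrite big1 ?ltxx// => i _; rewrite mxE expr0n.
Qed.

(** Two cutoffs, one around the singularity and one near infinity. *)
Lemma test_annulus g (a b : R) : 0 < a -> 0 < b -> smooth_on (rad_dom 0) g ->
  exists2 psi, test_on setT psi & forall z, a <= `|z| -> `|z| <= b -> psi z = g z.
Proof.
move=> a0 b0 sg.
have [eta [d [se [d0 da] _ e1 e0]]] := @small_cutoff R n 0 a a0.
have [chi [b' [sc bb c1 c0]]] := @large_cutoff R n b b0.
pose q z := (1 - eta z) * g z.
have se' : smooth_on setT (fun z => 1 - eta z).
  apply: (smoothB openT _ se); exact: (smooth_cst _ openT).
have Do := @rad_dom_open R n 0.
have sq : smooth_on setT q.
  have -> : setT = rad_dom 0 `|` [set z : Rn | `|z - 0| < d].
    apply/seteqP; split=> // z _; have [->|z0] := eqVneq z 0.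
      by right; rewrite /= subrr normr0.
    by left; exact/rad_dom0P.
  apply: smooth_onU; first exact: (smoothM Do (smooth_onW _ se') sg).
  apply: (@smooth_eq_on _ _ _ (fun=> 0)).
  - exact: open_norm_lt.
  - by move=> z /ltW zd; rewrite /q e1// subrr mul0r.
  - apply: smooth_cst; exact: open_norm_lt.
exists (fun z => chi z * q z).
  apply: (@testI _ _ _ setT _ b' (smoothM openT sc sq) closedT) => // [z /(_ I)//|z /ltW bz].
  by rewrite c0// mul0r.
by move=> z az zb; rewrite c1// /q e0 ?subr0// !mul1r.
Qed.

Lemma testM_fsupp U g phi : smooth_on setT g -> test_on U phi ->
  test_on (fsupp phi) (fun x => phi x * g x).
Proof.
move=> sg [sp cp pU]; have tp : test_on (fsupp phi) phi by split.
have := testMr sg tp; congr test_on; apply/funext => x; exact: mulrC.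
Qed.

Lemma test_on_ball phi x0 (t e : R) : test_on setT phi ->
  (forall x, t <= `|x - x0| -> phi x = 0) -> t < e ->
  test_on [set x | `|x - x0| < e] phi.
Proof.
move=> tp ht te; apply: (@closed_zero_test _ _ _ [set x | `|x - x0| <= t] _ _ _ tp).
- have -> : [set x : Rn | `|x - x0| <= t] = ~` [set x | t < `|x - x0|].
    apply/seteqP; split=> y /=; first by move=> yr; apply/negP; rewrite -leNgt.
    by move/negP; rewrite -leNgt.
  exact/open_closedC/open_norm_gt.
- by move=> x /= /le_lt_trans; apply.
- by move=> x /= /negP; rewrite -ltNge => /ltW /ht.
Qed.

(** Formally, [kappa] convolved with [h] is near [x0] the smooth function
    [G], and its derivatives at [x0] are, up to sign, the pairings of [h]
    with the derivatives of the translate of [kappa] to [x0]. The latter are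
    smooth on the support of [h], which does not contain [x0], and [Theta]
    removes the singularity without changing [h]. The identification with
    [G] is known against test functions only, so that evaluation at [x0] is
    replaced by a mollifier concentrating there. *)
Lemma annihilates_derivatives h (r e : R) x0 chi (G : Rn -> R) :
  Defs.distribution h -> 0 < e ->
  vanishes_on (~` [set x | `|x| <= r]) h ->
  vanishes_on [set x | `|x - x0| < e] h ->
  cutoff [set x | `|x| <= r] chi ->
  smooth_on [set x | `|x - x0| < e] G ->
  (forall s, partials s G x0 = 0) ->
  (forall omega, test_on [set x | `|x - x0| < e] omega ->
     h (fun x => chi x * Conv kappa omega x) = integral_Rn (fun x => G x * omega x)) ->
  exists Theta d, [/\ test_on setT Theta, 0 < d,
    forall x, `|x - x0| <= d -> Theta x = 0,
    forall phi, test_on setT phi -> h phi = h (fun x => Theta x * phi x) &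
    forall s, h (fun x => Theta x * partials s kappa (x - x0)) = 0].
Proof.
move=> dh e0 vK vV cc sG G0 hG.
have e2 : 0 < e / 2 by rewrite divr_gt0.
have e2e : e / 2 < e by rewrite ltr_pdivrMr// ltr_pMr// ltr1n.
have [eta [d [se [d0 de] _ eta1 eta0]]] := @small_cutoff R n x0 (e / 2) e2.
have [tc [W [Wo KW W1]]] := cc; have sc := cutoff_smooth cc.
have se' : smooth_on setT (fun z => 1 - eta z).
  apply: (smoothB openT _ se); exact: (smooth_cst _ openT).
pose Theta x := (1 - eta x) * chi x.
have tT : test_on setT Theta by exact: testMr.
have sT := test_smooth tT.
have Vo : open [set x | `|x - x0| < e] by exact: open_norm_lt.
(* h vanishes on an open set outside of which Theta and chi agree *)
have hT g : smooth_on setT g -> h (fun x => chi x * g x) = h (fun x => Theta x * g x).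
  move=> sg; apply/eqP; rewrite -subr_eq0.
  have t1 := cutoffM cc sg.
  have t2 : test_on setT (fun x => Theta x * g x).
    by have := testM_fsupp sg tT; exact: testT.
  rewrite -(distB dh t1 t2); apply/eqP; apply: vV.
  apply: (test_on_ball (testB t1 t2) _ e2e) => x /eta0 E.
  by rewrite /Theta E subr0 mul1r subrr.
have hphi phi : test_on setT phi -> h phi = h (fun x => Theta x * phi x).
  move=> tp; rewrite -hT; last exact: test_smooth tp.
  apply/eqP; rewrite -subr_eq0.
  have t2 := cutoffM cc (test_smooth tp).
  rewrite -(distB dh tp t2); apply/eqP.
  apply: (dist_zero_near vK Wo KW (testB tp t2)) => x /W1 ->.
  by rewrite mul1r subrr.
have Theta0 x : `|x - x0| <= d -> Theta x = 0.
  by move=> xd; rewrite /Theta eta1// subrr mul0r.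
have [rc rc0 hrc] := test_far tc.
have Theta_far x : rc < `|x| -> Theta x = 0 by move=> /hrc; rewrite /Theta => ->; rewrite mulr0.
exists Theta, d; split => // s.
have d2 : 0 < d / 2 by rewrite divr_gt0.
have b0 : 0 < rc + 1 + `|x0| + e by have := normr_ge0 x0; move: rc0 e0; lra.
have [kt tk ktE] := test_annulus d2 b0 smooth_kappa.
pose psi := partials s kt.
have tpsi : test_on setT psi := test_partials s tk.
have bk := test_bsmooth tk; have bpsi := test_bsmooth tpsi.
(* on the support of Theta the singular kernel may be replaced by kt *)
have E1 : h (fun x => Theta x * partials s kappa (x - x0)) =
          h (fun x => Theta x * psi (x - x0)).
  congr h; apply/funext => x.
  have [xd|xd] := leP `|x - x0| d; first by rewrite Theta0// !mul0r.
  have [xr|xr] := ltP rc `|x|; first by rewrite Theta_far// !mul0r.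
  congr (_ * _); apply/esym.
  pose A := [set z : Rn | d / 2 < `|z - 0|] `&` [set z : Rn | `|z - 0| < rc + 1 + `|x0| + e].
  apply: (@partials_eq_on _ _ A s kt kappa).
  - by apply: openI; [exact: open_norm_gt|exact: open_norm_lt].
  - by move=> z [/=]; rewrite !subr0 => /ltW za /ltW zb; exact: ktE.
  - rewrite /A /= !subr0; split.
      by apply: lt_trans xd; rewrite ltr_pdivrMr// ltr_pMr// ltr1n.
    apply: le_lt_trans (ler_normB _ _) _; rewrite ltr_wpDr// ?(ltW e0)//.
    by rewrite ltrD2r (le_lt_trans xr)// ltrDl.
rewrite E1.
have smear_eq omega : test_on setT omega ->
    (forall x, d / 2 <= `|x - x0| -> omega x = 0) ->
    h (fun x => chi x * Conv kappa (partials s omega) x) =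
    h (fun x => Theta x * smear omega psi x).
  move=> tw w0; have lk := @locint_kappa R n n1.
  rewrite (hT _ (Conv_smooth lk (test_partials s tw))); congr h.
  apply/funext => y.
  have [yd|yd] := leP `|y - x0| d; first by rewrite Theta0// !mul0r.
  have [yr|yr] := ltP rc `|y|; first by rewrite Theta_far// !mul0r.
  congr (_ * _); rewrite -(Conv_partials s lk tw) -(smear_partials s tw bk).
  pose A := [set z : Rn | d < `|z - x0|] `&` [set z : Rn | `|z - 0| < rc + 1].
  apply: (@partials_eq_on _ _ A).
  - by apply: openI; [exact: open_norm_gt|exact: open_norm_lt].
  - move=> z [/= zd]; rewrite subr0 => zr.
    rewrite -(Conv_sub z lk tw) integral_RnE; apply: eq_Rintegral => t _ /=.
    have [tx|tx] := leP (d / 2) `|row_of t - x0|; first by rewrite w0// mulr0 mul0r.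
    rewrite mulrC kappa_sub; congr (_ * _); apply/esym/ktE.
      have := ler_distD (row_of t) z x0; rewrite [d / 2]splitr.
      move: tx zd; move: `|row_of t - x0| `|z - x0| `|z - row_of t| => A1 A2 A3.
      by lra.
    have h1 : `|row_of t| <= `|row_of t - x0| + `|x0|.
      by rewrite -{1}(subrK x0 (row_of t)) ler_normD.
    have := ler_normB z (row_of t); move: h1 tx zr de e2e.
    move: `|z - row_of t| `|row_of t - x0| `|z| `|row_of t| `|x0| => A1 A2 A3 A4 A5.
    by lra.
  - rewrite /A /= subr0; split => //.
    by rewrite (le_lt_trans yr)// ltrDl.
have cT : compact (fsupp Theta) by have [] := tT.
have [C [m [C0 hC]]] := dist_bnd dh cT.
have [BT hBT] := test_bnd m tT; have BT0 := bnd_ge0 hBT.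
have [B hB] := test_bnd m.+1 tpsi; have B0 := bnd_ge0 hB.
pose D := C * (2 ^+ m * (BT * (n%:R * B))).
have D0 : 0 <= D by rewrite /D !mulr_ge0// exprn_ge0.
apply/eqP; rewrite -normr_le0; apply/ler_addgt0Pr => eps eps0; rewrite add0r.
have eps2 : 0 < eps / 2 by rewrite divr_gt0.
(* G and its derivatives are small near x0 *)
have [d3 d30 hd3] : exists2 d3 : R, 0 < d3 & forall x, `|x - x0| < d3 ->
    `|partials (rev s) G x| <= eps / 2.
  have Vx0 : `|x0 - x0| < e by rewrite subrr normr0.
  have /cvgrPdist_le c := smooth_continuous (smooth_partials (rev s) sG) Vx0.
  have /near_normP[d3 d30 h3] := c _ eps2.
  by exists d3 => // x /h3; rewrite (G0 (rev s)) sub0r normrN.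
pose t := Num.min (d / 2) (Num.min d3 (eps / 2 / (D + 1))).
have D1 : 0 < D + 1 by rewrite ltr_wpDl.
have t0 : 0 < t by rewrite !lt_min d2 d30 divr_gt0.
have td : t <= d / 2 by rewrite ge_min lexx.
have td3 : t <= d3 by rewrite !ge_min lexx orbT.
have tD : t * (D + 1) <= eps / 2.
  by rewrite -ler_pdivlMr// !ge_min lexx !orbT.
have [omega [tw w0 wt w1]] := mollifier x0 t0.
have te : t < e by apply: le_lt_trans td _; move: de e2e d0; lra.
have tw' := test_on_ball tw wt te.
have S : `|h (fun x => Theta x * smear omega psi x)| <= eps / 2.
  rewrite -(smear_eq omega tw) => [|x xd]; last by apply: wt; exact: le_trans xd.
  rewrite (hG _ (test_partials s tw')) (integral_Rn_by_parts_seq s Vo sG tw').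
  rewrite normrM normrX normrN1 expr1n mul1r.
  apply: (integral_Rn_le tw _ w0 wt w1) => [|x xt]; last first.
    by apply: hd3; exact: lt_le_trans td3.
  exact: testT (testM Vo (smooth_partials (rev s) sG) tw').
have sshift := smooth_shift (- x0) (test_smooth tpsi).
have ssm := smear_smooth tw bpsi.
pose diff x := psi (x - x0) - smear omega psi x.
have sdiff : smooth_on setT diff by exact: (smoothB openT sshift ssm).
have bdiff : bnd m diff (n%:R * B * t).
  move=> s' x sm.
  have -> : partials s' diff x = partials s' psi (x - x0) - smear omega (partials s' psi) x.
    rewrite -(smear_partials s' tw bpsi) -(partials_shift s' psi (- x0) x).
    have -> : diff = (fun x => - 1 * smear omega psi x + psi (x - x0)).
      by apply/funext => z; rewrite /diff mulN1r addrC.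
    by rewrite (partials_lin (- 1) s' openT ssm sshift I) mulN1r addrC.
  rewrite distrC.
  apply: (smear_close _ tw (bsmooth_partials s' bpsi) w0 wt w1 _ t0) => s'' z s1.
  rewrite -partials_cat; apply: hB.
  by rewrite size_cat -addn1 addnC leq_add.
have -> : h (fun x => Theta x * psi (x - x0)) =
    h (fun x => Theta x * diff x) + h (fun x => Theta x * smear omega psi x).
  rewrite -(distD dh (testT (testM_fsupp sdiff tT)) (testT (testM_fsupp ssm tT))).
  by congr h; apply/funext => x; rewrite -mulrDr subrK.
rewrite (le_trans (ler_normD _ _))// [leRHS]splitr lerD//.
apply: le_trans (hC _ _ (testM_fsupp sdiff tT) (bndM sT sdiff hBT bdiff)) _.
apply: le_trans tD.
have -> : C * (2 ^+ m * (BT * (n%:R * B * t))) = t * D by rewrite /D; ring.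
by rewrite ler_wpM2l ?(ltW t0)// lerDl.
Qed.

End annihilation.

(** * Homogeneous polynomials *)

Section homogeneous_polynomials.
Context {R : realType} {n : nat}.
Local Notation Rn := 'rV[R]_n.
Implicit Types (x y z : Rn) (i j : 'I_n) (k m : nat) (P Q : Rn -> R).

Inductive Hom : nat -> (Rn -> R) -> Prop :=
| Hom_cst c : Hom 0 (fun=> c)
| Hom_mul i k P : Hom k P -> Hom k.+1 (fun x => x 0 i * P x)
| Hom_add k P Q : Hom k P -> Hom k Q -> Hom k (fun x => P x + Q x).

Lemma Hom_scale k P (c : R) : Hom k P -> Hom k (fun x => c * P x).
Proof.
elim=> [d|i k' P' _ IH|k' P' Q' _ IP _ IQ]; first exact: (Hom_cst (c * d)).
  have -> : (fun x => c * (x 0 i * P' x)) = (fun x => x 0 i * (c * P' x)).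
    by apply/funext => x; rewrite mulrCA.
  exact: Hom_mul.
have -> : (fun x => c * (P' x + Q' x)) = (fun x => c * P' x + c * Q' x).
  by apply/funext => x; rewrite mulrDr.
exact: Hom_add.
Qed.

Lemma Hom_smooth k P U : open U -> Hom k P -> smooth_on U P.
Proof.
move=> Uo; elim=> [c|i k' P' _ IH|k' P' Q' _ IP _ IQ].
- exact: (smooth_cst _ Uo).
- exact: (smoothM Uo (smooth_coord i Uo) IH).
- exact: (smoothD Uo IP IQ).
Qed.

Lemma Hom_derivable k P x i : Hom k P -> derivable P x (delta_mx 0 i).
Proof. by move=> hP; exact: (smooth_derivable (Hom_smooth openT hP) I). Qed.

Lemma Hom_coord_partial k P i j : Hom k P -> Hom k (fun x => x 0 i * partial j P x).
Proof.
elim=> [c|a k' P' hP IH|k' P' Q' hP IP hQ IQ].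
- have -> : (fun x => x 0 i * partial j (fun=> c) x) = (fun=> 0).
    by apply/funext => x; rewrite partial_cst mulr0.
  exact: (Hom_cst 0).
- have -> : (fun x => x 0 i * partial j (fun y => y 0 a * P' y) x) =
      (fun x => x 0 i * ((j == a)%:R * P' x) + x 0 a * (x 0 i * partial j P' x)).
    apply/funext => x; have da := smooth_derivable (smooth_coord a openT) (I : setT x).
    rewrite (partialM (da j) (Hom_derivable hP)) partial_coord; ring.
  by apply: Hom_add; apply: Hom_mul => //; exact: Hom_scale.
- have -> : (fun x => x 0 i * partial j (fun y => P' y + Q' y) x) =
      (fun x => x 0 i * partial j P' x + x 0 i * partial j Q' x).
    apply/funext => x.
    by rewrite (partialD (Hom_derivable hP) (Hom_derivable hQ)) mulrDr.
  exact: Hom_add.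
Qed.

Lemma Euler k P x : Hom k P -> \sum_i x 0 i * partial i P x = k%:R * P x.
Proof.
elim=> [c|a k' P' hP IH|k' P' Q' hP IP hQ IQ].
- by rewrite mul0r big1// => i _; rewrite partial_cst mulr0.
- have E i : x 0 i * partial i (fun y => y 0 a * P' y) x =
      (a == i)%:R * (x 0 i * P' x) + x 0 a * (x 0 i * partial i P' x).
    have da := smooth_derivable (smooth_coord a openT) (I : setT x).
    by rewrite (partialM (da i) (Hom_derivable hP)) partial_coord [i == a]eq_sym; ring.
  rewrite (eq_bigr _ (fun i _ => E i)) big_split /= -mulr_sumr IH.
  rewrite (bigD1 a)//= eqxx big1 => [|i ia]; last by rewrite eq_sym (negbTE ia) mul0r.
  by rewrite -(natr1 k') mul1r; ring.
- have E i : x 0 i * partial i (fun y => P' y + Q' y) x =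
      x 0 i * partial i P' x + x 0 i * partial i Q' x.
    by rewrite (partialD (Hom_derivable hP) (Hom_derivable hQ)) mulrDr.
  by rewrite (eq_bigr _ (fun i _ => E i)) big_split /= IP IQ mulrDr.
Qed.

(** Differentiating Euler's identity. *)
Lemma Euler_partial k P x j : Hom k P ->
  \sum_i x 0 i * partial i (partial j P) x = k%:R * partial j P x - partial j P x.
Proof.
move=> hP; have sP := Hom_smooth openT hP.
have e : (fun y => \sum_i y 0 i * partial i P y) = (fun y => k%:R * P y).
  by apply/funext => y; exact: Euler.
have := congr1 (fun g => partial j g x) e; rewrite /=.
rewrite (partialZ k%:R (Hom_derivable hP)) => <-.
have d i : is_derive x (delta_mx 0 j : Rn) (fun y => y 0 i * partial i P y)
   ((j == i)%:R * partial i P x + x 0 i * partial j (partial i P) x).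
  have s1 := smooth_coord i (@openT Rn); have s2 := smooth_partial i sP.
  have := is_derive_partial j (smoothM openT s1 s2) (I : setT x).
  by rewrite (partialM (smooth_derivable s1 I) (smooth_derivable s2 I)) partial_coord.
have E : (fun y => \sum_i y 0 i * partial i P y) =
    \sum_(i < n) (fun y : Rn => y 0 i * partial i P y).
  by apply/funext => y; rewrite fct_sumE.
have [_] := is_derive_sum d; rewrite -E -/(partial j _ x) => ->.
have -> : \sum_i ((j == i)%:R * partial i P x + x 0 i * partial j (partial i P) x) =
    partial j P x + \sum_i x 0 i * partial j (partial i P) x.
  rewrite big_split; congr (_ + _); rewrite (bigD1 j)//= eqxx mul1r big1 ?addr0//.
  by move=> i ij; rewrite eq_sym (negbTE ij) mul0r.
have cancel (a b : R) : b = a + b - a by ring.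
transitivity (\sum_(i < n) x 0 i * partial j (partial i P) x); last exact: cancel.
apply: eq_bigr => i _.
by rewrite (partialC i j openT sP (I : setT x)).
Qed.

Lemma Hom_mulHom k P l Q : Hom k P -> Hom l Q -> Hom (k + l) (fun x => P x * Q x).
Proof.
move=> hP hQ; elim: hP => [c|a k' P' hP IH|k' P' Q' hP IP hQ' IQ].
- exact: Hom_scale.
- have -> : (fun x => x 0 a * P' x * Q x) = (fun x => x 0 a * (P' x * Q x)).
    by apply/funext => x; rewrite mulrA.
  by rewrite addSn; exact: Hom_mul.
- have -> : (fun x => (P' x + Q' x) * Q x) = (fun x => P' x * Q x + Q' x * Q x).
    by apply/funext => x; rewrite mulrDl.
  exact: Hom_add.
Qed.

Lemma Hom_coord i : Hom 1 (fun x => x 0 i).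
Proof.
have := Hom_mul i (Hom_cst 1); congr Hom; apply/funext => x; exact: mulr1.
Qed.

Lemma Hom_sqnorm : (0 < n)%N -> Hom 2 (@sqnorm R n).
Proof.
move=> n0; have H (r : seq 'I_n) : Hom 2 (fun x => \sum_(i <- r) x 0 i ^+ 2).
  have H1 i : Hom 2 (fun x => x 0 i ^+ 2) := Hom_mulHom (Hom_coord i) (Hom_coord i).
  elim: r => [|i r IH].
    have := Hom_scale 0 (H1 (Ordinal n0)); congr Hom.
    by apply/funext => x; rewrite big_nil mul0r.
  have := Hom_add (H1 i) IH; congr Hom.
  by apply/funext => x; rewrite big_cons.
exact: (H (index_enum _)).
Qed.

Lemma Hom_succ_ind k (Phi : (Rn -> R) -> Prop) :
  (forall i P, Hom k P -> Phi (fun x => x 0 i * P x)) ->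
  (forall P Q, Phi P -> Phi Q -> Phi (fun x => P x + Q x)) ->
  forall Q, Hom k.+1 Q -> Phi Q.
Proof.
move=> h1 h2 Q; move e : k.+1 => k1 hQ; move: e.
elim: hQ => [//|i k' P' hP _ [kk]|k' P' Q' _ IP _ IQ e].
  by apply: h1; rewrite kk.
by apply: h2; [exact: IP|exact: IQ].
Qed.

End homogeneous_polynomials.

(** * Geometric decay of powers *)

Section geometric_decay.
Context {R : realType} {n : nat}.
Local Notation Rn := 'rV[R]_n.
Implicit Types (x y z : Rn) (i : 'I_n) (phi g : Rn -> R).

(** A derivative of the N-th power produces a factor N, which a slightly
    larger rate absorbs. *)
Lemma natM_expr_le (a b : R) : 0 < a -> a < b ->
  exists2 C, 0 <= C & forall N : nat, N.+1%:R * a ^+ N <= C * b ^+ N.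
Proof.
move=> a0 ab; have b0 := lt_trans a0 ab.
pose d := b / a - 1.
have d0 : 0 < d by rewrite subr_gt0 ltr_pdivlMr// mul1r.
have ba : b = (1 + d) * a by rewrite /d addrC subrK divfK// gt_eqF.
have bern N : 1 + N%:R * d <= (1 + d) ^+ N.
  elim: N => [|N IH]; first by rewrite mul0r addr0 expr0.
  have d1 : 0 <= 1 + d by rewrite addr_ge0// ltW.
  rewrite exprS; apply: le_trans (ler_wpM2l d1 IH).
  have N0 : 0 <= N%:R :> R by []; rewrite -natr1.
  have -> : (1 + d) * (1 + N%:R * d) = 1 + (N%:R + 1) * d + N%:R * d * d by ring.
  by rewrite lerDl !mulr_ge0// ltW.
have C0 : 0 <= 1 + d^-1 by rewrite addr_ge0// invr_ge0 ltW.
exists (1 + d^-1) => // N; rewrite ba exprMn mulrA ler_wpM2r ?exprn_ge0 ?(ltW a0)//.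
apply: le_trans (ler_wpM2l C0 (bern N)).
have : 0 <= d^-1 by rewrite invr_ge0 ltW.
have -> : (1 + d^-1) * (1 + N%:R * d) = 1 + N%:R * d + d^-1 + N%:R.
  by field; rewrite gt_eqF.
rewrite -natr1.
have : 0 <= N%:R * d by rewrite mulr_ge0// ltW.
by lra.
Qed.

Lemma partialX g i (N : nat) x : smooth_on setT g ->
  partial i (fun y => g y ^+ N) x = N%:R * g x ^+ N.-1 * partial i g x.
Proof.
move=> sg; have := is_deriveX N (is_derive_partial i sg (I : setT x)).
by rewrite exprfctE => -[_]; rewrite /partial => ->.
Qed.

Lemma fsupp_bound phi g (q : R) : smooth_on setT phi -> smooth_on setT g ->
  (forall x, fsupp phi x -> `|g x| <= q) ->
  0 <= q -> forall x (N : nat), `|phi x * g x ^+ N| <= `|phi x| * q ^+ N.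
Proof.
move=> sp sg gq q0 x N; rewrite normrM normrX.
have [xp|/fsupp_notin ->] := pselect (fsupp phi x); last by rewrite normr0 !mul0r.
by rewrite ler_wpM2l// lerXn2r// ?nnegrE// gq.
Qed.

(** By induction on the order: the derivative of a product of [phi] and a
    power of [g] is made of terms of the same form, and [natM_expr_le]
    absorbs the exponent that comes out. *)
Lemma bnd_geometric m phi g (q q' : R) : test_on setT phi -> smooth_on setT g ->
  (forall x, fsupp phi x -> `|g x| <= q) -> 0 < q -> q < q' ->
  exists C, forall N : nat, bnd m (fun x => phi x * g x ^+ N) (C * q' ^+ N).
Proof.
move=> + sg + q0; elim: m phi q' => [|m IH] phi q' tp gq qq'.
  have [B hB] := test_bounded tp; exists B => N; apply/bnd0P => x.
  rewrite (le_trans (fsupp_bound (test_smooth tp) sg gq (ltW q0) x N))//.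
  rewrite ler_pM// ?exprn_ge0 ?(ltW q0)//.
  by rewrite lerXn2r ?nnegrE ?ltW// (lt_trans q0).
have q'0 := lt_trans q0 qq'.
pose q1 := (q + q') / 2.
have qq1 : q < q1 by rewrite ltr_pdivlMr//; lra.
have q1q' : q1 < q' by rewrite ltr_pdivrMr//; lra.
have q10 := lt_trans q0 qq1.
have [C0 hC0] := IH phi q' tp gq qq'.
have sup1 i x : fsupp (partial i phi) x -> fsupp phi x.
  apply: fsupp_sub; first exact: closed_fsupp.
  move=> y yp; rewrite -(partial_cst i 0 y).
  by apply: (partial_eq_on i (open_fsuppC (phi := phi)) _ yp) => z; exact: fsupp_notin.
have gq1 i x : fsupp (partial i phi) x -> `|g x| <= q by move=> /sup1; exact: gq.
have /choice[C1 hC1] i := IH _ q' (test_partial i tp) (gq1 i) qq'.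
have t2 i := testMr (smooth_partial i sg) tp.
have gq2 i x : fsupp (fun x => partial i g x * phi x) x -> `|g x| <= q.
  move=> xp; apply: gq; move: xp; apply: fsupp_sub; first exact: closed_fsupp.
  by move=> y /fsupp_notin ->; rewrite mulr0.
have /choice[C2 hC2] i := IH _ q1 (t2 i) (gq2 i) qq1.
have [E E0 hE] := natM_expr_le q10 q1q'.
exists (`|C0| + \sum_i (`|C1 i| + `|C2 i| * q'^-1 * E)) => N.
have C1_0 i : 0 <= `|C1 i| + `|C2 i| * q'^-1 * E.
  by rewrite addr_ge0// !mulr_ge0// invr_ge0 ltW.
apply/bndSP; split=> [x|i].
  have := hC0 N [::] x isT; rewrite /= => h; apply: le_trans h _.
  rewrite ler_wpM2r ?exprn_ge0 ?(ltW q'0)// (le_trans (ler_norm _))// lerDl.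
  exact: sumr_ge0.
have sN k : smooth_on setT (fun x => g x ^+ k) := smoothX k openT sg.
have sp := test_smooth tp; have sp1 := smooth_partial i sp.
have s2 := test_smooth (t2 i).
have -> : partial i (fun x => phi x * g x ^+ N) =
    (fun x => partial i phi x * g x ^+ N +
              N%:R * ((partial i g x * phi x) * g x ^+ N.-1)).
  apply/funext => x.
  rewrite (partialM (smooth_derivable sp I) (smooth_derivable (sN N) I)).
  by rewrite partialX//; ring.
have b1 := hC1 i N; have b2 := bndZ N%:R (smoothM openT s2 (sN N.-1)) (hC2 i N.-1).
have := bndD (smoothM openT sp1 (sN N)) (smoothZ N%:R openT (smoothM openT s2 (sN N.-1))) b1 b2.
apply: bnd_le => //.
rewrite normr_nat (bigD1 i)//=; set S := \sum_(j < n | j != i) _.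
have -> : (`|C0| + (`|C1 i| + `|C2 i| * q'^-1 * E + S)) * q' ^+ N =
    `|C0| * q' ^+ N + `|C1 i| * q' ^+ N + `|C2 i| * q'^-1 * E * q' ^+ N + S * q' ^+ N.
  by ring.
have A1 : C1 i * q' ^+ N <= `|C1 i| * q' ^+ N.
  by rewrite ler_wpM2r ?ler_norm// exprn_ge0// ltW.
have A2 : N%:R * (C2 i * q1 ^+ N.-1) <= `|C2 i| * q'^-1 * E * q' ^+ N.
  case: N {b1 b2 A1} => [|N].
    by rewrite mul0r !mulr_ge0// ?invr_ge0 ?exprn_ge0// ltW.
  rewrite /= mulrCA (le_trans (y := `|C2 i| * (N.+1%:R * q1 ^+ N)))//.
    by rewrite ler_wpM2r ?ler_norm// mulr_ge0// exprn_ge0// ltW.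
  have -> : `|C2 i| * q'^-1 * E * q' ^+ N.+1 = `|C2 i| * (E * q' ^+ N).
    by rewrite exprS; field; rewrite gt_eqF.
  by rewrite ler_wpM2l.
have A3 : 0 <= `|C0| * q' ^+ N by rewrite mulr_ge0// exprn_ge0// ltW.
have A4 : 0 <= S * q' ^+ N.
  by rewrite mulr_ge0 ?sumr_ge0// exprn_ge0// ltW.
by move: A1 A2 A3 A4; lra.
Qed.

Lemma expr_small (q e C : R) : 0 < q -> q < 1 -> 0 < e ->
  exists N : nat, C * q ^+ N < e.
Proof.
move=> q0 q1 e0; have C1 : 0 < `|C| + 1 by rewrite ltr_wpDl.
have c : (fun N => q ^+ N) @ \oo --> (0 : R) by apply: cvg_expr; rewrite gtr0_norm.
have /cvgrPdist_lt /(_ (e / (`|C| + 1)) (divr_gt0 e0 C1)) [N _ /(_ N (leqnn N))] := c.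
rewrite /= sub0r normrN ger0_norm ?exprn_ge0 ?(ltW q0)// ltr_pdivlMr// => h; exists N.
apply: le_lt_trans h; rewrite mulrC ler_wpM2l ?exprn_ge0 ?(ltW q0)//.
by rewrite (le_trans (ler_norm _))// lerDl.
Qed.

End geometric_decay.

(** * Polynomial approximation with derivatives *)

Section weierstrass.
Context {R : realType} {n : nat}.
Local Notation Rn := 'rV[R]_n.
Local Notation mu := (lebesgue_tuple R n).
Implicit Types (x y z : Rn) (i : 'I_n) (psi phi g P : Rn -> R).

Inductive Pol : (Rn -> R) -> Prop :=
| Pol_Hom k P : Hom k P -> Pol P
| Pol_add P Q : Pol P -> Pol Q -> Pol (fun x => P x + Q x).

Lemma Pol_scale (c : R) P : Pol P -> Pol (fun x => c * P x).
Proof.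
elim=> [k P' hP|P' Q' _ IP _ IQ]; first exact: (Pol_Hom (Hom_scale c hP)).
have := Pol_add IP IQ; congr Pol; apply/funext => x; exact/esym/mulrDr.
Qed.

(** Polynomials in the second variable whose coefficients are smooth in the
    first one: integration against the first variable leaves a polynomial. *)
Inductive tensor : (Rn -> Rn -> R) -> Prop :=
| tensor_base a k P : smooth_on setT a -> Hom k P -> tensor (fun x y => a x * P y)
| tensor_add F G : tensor F -> tensor G -> tensor (fun x y => F x y + G x y).

Lemma tensor_mul F G : tensor F -> tensor G -> tensor (fun x y => F x y * G x y).
Proof.
move=> tF tG; elim: tF => [a k P sa hP|F1 F2 _ I1 _ I2].
  elim: tG => [b l Q sb hQ|G1 G2 _ I1 _ I2].
    have := tensor_base (smoothM openT sa sb) (Hom_mulHom hP hQ).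
    by congr tensor; apply/funext => x; apply/funext => y; ring.
  have := tensor_add I1 I2.
  by congr tensor; apply/funext => x; apply/funext => y; ring.
have := tensor_add I1 I2.
by congr tensor; apply/funext => x; apply/funext => y; ring.
Qed.

Lemma tensor_cst (c : R) : tensor (fun _ _ => c).
Proof.
have := tensor_base (smooth_cst c openT) (Hom_cst 1).
by congr tensor; apply/funext => x; apply/funext => y; rewrite mulr1.
Qed.

Lemma tensor_exp F N : tensor F -> tensor (fun x y => F x y ^+ N).
Proof.
move=> tF; elim: N => [|N IH]; first exact: tensor_cst.
have := tensor_mul tF IH.
by congr tensor; apply/funext => x; apply/funext => y; rewrite exprS.
Qed.

Lemma tensor_sqnorm_sub : tensor (fun x y => sqnorm (x - y)).
Proof.
have H1 i : tensor (fun x y => (x - y) 0 i).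
  have := tensor_add (tensor_base (smooth_coord i openT) (Hom_cst 1))
    (tensor_base (smooth_cst (- 1) openT) (Hom_coord i)).
  by congr tensor; apply/funext => x; apply/funext => y; rewrite !mxE; ring.
have H (r : seq 'I_n) : tensor (fun x y => \sum_(i <- r) (x - y) 0 i ^+ 2).
  elim: r => [|i r IH].
    have := tensor_cst 0; congr tensor; apply/funext => x; apply/funext => y.
    by rewrite big_nil.
  have := tensor_add (tensor_exp 2 (H1 i)) IH.
  by congr tensor; apply/funext => x; apply/funext => y; rewrite big_cons.
exact: (H (index_enum _)).
Qed.

Lemma tensor_smooth F y : tensor F -> smooth_on setT (fun x => F x y).
Proof.
elim=> [a k P sa hP|F1 F2 _ I1 _ I2]; last exact: (smoothD openT I1 I2).
have := smoothZ (P y) openT sa; congr smooth_on; apply/funext => x; exact: mulrC.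
Qed.

Lemma tensor_integral F psi : tensor F -> test_on setT psi ->
  exists2 P, Pol P & forall y, integral_Rn (fun x => F x y * psi x) = P y.
Proof.
move=> tF tp; elim: tF => [a k P sa hP|F1 F2 t1 [P1 p1 e1] t2 [P2 p2 e2]].
  exists (fun y => integral_Rn (fun x => a x * psi x) * P y).
    exact: (Pol_scale _ (Pol_Hom hP)).
  move=> y; rewrite mulrC -(integral_RnZ (P y) (testMr sa tp)).
  by congr integral_Rn; apply/funext => x; ring.
exists (fun y => P1 y + P2 y); first exact: Pol_add.
move=> y; rewrite -e1 -e2 !integral_RnE -RintegralD//; last 2 first.
- exact: (intRn_test (testMr (tensor_smooth y t1) tp)).
- exact: (intRn_test (testMr (tensor_smooth y t2) tp)).
by apply: eq_Rintegral => t _; rewrite mulrDl.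
Qed.

Section landau.
Context (a rho : R).
Hypotheses (a0 : 0 < a) (rhoE : rho = 2 * n.+1%:R * a ^+ 2).

(** The constant [rho] is so large that [bump] is at least 1/2 on the cube; its
    powers are nonnegative there and concentrate at 0. *)
Definition bump z : R := 1 - sqnorm z / rho.

Let rho0 : 0 < rho.
Proof. by rewrite rhoE !mulr_gt0// exprn_gt0. Qed.

Lemma bump_smooth : smooth_on setT bump.
Proof.
apply: (smoothB openT (smooth_cst _ openT)).
have -> : (fun z => sqnorm z / rho) = (fun z => rho^-1 * sqnorm z).
  by apply/funext => z; exact: mulrC.
exact: (smoothZ rho^-1 openT (smooth_sqnorm openT)).
Qed.

Lemma bump_ge z (r : R) : `|z| <= r -> 1 - n%:R * r ^+ 2 / rho <= bump z.
Proof.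
move=> zr; rewrite /bump lerD2l lerN2 ler_wpM2r ?invr_ge0 ?(ltW rho0)//.
rewrite (le_trans (sqnorm_le z))// ler_wpM2l// lerXn2r ?nnegrE//.
exact: le_trans zr.
Qed.

Lemma bump_le z (r : R) : 0 <= r -> r <= `|z| -> bump z <= 1 - r ^+ 2 / rho.
Proof.
move=> r0 rz; rewrite /bump lerD2l lerN2 ler_wpM2r ?invr_ge0 ?(ltW rho0)//.
by apply: le_trans (norm_le_sqnorm z); rewrite lerXn2r ?nnegrE.
Qed.

Lemma bump_half z : `|z| <= a -> 2^-1 <= bump z.
Proof.
move=> za; apply: le_trans (bump_ge za).
have -> : n%:R * a ^+ 2 / rho = n%:R / n.+1%:R / 2.
  have : 0 < n.+1%:R :> R by [].
  by rewrite rhoE; move: (n.+1%:R) => c c0; field; rewrite !gt_eqF.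
have : n%:R / n.+1%:R <= 1 :> R by rewrite ler_pdivrMr// mul1r ler_nat.
by move: (n%:R / n.+1%:R) => x; lra.
Qed.

Lemma bump_le1 z : bump z <= 1.
Proof. by rewrite /bump gerBl divr_ge0 ?sqnorm_ge0// ltW. Qed.

Definition landau N (t : n.-tuple (measurableTypeR R)) : R :=
  \1_(cube a) t * bump (row_of t) ^+ N.

Lemma landau_ge0 N t : 0 <= landau N t.
Proof.
rewrite /landau indicE; have [/set_mem/cubeP -/(_ (ltW a0)) ta|_] := boolP (t \in cube a).
  by rewrite mul1r exprn_ge0// (le_trans _ (bump_half ta)).
by rewrite mul0r.
Qed.

Lemma measurable_bump N : measurable_fun setT (fun t => bump (@row_of R n t) ^+ N).
Proof.
apply: measurable_realfun.measurable_funX.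
by apply: measurable_row_continuous => x; exact: (smooth_continuous bump_smooth I).
Qed.

Lemma integrable_landau N : mu.-integrable setT (EFin \o landau N).
Proof.
apply: (le_integrable measurableT _ _ (integrable_cube a)).
  apply/measurable_EFinP; apply: measurable_realfun.measurable_funM.
    by apply: measurable_indic; exact: measurable_cube.
  exact: measurable_bump.
move=> t _ /=; rewrite lee_fin ger0_norm ?landau_ge0// ger0_norm//.
rewrite /landau indicE; have [/set_mem/cubeP -/(_ (ltW a0)) ta|_] := boolP (t \in cube a).
  by rewrite !mul1r exprn_ile1 ?bump_le1// (le_trans _ (bump_half ta)).
by rewrite mul0r.
Qed.

Definition landau_mass N : R := (\int[mu]_t landau N t)%R.

Lemma landau_mass_ge N (r : R) : 0 <= r -> r <= a ->
  (2 * r) ^+ n * (1 - n%:R * r ^+ 2 / rho) ^+ N <= landau_mass N.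
Proof.
move=> r0 ra; rewrite -(integral_cube (n := n) r0) -RintegralZr//; last first.
  exact: integrable_cube.
apply: le_Rintegral => //; last 1 first.
- move=> t _; rewrite indicE.
  have [/set_mem/cubeP -/(_ r0) tr|_] := boolP (t \in cube r); last first.
    by rewrite mul0r landau_ge0.
  rewrite /landau indicE mem_set ?mul1r; last by apply/cubeP; [exact: ltW|exact: le_trans ra].
  have ta : `|row_of t| <= a := le_trans tr ra.
  have b0 : 0 <= 1 - n%:R * r ^+ 2 / rho.
    rewrite subr_ge0 ler_pdivrMr// mul1r rhoE.
    have h : n%:R * r ^+ 2 <= n.+1%:R * a ^+ 2.
      by rewrite ler_pM ?exprn_ge0 ?ler_nat// lerXn2r ?nnegrE// ltW.
    apply: le_trans h _; rewrite -mulrA ler_peMl ?ler1n//.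
    by rewrite mulr_ge0// exprn_ge0// ltW.
  by rewrite lerXn2r ?nnegrE ?bump_ge// (le_trans b0)// bump_ge.
- have := integrableZr measurableT ((1 - n%:R * r ^+ 2 / rho) ^+ N) (integrable_cube (n := n) r).
  by congr (_.-integrable _ _).
- exact: integrable_landau.
Qed.

Lemma landau_approx N phi (B r : R) y : bsmooth phi -> bnd 1 phi B ->
  0 <= r -> r <= a ->
  `|par mu (landau N) row_of phi y - landau_mass N * phi y| <=
  n%:R * B * r * landau_mass N + 2 * B * (1 - r ^+ 2 / rho) ^+ N * (2 * a) ^+ n.
Proof.
move=> bp hB r0 ra; have B0 := bnd_ge0 hB.
have il := integrable_landau N.
have i1 := integrable_par il (@measurable_row_of R n) y bp.
have i2 : mu.-integrable setT (EFin \o (fun t => landau N t * phi y)).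
  by have := integrableZr measurableT (phi y) il; congr (_.-integrable _ _).
rewrite /par /landau_mass -RintegralZr// -RintegralB//.
have ib := integrableB measurableT i1 i2.
apply: le_trans (le_normr_Rintegral measurableT ib) _.
have i3 : mu.-integrable setT (EFin \o (fun t => n%:R * B * r * landau N t)).
  by have := integrableZl measurableT (n%:R * B * r) il; congr (_.-integrable _ _).
have i4 : mu.-integrable setT (EFin \o
    (fun t => 2 * B * (1 - r ^+ 2 / rho) ^+ N * \1_(@cube R n a) t)).
  have := integrableZl measurableT (2 * B * (1 - r ^+ 2 / rho) ^+ N) (integrable_cube (n := n) a).
  by congr (_.-integrable _ _).
rewrite -(integral_cube (n := n) (ltW a0)) -RintegralZl// -[X in _ <= _ + X]RintegralZl//; last first.
  exact: integrable_cube.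
rewrite -RintegralD//; apply: le_Rintegral => //.
- exact: (integrable_norm ib).
- by have := integrableD measurableT i3 i4; congr (_.-integrable _ _).
move=> t _ /=; rewrite -mulrBr normrM (ger0_norm (landau_ge0 N t)).
have q0 : 0 <= 1 - r ^+ 2 / rho.
  rewrite subr_ge0 ler_pdivrMr// mul1r rhoE.
  have h : r ^+ 2 <= a ^+ 2 by rewrite lerXn2r ?nnegrE// ltW.
  by apply: le_trans h _; rewrite ler_peMl ?exprn_ge0 ?(ltW a0)// -natrM ler1n.
have hB0 x : `|phi x| <= B by exact: (hB [::]).
have [tr|tr] := leP `|row_of t| r.
  rewrite [landau N t * _]mulrC -[leLHS]addr0; apply: lerD.
    rewrite ler_wpM2r ?landau_ge0// (le_trans (bnd_lipschitz _ _ bp.1 hB))//.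
    by rewrite addrAC subrr add0r ler_wpM2l// mulr_ge0.
  by rewrite !mulr_ge0// exprn_ge0.
rewrite -[leLHS]add0r; apply: lerD; first by apply: mulr_ge0; [rewrite !mulr_ge0|exact: landau_ge0].
rewrite /landau indicE; have [/set_mem/cubeP -/(_ (ltW a0)) ta|_] := boolP (t \in cube a); last first.
  by rewrite !mul0r mulr0.
rewrite mul1r mulr1 mulrC ler_pM ?exprn_ge0//.
- by rewrite (le_trans _ (bump_half ta)).
- rewrite (le_trans (ler_normB _ _))//.
  by have := hB0 (y + row_of t); have := hB0 (y); lra.
- rewrite lerXn2r ?nnegrE//; first by rewrite (le_trans _ (bump_half ta)).
  by apply: bump_le => //; exact: ltW.
Qed.

End landau.

(** When [y] is in the ball, psi (y + t) vanishes for [t] off the cube, so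
    that the indicator of the cube disappears and a power of a polynomial in
    x - y is left. *)
Lemma landau_pol N (r b rho : R) psi : 0 < r -> 0 < b -> test_on setT psi ->
  (forall x, r < `|x| -> psi x = 0) -> exists2 P, Pol P &
  forall y, `|y| <= b -> par mu (landau (r + b) rho N) row_of psi y = P y.
Proof.
move=> r0 b0 tp hr.
have tb : tensor (fun x y => bump rho (x - y) ^+ N).
  apply: tensor_exp; rewrite /bump.
  have -> : (fun x y => 1 - sqnorm (x - y) / rho) =
      (fun x y : Rn => 1 + - rho^-1 * sqnorm (x - y)).
    by apply/funext => x; apply/funext => y; rewrite mulNr mulrC.
  exact: (tensor_add (tensor_cst 1) (tensor_mul (tensor_cst _) tensor_sqnorm_sub)).
have [P pP E] := tensor_integral tb tp; exists P => // y yb.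
have := Conv_par (fun z => bump rho z ^+ N) r0 b0 hr yb.
rewrite /landau => <-; rewrite -E /Conv.
have tg : test_on setT (fun x => bump rho (x - y) ^+ N * psi x).
  exact: (testMr (tensor_smooth y tb) tp).
rewrite -[RHS](integral_Rn_shift (v := y)); last 2 first.
- by apply: measurable_row_continuous => x; exact: (smooth_continuous (test_smooth tg) I).
- exact: (intRn_test (test_shift y tg)).
by congr integral_Rn; apply/funext => x; rewrite addrK.
Qed.

(** Convolution with a normalised Landau kernel commutes with derivatives,
    so that it approximates these as well. The mass of the kernel is bounded
    below by the contribution of a cube of radius [eta'] smaller than [eta],
    on which the kernel exceeds its values beyond distance [eta] by a factor
    that grows geometrically with the exponent. *)
Lemma weierstrass psi (b : R) m (e : R) : test_on setT psi -> 0 < b -> 0 < e ->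
  exists F P, [/\ smooth_on setT F, Pol P, forall z, `|z| <= b -> F z = P z &
    bnd m (fun x => F x - psi x) e].
Proof.
move=> tp b0 e0; have [r r0 hr] := test_far tp.
have [B hB] := test_bnd m.+1 tp; have B0 := bnd_ge0 hB.
pose a := r + b; have a0 : 0 < a by rewrite addr_gt0.
pose c : R := n.+1%:R; have c0 : 0 < c by [].
have nc : n%:R = c - 1 :> R by rewrite /c -natr1 addrK.
have n0 : 0 <= n%:R :> R by [].
pose rho := 2 * c * a ^+ 2.
have rho0 : 0 < rho by rewrite !mulr_gt0// exprn_gt0.
pose eta := Num.min a (e / (2 * (n%:R * B + 1))).
have nB0 : 0 <= n%:R * B by rewrite mulr_ge0.
have eta0 : 0 < eta by rewrite lt_min a0 divr_gt0// mulr_gt0// ltr_wpDl.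
have etaa : eta <= a by rewrite /eta ge_min lexx.
have etae : n%:R * B * eta <= e / 2.
  have : eta <= e / (2 * (n%:R * B + 1)) by rewrite /eta ge_min lexx orbT.
  rewrite ler_pdivlMr; last by rewrite mulr_gt0// ltr_wpDl.
  by move=> h; have := ltW eta0; rewrite ler_pdivlMr//; nra.
pose eta' := eta / c.
have eta'0 : 0 < eta' by rewrite divr_gt0.
have eta'a : eta' <= a.
  by rewrite (le_trans _ etaa)// ler_pdivrMr// ler_peMr ?(ltW eta0)// ler1n.
pose q1 := 1 - eta ^+ 2 / rho; pose q2 := 1 - n%:R * eta' ^+ 2 / rho.
have q10 : 0 < q1.
  rewrite subr_gt0 ltr_pdivrMr// mul1r /rho.
  have h : eta ^+ 2 <= a ^+ 2 by rewrite lerXn2r ?nnegrE ?(ltW a0) ?(ltW eta0).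
  apply: le_lt_trans h _; rewrite ltr_pMl ?exprn_gt0//.
  have : 1 <= c by rewrite ler1n.
  by lra.
have q12 : q1 < q2.
  rewrite /q1 /q2 ltrD2l ltrN2 ltr_pM2r ?invr_gt0// /eta' exprMn mulrCA.
  rewrite gtr_pMr ?exprn_gt0// exprVn ltr_pdivrMr ?exprn_gt0// mul1r nc.
  by have : 1 <= c by [rewrite ler1n]; nra.
have q20 := lt_trans q10 q12.
pose C := 2 * B * (2 * a) ^+ n / (2 * eta') ^+ n.
have e2 : 0 < e / 2 by rewrite divr_gt0.
have qq0 : 0 < q1 / q2 by rewrite divr_gt0.
have qq1 : q1 / q2 < 1 by rewrite ltr_pdivrMr// mul1r.
have [N hN] := expr_small C qq0 qq1 e2.
have il := integrable_landau a0 (erefl rho) N.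
have bp := test_bsmooth tp.
pose M := landau_mass a rho N.
have Mge : (2 * eta') ^+ n * q2 ^+ N <= M.
  exact: (landau_mass_ge a0 (erefl rho) N (ltW eta'0) eta'a).
have p0 : 0 < (2 * eta') ^+ n by rewrite exprn_gt0// mulr_gt0.
have M0 : 0 < M.
  by apply: lt_le_trans Mge; rewrite mulr_gt0// exprn_gt0.
have [P pP hP] := landau_pol N rho r0 b0 tp hr.
pose F0 := par mu (landau a rho N) row_of psi.
have sF0 : smooth_on setT F0 := par_smooth il (@measurable_row_of R n) bp.
exists (fun z => M^-1 * F0 z), (fun z => M^-1 * P z); split.
- exact: (smoothZ M^-1 openT sF0).
- exact: Pol_scale.
- by move=> z zb; rewrite /F0 (hP z zb).
move=> s x sm.
have -> : (fun x => M^-1 * F0 x - psi x) = (fun x => -1 * psi x + (M^-1 * F0 x)).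
  by apply/funext => z; rewrite mulN1r addrC.
rewrite (partials_lin (-1) s openT (test_smooth tp) (smoothZ M^-1 openT sF0) I).
rewrite (partialsZ M^-1 s openT sF0 I) /F0 (par_partials il (@measurable_row_of R n) s bp).
have hBs : bnd 1 (partials s psi) B.
  by move=> t z t1; rewrite -partials_cat; apply: hB; rewrite size_cat -addn1 addnC leq_add.
have := landau_approx a0 (erefl rho) N x (bsmooth_partials s bp) hBs (ltW eta0) etaa.
rewrite -/M -/q1; set G := par _ _ _ _ _; set D := partials s psi x => ap.
have -> : -1 * D + M^-1 * G = M^-1 * (G - M * D).
  by rewrite mulrBr mulKf ?gt_eqF// mulN1r addrC.
rewrite normrM gtr0_norm ?invr_gt0// mulrC ler_pdivrMr//.
apply: le_trans ap _; have -> : e * M = e / 2 * M + e / 2 * M by field.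
apply: lerD; first by rewrite ler_wpM2r// ltW.
have fin : C * (q1 / q2) ^+ N * ((2 * eta') ^+ n * q2 ^+ N) <= e / 2 * M.
  apply: ler_pM => //; [|by rewrite ltW// mulr_gt0// exprn_gt0|exact: ltW].
  have a2 : 0 <= 2 * a by rewrite mulr_ge0// ltW.
  have C0 : 0 <= C.
    by apply: divr_ge0 (ltW p0); rewrite mulr_ge0 ?exprn_ge0// mulr_ge0.
  by rewrite mulr_ge0// exprn_ge0// ltW.
apply: le_trans fin; rewrite /C [(q1 / q2) ^+ N]exprMn exprVn le_eqVlt; apply/orP; left; apply/eqP.
by field; rewrite expf_neq0 ?gt_eqF// mulr_gt0.
Qed.

End weierstrass.

(** * Density of the derivatives of the kernel *)

Lemma Hom0_cst {R : realType} {n : nat} k (P : 'rV[R]_n -> R) :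
  Hom k P -> k = 0%N -> exists c, P = (fun=> c).
Proof.
elim=> [c _|//|k' P1 P2 _ I1 _ I2 e]; first by exists c.
have [c1 ->] := I1 e; have [c2 ->] := I2 e.
by exists (c1 + c2).
Qed.

Section density.
Context {R : realType} {n : nat}.
Local Notation Rn := 'rV[R]_n.
Local Notation U0 := (@rad_dom R n 0).
Local Notation u := (@rad R n 0).
Implicit Types (x y z : Rn) (i j : 'I_n) (k m : nat) (s : seq 'I_n)
  (P Q psi phi g : Rn -> R).
Hypothesis n1 : (1 < n)%N.
Context (h : functional R n) (Theta : Rn -> R) (x0 : Rn) (d : R).
Hypotheses (dh : Defs.distribution h) (tT : test_on setT Theta) (d0 : 0 < d)
  (Td : forall x, `|x - x0| <= d -> Theta x = 0).

Definition cut_pairing psi : R := h (fun y => Theta y * psi (y - x0)).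
Local Notation L := cut_pairing.

Let U0o : open U0. Proof. exact: rad_dom_open. Qed.

Let cT : compact (fsupp Theta). Proof. by case: tT. Qed.

Lemma Theta_radius : exists2 b : R, 0 < b & forall y, b < `|y - x0| -> Theta y = 0.
Proof.
have [r r0 hr] := test_far tT; exists (r + `|x0|) => [|y yb].
  by rewrite ltr_pwDl.
by apply: hr; rewrite -(ltrD2r `|x0|) (lt_le_trans yb)// ler_normB.
Qed.

Lemma cut_rep psi : smooth_on U0 psi -> exists2 psi', test_on setT psi' &
  forall y, Theta y * psi (y - x0) = Theta y * psi' (y - x0).
Proof.
move=> sp; have [b b0 hb] := Theta_radius.
have [psi' tp E] := test_annulus d0 b0 sp; exists psi' => // y.
have [yd|yd] := leP `|y - x0| d; first by rewrite Td// !mul0r.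
have [yb|yb] := leP `|y - x0| b; last by rewrite hb// !mul0r.
by rewrite E// ltW.
Qed.

Lemma cut_test psi : smooth_on U0 psi ->
  test_on (fsupp Theta) (fun y => Theta y * psi (y - x0)).
Proof.
move=> /cut_rep[psi' tp E].
have -> : (fun y => Theta y * psi (y - x0)) = (fun y => Theta y * psi' (y - x0)).
  by apply/funext => y; exact: E.
exact: (testM_fsupp (smooth_shift (- x0) (test_smooth tp)) tT).
Qed.

Lemma cut_lin (a : R) psi1 psi2 : smooth_on U0 psi1 -> smooth_on U0 psi2 ->
  L (fun z => a * psi1 z + psi2 z) = a * L psi1 + L psi2.
Proof.
move=> s1 s2; have [lin _] := dh.
rewrite /L -(lin a _ _ (testT (cut_test s1)) (testT (cut_test s2))).
by congr h; apply/funext => y; ring.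
Qed.

Lemma cut_eq psi1 psi2 : (forall z, U0 z -> psi1 z = psi2 z) -> L psi1 = L psi2.
Proof.
move=> E; congr h; apply/funext => y.
have [yx|yx] := eqVneq (y - x0) 0; first by rewrite Td ?mul0r// yx normr0 ltW.
by rewrite E//; exact/rad_dom0P.
Qed.

(** The derivatives are part of the condition, which makes it stable under
    differentiation. *)
Definition annihilated psi : Prop :=
  smooth_on U0 psi /\ forall s, L (partials s psi) = 0.

Lemma annihilated_eq psi1 psi2 : (forall z, U0 z -> psi1 z = psi2 z) ->
  annihilated psi1 -> annihilated psi2.
Proof.
move=> E [s1 h1]; split=> [|s]; first exact: smooth_eq_on U0o E s1.
by rewrite -(h1 s); apply: cut_eq => z Uz; apply/esym; exact: (partials_eq_on s U0o E Uz).
Qed.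

Lemma annihilated_partial psi i : annihilated psi -> annihilated (partial i psi).
Proof.
move=> [s1 h1]; split=> [|s]; first exact: smooth_partial.
by rewrite -partials_rcons.
Qed.

Lemma annihilated_lin (a : R) psi1 psi2 : annihilated psi1 -> annihilated psi2 ->
  annihilated (fun z => a * psi1 z + psi2 z).
Proof.
move=> [s1 h1] [s2 h2]; split=> [|s].
  exact: (smoothD U0o (smoothZ a U0o s1) s2).
rewrite (cut_eq (psi2 := fun z => a * partials s psi1 z + partials s psi2 z)).
  rewrite (cut_lin a (smooth_partials s s1) (smooth_partials s s2)).
  by rewrite h1 h2 mulr0 addr0.
by move=> z; exact: partials_lin.
Qed.

Lemma annihilated0 psi : annihilated psi -> annihilated (fun=> 0).
Proof.
move=> a1; have := annihilated_lin (-1) a1 a1; apply: annihilated_eq => z _.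
by rewrite mulN1r addNr.
Qed.

Lemma annihilated_sum psi0 (F : 'I_n -> Rn -> R) : annihilated psi0 ->
  (forall i, annihilated (F i)) -> annihilated (fun z => \sum_i F i z).
Proof.
move=> a0 aF; have H (r : seq 'I_n) : annihilated (fun z => \sum_(i <- r) F i z).
  elim: r => [|i r IH].
    by apply: annihilated_eq (annihilated0 a0) => z _; rewrite big_nil.
  apply: annihilated_eq (annihilated_lin 1 (aF i) IH) => z _.
  by rewrite big_cons mul1r.
exact: (H (index_enum _)).
Qed.

Lemma annihilated_scale (a : R) psi : annihilated psi -> annihilated (fun z => a * psi z).
Proof.
move=> a1; apply: annihilated_eq (annihilated_lin a a1 (annihilated0 a1)) => z _.
exact: addr0.
Qed.

(** The exponent for which [P z * u z ^+ weight k] is homogeneous of degree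
    1 - n - k when [P] is in [Hom k], as are the k-th derivatives of
    [kappa]. *)
Definition weight k : nat := (n.-1 + k.*2)%N.

Lemma weightE k : (weight k)%:R = n%:R - 1 + 2 * k%:R :> R.
Proof.
rewrite /weight natrD -mul2n natrM; congr (_ + _).
by rewrite -[in RHS](prednK (ltnW n1)) -natr1 addrK.
Qed.

Lemma sqnorm_rad z : U0 z -> sqnorm z * u z ^+ 2 = 1.
Proof.
move=> Uz; rewrite sqr_rad// addr0 divff// gt_eqF//.
by move: Uz; rewrite /rad_dom /= addr0.
Qed.

Lemma partial_Hom_rad k P m j z : Hom k P -> U0 z ->
  partial j (fun y => P y * u y ^+ m) z =
  partial j P z * u z ^+ m - m%:R * (z 0 j * P z * u z ^+ m.+2).
Proof.
move=> hP Uz; rewrite (partialM (Hom_derivable hP) (smooth_derivable (@smooth_radX R n 0 m) Uz)).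
by rewrite partial_radX//; ring.
Qed.

(** The radial field through [partial j P]: by homogeneity its divergence is
    a multiple of the function itself. *)
Lemma div_Hom_rad k P j z : Hom k P -> U0 z ->
  \sum_i partial i (fun y => (y 0 i * partial j P y) * u y ^+ weight k) z =
  - k%:R * (partial j P z * u z ^+ weight k).
Proof.
move=> hP Uz; have sP := Hom_smooth openT hP; have sjP := smooth_partial j sP.
pose A := partial j P z; pose m := weight k.
have step i : partial i (fun y => (y 0 i * partial j P y) * u y ^+ m) z =
    A * u z ^+ m + (z 0 i * partial i (partial j P) z) * u z ^+ m
     - m%:R * A * u z ^+ m.+2 * z 0 i ^+ 2.
  rewrite (partial_Hom_rad m i (Hom_coord_partial i j hP) Uz).
  rewrite (partialM (smooth_derivable (smooth_coord i openT) (I : setT z))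
    (smooth_derivable sjP I)) partial_coord eqxx /A expr2.
  by rewrite mul1r; ring.
have S1 : \sum_(i < n) A * u z ^+ m = n%:R * (A * u z ^+ m).
  by rewrite sumr_const card_ord [RHS]mulr_natl.
have S2 : \sum_(i < n) z 0 i * partial i (partial j P) z * u z ^+ m =
    (k%:R * A - A) * u z ^+ m.
  by rewrite -mulr_suml; congr (_ * _); exact: Euler_partial.
have S3 : \sum_(i < n) m%:R * A * u z ^+ m.+2 * z 0 i ^+ 2 = m%:R * A * u z ^+ m.
  rewrite -mulr_sumr -/(sqnorm z) -addn2 exprD -mulrA -(mulrA (u z ^+ m)).
  by rewrite [u z ^+ 2 * _]mulrC sqnorm_rad// mulr1.
rewrite (eq_bigr _ (fun i _ => step i)) sumrB big_split /= S1 S2 S3 weightE -/A -/m.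
by ring.
Qed.

(** Differentiating P u^w along j gives (partial j P) u^w - w z_j P u^(w+2).
    By [div_Hom_rad] the first term is a divergence divided by -k, or 0 when
    k = 0, hence annihilated, and the second one has the next degree. As w
    is not 0, all polynomials are reached. For the exponent 2 - n of the
    Newtonian kernel the factor -k would be 1 - k, and only the harmonic
    polynomials would be reached. *)
Lemma annihilated_Hom k : annihilated kappa ->
  forall P, Hom k P -> annihilated (fun z => P z * u z ^+ weight k).
Proof.
move=> ak; elim: k => [|k IH] P.
  move=> /Hom0_cst /(_ erefl) [c Pc].
  apply: annihilated_eq (annihilated_scale c ak) => z _.
  by rewrite Pc /weight double0 addn0.
apply: (@Hom_succ_ind _ _ k (fun P => annihilated (fun z => P z * u z ^+ weight k.+1)))
    => [j {}P hP|P1 P2 a1 a2]; last first.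
  apply: annihilated_eq (annihilated_lin 1 a1 a2) => z _.
  by rewrite mul1r mulrDl.
have w2 : weight k.+1 = (weight k).+2 by rewrite /weight doubleS !addnS.
have m0 : (weight k)%:R != 0 :> R.
  by rewrite pnatr_eq0 /weight addn_eq0 negb_and -lt0n -subn1 subn_gt0 n1.
have ajP : annihilated (fun z => partial j P z * u z ^+ weight k).
  have aS := annihilated_sum ak (fun i => annihilated_partial i
    (IH _ (Hom_coord_partial i j hP))).
  have [k0|k0] := eqVneq k 0%N.
    apply: annihilated_eq (annihilated0 ak) => z _.
    have [c ->] := Hom0_cst hP k0.
    by rewrite partial_cst mul0r.
  apply: annihilated_eq (annihilated_scale (- k%:R^-1) aS) => z Uz.
  rewrite (div_Hom_rad j hP Uz) mulrA mulrNN mulVf ?mul1r//.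
  by rewrite pnatr_eq0.
apply: annihilated_eq (annihilated_scale (weight k)%:R^-1
  (annihilated_lin (-1) (annihilated_partial j (IH _ hP)) ajP)) => z Uz.
rewrite (partial_Hom_rad _ _ hP Uz) w2 mulN1r opprB subrK mulrA mulVf// mul1r.
by [].
Qed.

Lemma fsupp_Theta b y : (forall y, b < `|y - x0| -> Theta y = 0) ->
  fsupp Theta y -> d <= `|y - x0| /\ `|y - x0| <= b.
Proof.
move=> hb ty; split.
  have cd : closed (~` [set y | `|y - x0| < d]) by exact/open_closedC/open_norm_lt.
  have h0 z : ~ (~` [set y | `|y - x0| < d]) z -> Theta z = 0.
    by move=> /contrapT /= zd; rewrite Td// ltW.
  by have /negP := fsupp_sub cd h0 ty; rewrite -leNgt.
have cb : closed (~` [set y | b < `|y - x0|]) by exact/open_closedC/open_norm_gt.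
have h0 z : ~ (~` [set y | b < `|y - x0|]) z -> Theta z = 0.
  by move=> /contrapT /= zd; exact: hb.
by have /negP := fsupp_sub cb h0 ty; rewrite -leNgt.
Qed.

Definition damping z : R := 1 - d ^+ 2 * u z ^+ 2.

Lemma damping_smooth : smooth_on U0 damping.
Proof.
exact: (smoothB U0o (smooth_cst 1 U0o) (smoothZ (d ^+ 2) U0o (@smooth_radX R n 0 2))).
Qed.

Lemma damping_bound b z : 0 < b -> d <= `|z| -> `|z| <= b ->
  `|damping z| <= 1 - d ^+ 2 / (n%:R * (b + d) ^+ 2).
Proof.
move=> b0 dz zb; have z0 : 0 < `|z| := lt_le_trans d0 dz.
have s0 : 0 < sqnorm z.
  by apply: lt_le_trans (norm_le_sqnorm z); rewrite exprn_gt0.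
have ds : d ^+ 2 <= sqnorm z.
  by apply: le_trans (norm_le_sqnorm z); rewrite lerXn2r ?nnegrE// ltW.
have n0 : 0 < n%:R :> R by rewrite ltr0n ltnW.
have bd0 : 0 < b + d by rewrite addr_gt0.
have sb : sqnorm z <= n%:R * (b + d) ^+ 2.
  apply: le_trans (sqnorm_le z) _; rewrite ler_pM2l// lerXn2r ?nnegrE ?(ltW bd0)//.
  by apply: le_trans zb _; rewrite lerDl ltW.
rewrite /damping sqr_rad ?addr0// ger0_norm; last by rewrite subr_ge0 ler_pdivrMr// mul1r.
rewrite lerD2l lerN2 ler_wpM2l ?exprn_ge0 ?(ltW d0)//.
by rewrite lef_pV2 ?posrE// mulr_gt0// exprn_gt0.
Qed.

(** On the annulus carrying [Theta] the function [damping] takes values in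
    [0, q] with q < 1, so that its powers decrease geometrically with all
    their derivatives. As [F] times a power of it pairs to a value
    independent of the exponent, that value is 0. *)
Lemma damping_argument F : smooth_on U0 F ->
  (forall N, L (fun z => F z * u z ^+ 2 * damping z ^+ N) = 0) -> L F = 0.
Proof.
move=> sF hF; have [b b0 hb] := Theta_radius.
have LN N : L (fun z => F z * damping z ^+ N) = L F.
  elim: N => [|N IH]; first by apply: cut_eq => z _; rewrite mulr1.
  rewrite -IH; have s1 := smoothM U0o sF (@smooth_radX R n 0 2).
  have sN := smoothX N U0o damping_smooth.
  have := cut_lin (- d ^+ 2) (smoothM U0o s1 sN) (smoothM U0o sF sN).
  rewrite (hF N) mulr0 add0r => E; apply: etrans E.
  by apply: cut_eq => z _; rewrite exprS /damping; ring.
have [F' tF' EF] := test_annulus d0 b0 sF.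
have [g tg Eg] := test_annulus d0 b0 damping_smooth.
pose phi y := Theta y * F' (y - x0); pose gx y := g (y - x0).
have tphi : test_on setT phi.
  exact: (testT (testM_fsupp (smooth_shift (- x0) (test_smooth tF')) tT)).
have sg : smooth_on setT gx := smooth_shift (- x0) (test_smooth tg).
have n0 : 0 < n%:R :> R by rewrite ltr0n ltnW.
pose q := 1 - d ^+ 2 / (n%:R * (b + d) ^+ 2).
have bd0 : 0 < b + d by rewrite addr_gt0.
have q0 : 0 < q.
  rewrite subr_gt0 ltr_pdivrMr ?mulr_gt0 ?exprn_gt0// mul1r.
  have n1' : 1 <= n%:R :> R by rewrite ler1n ltnW.
  have hd : d ^+ 2 < (b + d) ^+ 2.
    by rewrite ltrXn2r ?nnegrE ?(ltW d0) ?(ltW bd0)// ltrDr.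
  by apply: lt_le_trans hd _; rewrite ler_peMl// exprn_ge0// ltW.
have q1 : q < 1 by rewrite gtrDl oppr_lt0 divr_gt0 ?mulr_gt0 ?exprn_gt0.
pose q' := (1 + q) / 2; have qq' : q < q' by rewrite /q'; lra.
have q'1 : q' < 1 by rewrite /q'; lra.
have gq y : fsupp phi y -> `|gx y| <= q.
  move=> fy; have : fsupp Theta y.
    apply: fsupp_sub fy => [|z nz]; first exact: closed_fsupp.
    by rewrite /phi (fsupp_notin nz) mul0r.
  move=> /(fsupp_Theta hb) [dy yb].
  by rewrite /gx (Eg _ dy yb); exact: damping_bound.
apply: (dist_small dh cT) => m e e0.
have [C hC] := bnd_geometric m tphi sg gq q0 qq'.
have [N hN] := expr_small C (lt_trans q0 qq') q'1 e0.
have E : (fun y => phi y * gx y ^+ N) =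
    (fun y => Theta y * (F (y - x0) * damping (y - x0) ^+ N)).
  apply/funext => y; rewrite /phi /gx -mulrA.
  have [ft|/fsupp_notin ->] := pselect (fsupp Theta y); last by rewrite !mul0r.
  by have [dy yb] := fsupp_Theta hb ft; rewrite EF ?Eg.
exists (fun y => phi y * gx y ^+ N); split.
- rewrite E; apply: (cut_test (psi := fun z => F z * damping z ^+ N)).
  exact: (smoothM U0o sF (smoothX N U0o damping_smooth)).
- exact: (bnd_le (leqnn m) (ltW hN) (hC N)).
- by rewrite E; exact: LN.
Qed.

(** Powers of [damping] may be inserted because |z|^(-2) = |z|^2 |z|^(-4)
    turns [P] into another homogeneous polynomial. Then [damping_argument]
    removes the factors |z|^(-2) one at a time; it sums the geometric series
    of |z|^2 = d^2 / (1 - damping z). *)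
Lemma damped_Hom_eq0 : annihilated kappa -> forall (j N k : nat) P, Hom k P ->
  L (fun z => P z * u z ^+ weight k * sqnorm z ^+ j * damping z ^+ N) = 0.
Proof.
move=> ak.
have sm k P (j N : nat) : Hom k P ->
    smooth_on U0 (fun z => P z * u z ^+ weight k * sqnorm z ^+ j * damping z ^+ N).
  move=> hP; apply: (smoothM U0o _ (smoothX N U0o damping_smooth)).
  apply: (smoothM U0o _ (smoothX j U0o (smooth_sqnorm U0o))).
  exact: (smoothM U0o (Hom_smooth U0o hP) (@smooth_radX R n 0 _)).
elim=> [|j IHj] N k P hP.
  elim: N k P hP => [|N IHN] k P hP.
    transitivity (L (fun z => P z * u z ^+ weight k)).
      by apply: cut_eq => z _; rewrite !mulr1.
    exact: ((annihilated_Hom ak hP).2 [::]).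
  have hP2 := Hom_mulHom hP (Hom_sqnorm (ltnW n1)).
  have := cut_lin (- d ^+ 2) (sm _ _ 0%N N hP2) (sm _ _ 0%N N hP).
  rewrite (IHN _ _ hP2) (IHN _ _ hP) mulr0 addr0 => E; apply: etrans E.
  apply: cut_eq => z Uz.
  have -> : weight (k + 2) = (weight k + 4)%N by rewrite /weight doubleD addnA.
  have e2 := sqnorm_rad Uz; rewrite exprD exprS !expr0 !mulr1.
  rewrite (_ : u z ^+ 4 = u z ^+ 2 * u z ^+ 2); last by rewrite -exprD.
  rewrite {1}/damping; set w := u z ^+ weight k; set D := damping z ^+ N.
  transitivity (- d ^+ 2 * (P z * (sqnorm z * u z ^+ 2) * w * u z ^+ 2 * D) + P z * w * D).
    by rewrite e2; ring.
  by ring.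
pose F z := P z * u z ^+ weight k * sqnorm z ^+ j.+1 * damping z ^+ N.
apply: (damping_argument (F := F)); first exact: sm.
move=> M; apply: etrans (IHj (N + M)%N k P hP); apply: cut_eq => z Uz.
rewrite /F exprD exprS; have e2 := sqnorm_rad Uz.
set w := u z ^+ weight k; set D := damping z ^+ N; set D' := damping z ^+ M.
transitivity (P z * w * (sqnorm z * u z ^+ 2) * sqnorm z ^+ j * D * D'); first by ring.
by rewrite e2; ring.
Qed.

(** With as many factors |z|^2 as the degree requires, the singular weight
    no longer depends on the polynomial. *)
Lemma Pol_eq0 P : annihilated kappa -> Pol P -> 
  smooth_on U0 P /\ L (fun z => u z ^+ n.-1 * P z) = 0.
Proof.
move=> ak; elim=> [k {}P hP|P1 P2 _ [s1 I1] _ [s2 I2]].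
  split; first exact: (Hom_smooth U0o hP).
  apply: etrans (damped_Hom_eq0 ak k 0 hP); apply: cut_eq => z Uz.
  rewrite mulr1 /weight exprD -mul2n exprM -!mulrA; rewrite -exprMn.
  by rewrite [_ * sqnorm z]mulrC sqnorm_rad// expr1n mulr1 mulrC.
split; first exact: (smoothD U0o s1 s2).
have sk := @smooth_radX R n 0 n.-1.
transitivity (1 * L (fun z => u z ^+ n.-1 * P1 z) + L (fun z => u z ^+ n.-1 * P2 z)).
  rewrite -(cut_lin 1 (smoothM U0o sk s1) (smoothM U0o sk s2)).
  by apply: cut_eq => z _; rewrite mul1r mulrDr.
by rewrite I1 I2 mulr0 addr0.
Qed.

(** By [Pol_eq0] the distribution annihilates all polynomials times a fixed
    function, smooth and nowhere zero on the support of [Theta]; polynomials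
    approximate test functions there with all derivatives. *)
Lemma density psi : annihilated kappa -> test_on setT psi ->
  h (fun x => Theta x * psi x) = 0.
Proof.
move=> ak; have [b b0 hb] := Theta_radius.
have sk := @smooth_radX R n 0 n.-1.
have main phi : test_on setT phi -> L (fun z => u z ^+ n.-1 * phi z) = 0.
  move=> tp; apply: (dist_small dh cT) => m e e0.
  have [A tA EA] := cut_rep sk.
  have sT := test_smooth tT; have sAx := smooth_shift (- x0) (test_smooth tA).
  have tTA : test_on setT (fun y => Theta y * A (y - x0)).
    exact: (testT (testM_fsupp sAx tT)).
  have [B hB] := test_bnd m tTA; have B0 := bnd_ge0 hB.
  have B1 : 0 < 2 ^+ m * (B + 1) by rewrite mulr_gt0 ?exprn_gt0// ltr_wpDl.
  have [F [P [sF pP FP hF]]] := weierstrass m tp b0 (divr_gt0 e0 B1).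
  have [sP LP] := Pol_eq0 ak pP.
  have sphi := test_smooth tp.
  have sFp : smooth_on setT (fun z => F z - phi z) := smoothB openT sF sphi.
  exists (fun y => Theta y * A (y - x0) * (-1 * (F (y - x0) - phi (y - x0)))).
  have sX := smooth_shift (- x0) (smoothZ (-1) openT sFp).
  split.
  - have -> : (fun y => Theta y * A (y - x0) * (-1 * (F (y - x0) - phi (y - x0)))) =
        (fun y => Theta y * (A (y - x0) * (-1 * (F (y - x0) - phi (y - x0))))).
      by apply/funext => y; rewrite mulrA.
    exact: (testM_fsupp (smoothM openT sAx sX) tT).
  - have hX : bnd m (fun y => -1 * (F (y - x0) - phi (y - x0))) (e / (2 ^+ m * (B + 1))).
      move=> s x sm; rewrite (partials_shift s (fun z => -1 * (F z - phi z)) (- x0) x).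
      rewrite (partialsZ (-1) s openT sFp I) mulN1r normrN.
      exact: hF.
    apply: (bnd_le (leqnn m) _ (bndM (test_smooth tTA) sX hB hX)).
    rewrite mulrA mulrCA ger_pMr// mulrC mulrC ler_pdivrMr// mul1r.
    by rewrite ler_pM2l ?exprn_gt0// lerDl.
  transitivity (- 1 * L (fun z => u z ^+ n.-1 * P z) + L (fun z => u z ^+ n.-1 * phi z)).
    rewrite -(cut_lin (- 1) (smoothM U0o sk sP) (smoothM U0o sk (smooth_onW (@subsetT _ _) sphi))).
    congr h; apply/funext => y; rewrite -EA.
    have [yb|yb] := leP `|y - x0| b; last by rewrite hb// !mul0r.
    by rewrite (FP _ yb); ring.
  by rewrite LP mulr0 add0r.
move=> tpsi; pose psi1 z := psi (z + x0).
have s1 : smooth_on setT psi1 := smooth_shift x0 (test_smooth tpsi).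
have s2 : smooth_on U0 (fun z => (sqnorm z * u z) ^+ n.-1 * psi1 z).
  apply: (smoothM U0o _ (smooth_onW (@subsetT _ _) s1)).
  exact: (smoothX _ U0o (smoothM U0o (smooth_sqnorm U0o) (@smooth_rad R n 0))).
have [phi tphi E] := test_annulus d0 b0 s2.
apply: etrans (main phi tphi); congr h; apply/funext => y.
have [yd|yd] := leP `|y - x0| d; first by rewrite Td// !mul0r.
have [yb|yb] := leP `|y - x0| b; last by rewrite hb// !mul0r.
have Uy : U0 (y - x0).
  by apply/rad_dom0P; rewrite -normr_gt0 (lt_trans d0).
rewrite (E _ (ltW yd) yb) /psi1 subrK.
rewrite [u _ ^+ _ * (_ * _)]mulrA -exprMn [u _ * (_ * _)]mulrCA -expr2.
by rewrite sqnorm_rad// expr1n mul1r.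
Qed.

End density.

(** * Primitives of closed fields *)

Section segments.
Context {R : realType} {n : nat}.
Local Notation Rn := 'rV[R]_n.
Local Notation ei i := (delta_mx 0 i : 'rV[R]_n).
Local Notation leb := (@lebesgue_measure R).
Implicit Types (x y z : Rn) (i j : 'I_n) (psi : Rn -> R) (M : R).

Definition ray i psi x : R :=
  (\int[leb]_t (\1_(`[0%R, +oo[%classic : set (measurableTypeR R)) t * psi (x + (t : R) *: ei i)))%R.

Definition segment M : measurableTypeR R -> R := \1_(`[0%R, M]%classic).

Definition seg i M : (Rn -> R) -> Rn -> R :=
  par leb (segment M) (fun t => (t : R) *: ei i).

Lemma integrable_segment M : leb.-integrable setT (EFin \o segment M).
Proof.
apply/integrableP; split.
  by apply/measurable_EFinP; apply: measurable_indic; exact: measurable_itv.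
under eq_integral => t _ do rewrite /= ger0_norm ?indicE//.
rewrite integral_indic//= setIT lebesgue_measure_itv /=.
by case: ifP => _; rewrite ltry.
Qed.

Lemma measurable_line i j :
  measurable_fun setT (fun t : measurableTypeR R => ((t : R) *: ei i) 0 j).
Proof.
have -> : (fun t : measurableTypeR R => ((t : R) *: ei i) 0 j) =
    (fun t : R => t * ei i 0 j).
  by apply/funext => t; rewrite mxE.
by apply: measurable_realfun.measurable_funM.
Qed.

Lemma seg_bsmooth i M psi : bsmooth psi -> bsmooth (seg i M psi).
Proof. by move=> bp; exact: (par_bsmooth (integrable_segment M) (measurable_line i) bp). Qed.

Lemma seg_partial i j M psi : bsmooth psi ->
  partial j (seg i M psi) = seg i M (partial j psi).
Proof. by move=> bp; exact: (par_partial (integrable_segment M) (measurable_line i) j bp). Qed.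

Lemma seg_partial_self i M psi x : bsmooth psi -> 0 < M ->
  seg i M (partial i psi) x = psi (x + M *: ei i) - psi x.
Proof.
move=> bp M0; have sp := bp.1.
pose F (t : R) := psi (x + t *: ei i).
pose G (t : R) := partial i psi (x + t *: ei i).
have dF (t : R) : is_derive t (1 : R) F (G t).
  exact/is_derive_line/(is_derive_partial i sp I).
have dG (t : R) : is_derive t (1 : R) G (partial i (partial i psi) (x + t *: ei i)).
  exact/is_derive_line/(is_derive_partial i (smooth_partial i sp) I).
have cF : continuous F.
  by move=> t; apply: differentiable_continuous; apply/derivable1_diffP; have [] := dF t.
have cG : continuous G.
  by move=> t; apply: differentiable_continuous; apply/derivable1_diffP; have [] := dG t.
have -> : seg i M (partial i psi) x = (\int[leb]_(t in `[0%R, M]) G t)%R.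
  rewrite Rintegral_mkcond /seg /par; apply: eq_Rintegral => t _.
  by rewrite /segment indicE patchE; case: ifP; rewrite ?mul1r ?mul0r.
rewrite /Rintegral (@continuous_FTC2 _ G F 0 M M0).
- by rewrite /F scale0r addr0.
- exact: continuous_subspaceT.
- split.
  + by move=> t _; have [] := dF t.
  + exact: cvg_at_right_filter (cF 0).
  + exact: cvg_at_left_filter (cF M).
- by move=> t _; rewrite derive1E; have [_ ->] := dF t.
Qed.

Lemma seg_diff i M (v x : Rn) psi : bsmooth psi ->
  seg i M (fun y => psi (y + v) - psi y) x = seg i M psi (x + v) - seg i M psi x.
Proof.
move=> bp; rewrite /seg.
rewrite (par_sub (integrable_segment M) (measurable_line i) (x + v) x bp bp).
by apply: eq_Rintegral => t _; rewrite [x + v + _]addrAC.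
Qed.

Lemma seg_lin i M (a : R) x psi1 psi2 : bsmooth psi1 -> bsmooth psi2 ->
  seg i M (fun y => a * psi1 y + psi2 y) x = a * seg i M psi1 x + seg i M psi2 x.
Proof.
move=> b1 b2; rewrite /seg /par.
have i1 := integrable_par (integrable_segment M) (measurable_line i) x b1.
have i2 := integrable_par (integrable_segment M) (measurable_line i) x b2.
rewrite -RintegralZl// -RintegralD//; last first.
  by have := integrableZl measurableT a i1; congr (_.-integrable _ _).
by apply: eq_Rintegral => t _; rewrite mulrDr mulrCA.
Qed.

Lemma ray_seg i psi (rho b M : R) y : (forall x, rho < `|x| -> psi x = 0) ->
  `|y| <= b -> b + rho <= M -> ray i psi y = seg i M psi y.
Proof.
move=> hp yb bM; apply: eq_Rintegral => t _; rewrite /segment !indicE.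
have [tM|Mt] := leP t M.
  congr (_%:R * _); congr nat_of_bool.
  by apply/idP/idP; rewrite !inE /= !in_itv /= tM !andbT.
rewrite hp ?mulr0//.
have : `|(y + (t : R) *: ei i) 0 i| <= `|y + (t : R) *: ei i| by exact: coord_le_norm.
have := coord_le_norm y i; rewrite !mxE !eqxx mulr1.
by have := ler_norm (y 0 i + t); have := ler_norm (- y 0 i); rewrite normrN; lra.
Qed.

Lemma seg_eq0 i M psi x : (forall t : R, psi (x + t *: ei i) = 0) -> seg i M psi x = 0.
Proof.
move=> h; have i0 : (\int[leb]_(t in setT) (0 : R))%R = 0 by rewrite /Rintegral integral0.
by rewrite -[RHS]i0 /seg /par; apply: eq_Rintegral => t _; rewrite h mulr0.
Qed.

Lemma seg_far i j (M M' rho b : R) psi y : i != j ->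
  (forall x, rho < `|x| -> psi x = 0) -> `|y| <= b -> b + rho < M ->
  seg j M' psi (y + M *: ei i) = 0.
Proof.
move=> ij hp yb bM; apply: seg_eq0 => t; rewrite hp//.
set z := y + _ + _.
have : `|z 0 i| <= `|z| by exact: coord_le_norm.
have := coord_le_norm y i; rewrite !mxE !eqxx (negbTE ij) andbF mulr0 mulr1 addr0.
by have := ler_norm (y 0 i + M); have := ler_norm (- y 0 i); rewrite normrN; lra.
Qed.

End segments.

Section primitive.
Context {R : realType} {n : nat}.
Local Notation Rn := 'rV[R]_n.
Local Notation ei i := (delta_mx 0 i : 'rV[R]_n).
Local Notation leb := (@lebesgue_measure R).
Implicit Types (x y z : Rn) (i j k l : 'I_n) (g psi : Rn -> R) (M : R).
Context (f : 'I_n -> functional R n) (r b : R) (chi : Rn -> R).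
Hypotheses (df : forall i, Defs.distribution (f i))
  (vf : forall i, vanishes_on (~` [set x | `|x| <= r]) (f i))
  (cchi : cutoff [set x | `|x| <= r] chi)
  (r0 : 0 < r) (b0 : 0 < b) (chib : forall x, b < `|x| -> chi x = 0)
  (clf : forall i j psi, test_on setT psi -> ext_diff1 f i j psi = 0).

Let schi : smooth_on setT chi := cutoff_smooth cchi.

Lemma dist_Leibniz k l g : smooth_on setT g ->
  f k (partial l (fun x => chi x * g x)) = f k (fun x => chi x * partial l g x).
Proof.
move=> sg; have [lin _] := df k; have [tc [W [Wo KW cW]]] := cchi.
have t1 : test_on setT (fun x => partial l chi x * g x).
  have -> : (fun x => partial l chi x * g x) = (fun x => g x * partial l chi x).
    by apply/funext => x; exact: mulrC.
  exact: (testMr sg (test_partial l tc)).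
have t2 : test_on setT (fun x => chi x * partial l g x).
  exact: (cutoffM cchi (smooth_partial l sg)).
have -> : partial l (fun x => chi x * g x) =
    (fun x => 1 * (partial l chi x * g x) + chi x * partial l g x).
  apply/funext => x; rewrite mul1r.
  exact: (partialM (smooth_derivable schi I) (smooth_derivable sg I)).
rewrite (lin 1 _ _ t1 t2) (dist_zero_near (vf k) Wo KW t1) ?mulr0 ?add0r// => x Wx.
by rewrite (partial_eq_on l Wo cW Wx) partial_cst mul0r.
Qed.

(** Closedness, tested against a function whose support need not be compact. *)
Lemma closed_swap k l g : smooth_on setT g ->
  f k (fun x => chi x * partial l g x) = f l (fun x => chi x * partial k g x).
Proof.
move=> sg; rewrite -(dist_Leibniz k l sg) -(dist_Leibniz l k sg).
have := clf k l (cutoffM cchi sg); rewrite /ext_diff1 /dist_partial opprK => /eqP.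
by rewrite addrC subr_eq0 => /eqP.
Qed.

(** The primitive of [f i] along [ei i] that vanishes far in the negative
    direction, by transposition: the test function is integrated along
    forward rays. *)
Definition ray_pairing i : functional R n := fun psi => f i (fun x => chi x * ray i psi x).

Lemma ray_pairing_seg i psi (rho M : R) : (forall x, rho < `|x| -> psi x = 0) ->
  b + rho <= M -> ray_pairing i psi = f i (fun x => chi x * seg i M psi x).
Proof.
move=> hp bM; congr (f i); apply/funext => x.
have [xb|xb] := leP `|x| b; last by rewrite chib// !mul0r.
by rewrite (ray_seg i hp xb bM).
Qed.

Lemma far_partials psi (rho : R) j : (forall x, rho < `|x| -> psi x = 0) ->
  forall x, rho < `|x| -> partial j psi x = 0.
Proof.
move=> hp x xr.
have Uo : open [set y : Rn | rho < `|y - 0|] by exact: open_norm_gt.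
rewrite (partial_eq_on j Uo (g2 := fun=> 0) _ (x := x)) ?partial_cst//.
  by move=> y /=; rewrite subr0; exact: hp.
by rewrite /= subr0.
Qed.

(** For [j] equal to [i] this is the fundamental theorem of calculus;
    [closed_swap] reduces the other directions to it. *)
Lemma ray_pairing_partial i j psi : test_on setT psi ->
  ray_pairing i (partial j psi) = - f j psi.
Proof.
move=> tp; have [rho rho0 hp] := test_far tp.
have bp := test_bsmooth tp.
pose M := b + rho + 1.
have bM : b + rho <= M by rewrite /M lerDl.
have M0 : 0 < M by rewrite /M !addr_gt0.
rewrite (ray_pairing_seg i (far_partials j hp) bM).
have -> : (fun x => chi x * seg i M (partial j psi) x) =
    (fun x => chi x * partial j (seg i M psi) x) by rewrite seg_partial.
rewrite (closed_swap i j (seg_bsmooth i M bp).1) seg_partial//.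
have [lin _] := df j; have [tc [W [Wo KW cW]]] := cchi.
have t0 := test0 (setT : set Rn).
have tcp : test_on setT (fun x => chi x * psi x) := cutoffM cchi (test_smooth tp).
transitivity (- 1 * f j (fun x => chi x * psi x)).
  transitivity (f j (fun x => - 1 * (chi x * psi x) + 0)); last first.
    by rewrite (lin (- 1) _ _ tcp t0) (dist0 (df j)) addr0.
  congr (f j); apply/funext => x; rewrite (seg_partial_self i x bp M0) addr0.
  have [xb|xb] := leP `|x| b; last by rewrite chib// !mul0r mulr0.
  rewrite hp; first by rewrite sub0r mulrN mulN1r.
  have : `|(x + M *: ei i) 0 i| <= `|x + M *: ei i| by exact: coord_le_norm.
  have := coord_le_norm x i; rewrite !mxE !eqxx mulr1 /M.
  have := ler_norm (x 0 i + (b + rho + 1)); have := ler_norm (- x 0 i).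
  by rewrite normrN; lra.
rewrite mulN1r; congr (- _).
have td : test_on setT (fun x => chi x * psi x - psi x).
  exact: (testB tcp tp).
apply/eqP; rewrite -subr_eq0 -(distB (df j) tcp tp); apply/eqP.
by apply: (dist_zero_near (vf j) Wo KW td) => x Wx; rewrite cW// mul1r subrr.
Qed.

(** Both sides are [f i] and [f j] paired with the derivatives of one double
    integral, over a large square in the plane of [ei i] and [ei j]. *)
Lemma ray_pairing_indep i j psi : i != j -> test_on setT psi ->
  ray_pairing i psi = ray_pairing j psi.
Proof.
move=> ij tp; have [rho rho0 hp] := test_far tp.
have bp := test_bsmooth tp.
pose M := b + rho + 1.
have bM : b + rho < M by rewrite /M ltrDl.
have M0 : 0 < M by rewrite /M !addr_gt0.
rewrite (ray_pairing_seg i hp (ltW bM)) (ray_pairing_seg j hp (ltW bM)).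
pose B := seg j M (seg i M psi).
have bi := seg_bsmooth i M bp.
have sB : smooth_on setT B := (seg_bsmooth j M bi).1.
have ji : j != i by rewrite eq_sym.
have E1 : (fun x => chi x * seg i M psi x) = (fun x => - 1 * (chi x * partial j B x) + 0).
  apply/funext => x; rewrite /B seg_partial// (seg_partial_self j x bi M0).
  have [xb|xb] := leP `|x| b; last by rewrite chib// !mul0r mulr0 addr0.
  by rewrite (seg_far M ji hp xb bM) sub0r mulrN mulN1r opprK addr0.
have E2 : (fun x => chi x * seg j M psi x) = (fun x => - 1 * (chi x * partial i B x) + 0).
  apply/funext => x; rewrite /B seg_partial// seg_partial//.
  have [xb|xb] := leP `|x| b; last by rewrite chib// !mul0r mulr0 addr0.
  have -> : seg j M (seg i M (partial i psi)) x = - seg j M psi x.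
    have -> : seg i M (partial i psi) = (fun y => psi (y + M *: ei i) - psi y).
      by apply/funext => y; exact: seg_partial_self.
    by rewrite (seg_diff j M _ x bp) (seg_far M ij hp xb bM) sub0r.
  by rewrite mulrN mulN1r opprK addr0.
have t0 := test0 (setT : set Rn).
have [lini _] := df i; have [linj _] := df j.
rewrite E1 E2 (lini _ _ _ (cutoffM cchi (smooth_partial j sB)) t0).
rewrite (linj _ _ _ (cutoffM cchi (smooth_partial i sB)) t0).
by rewrite (dist0 (df i)) (dist0 (df j)) (closed_swap i j sB).
Qed.

Lemma ray_pairing_distribution i : Defs.distribution (ray_pairing i).
Proof.
apply: distributionI => [a phi psi tphi tpsi|K cK].
  have [rho1 _ h1] := test_far tphi; have [rho2 _ h2] := test_far tpsi.
  pose rho := Num.max rho1 rho2.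
  have g1 x : rho < `|x| -> phi x = 0 by rewrite gt_max => /andP[? _]; exact: h1.
  have g2 x : rho < `|x| -> psi x = 0 by rewrite gt_max => /andP[_ ?]; exact: h2.
  have g x : rho < `|x| -> a * phi x + psi x = 0.
    by move=> xr; rewrite g1// g2// mulr0 addr0.
  have bM := lexx (b + rho).
  have b1 := test_bsmooth tphi; have b2 := test_bsmooth tpsi.
  rewrite (ray_pairing_seg i g bM) (ray_pairing_seg i g1 bM) (ray_pairing_seg i g2 bM).
  have [lin _] := df i.
  rewrite -(lin a _ _ (cutoffM cchi (seg_bsmooth i _ b1).1) (cutoffM cchi (seg_bsmooth i _ b2).1)).
  congr (f i); apply/funext => x; rewrite (seg_lin i _ a x b1 b2); ring.
have [rho [rho0 Kr]] : exists rho : R, 0 < rho /\ K `<=` [set x | `|x| <= rho].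
  have [rho rho0 h] := compact_le_norm cK; exists rho; split=> // x Kx; exact: h.
have tc : test_on setT chi := cchi.1.
have cc : compact (fsupp chi) by have [_ ? _] := tc.
have [C [m [C0 hC]]] := dist_bnd (df i) cc.
have [D hD] := test_bnd m tc.
pose M := b + rho; pose I0 := mass leb (segment M).
exists (C * (2 ^+ m * (D * I0))), m => phi B tK hB.
have hp x : rho < `|x| -> phi x = 0.
  by move=> xr; apply: (test_zero tK) => /Kr /=; rewrite leNgt xr.
have bp := test_bsmooth (testT tK).
rewrite (ray_pairing_seg i hp (lexx M)) -!mulrA; apply: hC.
  exact: (testM_fsupp (seg_bsmooth i M bp).1 tc).
apply: (bndM schi (seg_bsmooth i M bp).1 hD).
exact: (par_bnd (integrable_segment M) (measurable_line i) bp hB).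
Qed.

(** A ray in direction [ei i] that starts where [chi] does not vanish meets
    the support of [psi] only where the i-th coordinate is large. The part
    of [psi] over that region is out of reach of the rays in direction [ei
    j] that start near the supports of the distributions, and the two
    directions give the same pairing. *)
Lemma ray_pairing_support i j : i != j ->
  vanishes_on (~` [set x | `|x| <= b + r + 2]) (ray_pairing i).
Proof.
move=> ij psi tp0; have tp := testT tp0.
have hp x : `|x| <= b + r + 2 -> psi x = 0.
  by move=> xb; apply: (test_zero tp0); apply.
have r12 : r + 1 < r + 2 by rewrite ltrD2l ltr1n.
have [c [sc _ c1 c0]] := level_cutoff (smooth_coord i (@openT Rn)) r12.
pose eta x := (1 - c x) * psi x.
have teta : test_on setT eta := testMr (smoothB openT (smooth_cst 1 openT) sc) tp.
have [rho rho0 hr] := test_far tp.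
have er x : rho < `|x| -> eta x = 0 by move=> /hr; rewrite /eta => ->; rewrite mulr0.
pose M := b + rho.
transitivity (ray_pairing i eta).
  congr (f i); apply/funext => x.
  have [xb|xb] := leP `|x| b; last by rewrite chib// !mul0r.
  congr (chi x * _); apply: eq_Rintegral => t _; rewrite indicE.
  have [|_] := boolP (t \in _); last by rewrite !mul0r.
  rewrite inE /= in_itv /= andbT => t0; congr (_ * _); rewrite /eta.
  set z := x + _; have [zi|zi] := leP (r + 2) (z 0 i); first by rewrite c0// subr0 mul1r.
  rewrite hp ?mulr0//; apply: norm_le_coord => [|k].
    by rewrite !addr_ge0// ltW.
  have := coord_le_norm x k; rewrite ler_norml => /andP[x1 x2].
  rewrite ler_norml; have [e|ki] := eqVneq k i.
    move: zi t0 x1 x2; rewrite e /z !mxE !eqxx mulr1 => zi t0 x1 x2.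
    have tR : 0 <= (t : R) := t0; have ri := r0; have bi := b0.
    by apply/andP; split; lra.
  rewrite /z !mxE eqxx (negbTE ki) mulr0 addr0; have ri := r0.
  by apply/andP; split; lra.
rewrite (ray_pairing_indep ij teta) (ray_pairing_seg j er (lexx _)).
have Wo : open [set x : Rn | `|x - 0| < r + 1] by exact: open_norm_lt.
apply: (dist_zero_near (vf j) Wo) => [x /=|| x /=].
- by rewrite subr0 => xr; rewrite (le_lt_trans xr)// ltrDl.
- exact: (cutoffM cchi (seg_bsmooth j _ (test_bsmooth teta)).1).
rewrite subr0 => xr.
rewrite seg_eq0 ?mulr0// => t; rewrite /eta c1 ?subrr ?mul0r//.
rewrite !mxE eqxx (negbTE ij) mulr0 addr0 (le_trans (ler_norm _))//.
by rewrite (le_trans (coord_le_norm _ _))// ltW.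
Qed.

End primitive.

(** The primitive is obtained by integration along one coordinate direction.
    Its support is compact because a second direction yields the same
    primitive. *)
Lemma poincare {R : realType} {n : nat} (f : 'I_n -> functional R n) (i j : 'I_n) :
  i != j -> (forall k, compact_distribution (f k)) ->
  (forall k l psi, test_on setT psi -> ext_diff1 f k l psi = 0) ->
  exists2 phi : functional R n, compact_distribution phi &
    forall k, dist_eq (f k) (dist_partial k phi).
Proof.
move=> ij hf clf; have [r r0 vf] := common_support hf.
have df k : Defs.distribution (f k) by have [] := hf k.
have [chi cchi] := @ball_cutoff R n r r0.
have [b b0 chib] := test_far cchi.1.
exists (ray_pairing f chi i); last first.
  move=> k psi tp.
  by rewrite /dist_partial (ray_pairing_partial df vf cchi b0 chib clf i k tp) opprK.
split; first exact: (ray_pairing_distribution df cchi chib i).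
exists [set x | `|x| <= b + r + 2]; first exact: compact_norm_le.
exact: (ray_pairing_support df vf cchi r0 b0 chib clf ij).
Qed.

(** * Unique continuation for the normal operator *)

Section unique_continuation.
Context {R : realType} {n : nat}.
Local Notation Rn := 'rV[R]_n.
Implicit Types (x y : Rn) (k l : 'I_n) (U V : set Rn) (psi omega : Rn -> R).
Hypothesis n1 : (1 < n)%N.

Lemma integral_Rn_lin (a c : R) psi1 psi2 :
  test_on setT psi1 -> test_on setT psi2 ->
  integral_Rn (fun x => a * psi1 x + c * psi2 x) =
  a * integral_Rn psi1 + c * integral_Rn psi2.
Proof.
move=> t1 t2; have s1 := testZ a t1; have s2 := testZ c t2.
rewrite -(integral_RnZ a t1) -(integral_RnZ c t2) !integral_RnE -RintegralD//.
- exact: (intRn_test s1).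
- exact: (intRn_test s2).
Qed.

(** By [normal_op1_curl] the convolution of [kappa] with a component of the
    exterior derivative is near [x0] a combination of derivatives of
    components of the normal operator, so that it vanishes to infinite order
    there. Then [annihilates_derivatives] and [density] apply. *)
Lemma ext_diff_eq0 (f : 'I_n -> functional R n) V x0 k l :
  (forall i, compact_distribution (f i)) -> open V -> V x0 ->
  (forall i j, vanishes_on V (ext_diff1 f i j)) ->
  vanishes_infinite_order (normal_op1 f) x0 ->
  forall psi, test_on setT psi -> ext_diff1 f k l psi = 0.
Proof.
move=> hf Vo Vx hV [U [g [Uo Ux hg]]]; set h := ext_diff1 f k l.
have [r r0 vf] := common_support hf.
have df i : Defs.distribution (f i) by have [] := hf i.
have [chi cchi] := @ball_cutoff R n r r0.
have cK := @compact_norm_le R n r.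
have UVo : open (U `&` V) by exact: openI.
have [|e e0 eUV] := (openP (U `&` V)).1 UVo x0; first by [].
have eU : [set x | `|x - x0| < e] `<=` U by move=> x /eUV[].
have eV : [set x | `|x - x0| < e] `<=` V by move=> x /eUV[].
have sg i : smooth_on U (g i) by have [] := hg i.
have k0 : kcoef (R := R) (n := n) != 0.
  rewrite /kcoef gt_eqF// divr_gt0// ltr0n -subn1 subn_gt0 //.
pose c := (kcoef (R := R) (n := n))^-1.
have sk := smooth_partial k (sg l); have sl := smooth_partial l (sg k).
pose G x := c * partial k (g l) x + (fun y => - c * partial l (g k) y) x.
have sG : smooth_on U G := smoothD Uo (smoothZ c Uo sk) (smoothZ (- c) Uo sl).
have G0 s : partials s G x0 = 0.
  rewrite (partials_lin c s Uo sk (smoothZ (- c) Uo sl) Ux) (partialsZ (- c) s Uo sl Ux).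
  rewrite -!partials_rcons !(partials_mpartial _ Uo _ Ux); try exact: sg.
  have [_ _ ->] := hg l; have [_ _ ->] := hg k.
  by rewrite !mulr0 addr0.
have hG omega : test_on [set x | `|x - x0| < e] omega ->
    h (fun x => chi x * Conv kappa omega x) = integral_Rn (fun x => G x * omega x).
  move=> tw; have tU := testW eU tw; have tT := testT tw.
  have := normal_op1_curl n1 k l df cK vf cchi tT.
  have [_ El _] := hg l; have [_ Ek _] := hg k.
  rewrite (El _ (test_partial k tU)) (Ek _ (test_partial l tU)).
  rewrite (integral_Rn_by_parts k Uo (sg l) tU) (integral_Rn_by_parts l Uo (sg k) tU).
  have t1 := testT (testM Uo sk tU); have t2 := testT (testM Uo sl tU).
  rewrite -/h; set A := integral_Rn _ in t1 *; set B := integral_Rn _; set H := h _ => E.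
  have -> : integral_Rn (fun x => G x * omega x) = c * A - c * B.
    rewrite -mulNr -(integral_Rn_lin c (- c) t1 t2); congr integral_Rn.
    by apply/funext => x; rewrite /G; ring.
  apply: (mulfI k0); rewrite -mulrBr mulVKf//.
  by apply: oppr_inj; rewrite -mulNr -E opprB opprK addrC.
have dh : Defs.distribution h by exact: ext_diff_distribution.
have vh : vanishes_on (~` [set x | `|x| <= r]) h by exact: ext_diff_vanishes.
have vh' : vanishes_on [set x | `|x - x0| < e] h by exact: vanishes_onW (hV k l).
have [Th [d [tT dpos Thd hT hs]]] :=
  annihilates_derivatives n1 dh e0 vh vh' cchi (smooth_onW eU sG) G0 hG.
move=> psi tp; rewrite hT//; apply: (density n1 dh tT dpos Thd) => //.
by split=> [|s]; [exact: smooth_kappa|exact: hs].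
Qed.

End unique_continuation.

Theorem theorem1p1 (R : realType) (n : nat) (hn : (2 <= n)%N)
    (f : 'I_n -> functional R n) (hf : forall i, compact_distribution (f i))
    (V : set 'rV[R]_n) (hVo : open V) (hV0 : V !=set0)
    (hdf : forall i j, vanishes_on V (ext_diff1 f i j))
    (x0 : 'rV[R]_n) (hx0 : V x0)
    (hN : vanishes_infinite_order (normal_op1 f) x0) :
  exists2 phi : functional R n, compact_distribution phi &
    forall i, dist_eq (f i) (dist_partial i phi).
Proof.
have i01 : Ordinal (ltnW hn) != Ordinal hn by [].
apply: (poincare i01 hf) => k l psi tp.
exact: (ext_diff_eq0 hn k l hf hVo hx0 hdf hN tp).
Qed.
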